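(* Let $T>0$, $\Omega=\frac{3\pi}{2T}$, $L=\frac{21}{10}T$, $\delta=\frac{9}{100}T$, and let $\chi(t)=\cos^2(\pi t/2T)$ for $|t|\le T$, $\chi(t)=0$ for $|t|>T$. Let $\mathcal H(s)$, $\mathcal Q(s)$, $\mathcal P$ and $\bar g(s)=\sqrt{\mathcal H(s)^2+\mathcal Q(s)^2}-\mathcal P$ be as defined in the context for these data. Let $\Gamma>0$ and $\lambda\ne 0$ be arbitrary constants independent of the delay, and for $\tau\in\mathbb R$ set $g_0=\Gamma\lambda^2\bar g(\tau)$, $g_\pm=\Gamma\lambda^2\bar g(\tau\pm\delta)$. Then the three-action timing game with parameters $(g_0,g_+,g_-)$ defined in the context has the following number $N_{\rm THP}$ of trembling-hand perfect equilibria (pure or mixed), with the following behaviour of the active rewards: 1. $\tau=0$: $g_-=g_+>g_0>0$, and $N_{\rm THP}=7$; 2. $\tau=L-T$: $g_->g_0>g_+>0$, and $N_{\rm THP}=3$; 3. $\tau=L$: $g_-,g_0,g_+<0$, and $N_{\rm THP}=1$; 4. $\tau=L+T$: $g_0>\max(g_-,g_+)$ and $\min(g_-,g_+)>0$, and $N_{\rm THP}=7$; 5. $\tau=2L$: $g_-,g_0,g_+<0$, and $N_{\rm THP}=1$.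
   Context: Response functions. For a pulse $\chi$ supported on $[-T,T]$ define $$\mathcal C_\Omega(\zeta)=\int_{\mathbb R}\chi(z+\zeta/2)\,\chi(z-\zeta/2)\cos(2\Omega z)\,dz,$$ which is supported on $[-2T,2T]$, and $$\mathcal H(s)=\frac1{4\pi^2}\,\mathrm{PV}\!\int_{-2T}^{2T}\frac{\mathcal C_\Omega(\zeta)\,d\zeta}{L^2-(\zeta-s)^2},\qquad \mathcal Q(s)=-\frac{\mathcal C_\Omega(s-L)+\mathcal C_\Omega(s+L)}{8\pi L},$$ where $\mathrm{PV}$ is the Cauchy principal value (symmetric exclusion around each simple pole), and $$\mathcal P=\frac1{4\pi^2}\int_0^\infty k\,|\widetilde\chi(\Omega+k)|^2\,dk,\qquad \widetilde\chi(\omega)=\int_{\mathbb R}\chi(t)e^{i\omega t}\,dt .$$ Game. Given real $g_0,g_+,g_-$, the three-action timing game has two players (Alice, Bob), each with actions $E$ (exit), $0$ (early entry), $1$ (late entry). With rows (Alice's action) and columns (Bob's action) ordered $(E,0,1)$, the payoff matrices are $$\mathsf A=\begin{pmatrix}0&0&0\\-1&g_0&g_+\\-1&g_-&g_0\end{pmatrix}\ (\text{Alice}),\qquad \mathsf B=\begin{pmatrix}0&-1&-1\\0&g_0&g_+\\0&g_-&g_0\end{pmatrix}\ (\text{Bob}).$$ A strategy profile (pair of probability distributions on actions) is trembling-hand perfect if it is the limit of a sequence of completely mixed profiles such that, along the sequence, every action in the support of each player's limit strategy is a best response to the other player's completely mixed strategy. *)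

(* Defs.v *)
(* Stdlib's real numbers [R], with Coquelicot for integrals and limits. *)
From Stdlib Require Export Reals Finite_sets.
From Coquelicot Require Export Coquelicot.
Open Scope R_scope.

(** * Response functions *)

Definition cos2_pulse (T t : R) : R :=
  if Rle_dec (Rabs t) T then cos (PI * t / (2 * T)) ^ 2 else 0.

Definition RInt_line {V : CompleteNormedModule R_AbsRing} (f : R -> V) : V :=
  RInt_gen f (Rbar_locally m_infty) (Rbar_locally p_infty).

Definition corr (chi : R -> R) (Omega zeta : R) : R :=
  RInt_line (fun z =>
    chi (z + zeta / 2) * chi (z - zeta / 2) * cos (2 * Omega * z)).

(* The integrand is set to 0 within distance [eps] of [p] or [q], so a pole
   outside [a, b] has no effect once [eps] is small, and the same exclusion
   radius is used on both sides of each pole. *)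
Definition PV_truncated (p q : R) (f : R -> R) (a b eps : R) : R :=
  RInt (fun x => if Rlt_dec eps (Rmin (Rabs (x - p)) (Rabs (x - q)))
                 then f x else 0) a b.

Definition is_PV (p q : R) (f : R -> R) (a b l : R) : Prop :=
  filterlim (PV_truncated p q f a b) (at_right 0) (locally l).

(* Like [RInt] and [RInt_gen], a total function: the unique [l] such that
   [is_PV p q f a b l] when there is one. *)
Definition PV (p q : R) (f : R -> R) (a b : R) : R := iota (is_PV p q f a b).

Definition resp_H (chi : R -> R) (T Omega L s : R) : R :=
  1 / (4 * PI ^ 2) *
  PV (s - L) (s + L)
     (fun zeta => corr chi Omega zeta / (L ^ 2 - (zeta - s) ^ 2))
     (- (2 * T)) (2 * T).

Definition resp_Q (chi : R -> R) (Omega L s : R) : R :=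
  - ((corr chi Omega (s - L) + corr chi Omega (s + L)) / (8 * PI * L)).

Definition expi (x : R) : C := (cos x, sin x).

Definition fourier (chi : R -> R) (omega : R) : C :=
  RInt_line (V := C_R_CompleteNormedModule)
    (fun t => (RtoC (chi t) * expi (omega * t))%C).

Definition resp_P (chi : R -> R) (Omega : R) : R :=
  1 / (4 * PI ^ 2) *
  RInt_gen (fun k => k * Cmod (fourier chi (Omega + k)) ^ 2)
    (at_point 0) (Rbar_locally p_infty).

Definition gbar (chi : R -> R) (T Omega L s : R) : R :=
  sqrt (resp_H chi T Omega L s ^ 2 + resp_Q chi Omega L s ^ 2)
  - resp_P chi Omega.

(** * The timing game *)

Inductive action : Set := Exit | Early | Late.

(* In both matrices the first argument (row) is Alice's action and the second
   (column) is Bob's. *)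
Definition payoffA (g0 gp gm : R) (a b : action) : R :=
  match a, b with
  | Exit, _ => 0
  | _, Exit => -1
  | Early, Early => g0
  | Early, Late => gp
  | Late, Early => gm
  | Late, Late => g0
  end.

Definition payoffB (g0 gp gm : R) (a b : action) : R :=
  match a, b with
  | _, Exit => 0
  | Exit, _ => -1
  | Early, Early => g0
  | Early, Late => gp
  | Late, Early => gm
  | Late, Late => g0
  end.

Definition sum_action (f : action -> R) : R := f Exit + f Early + f Late.

Definition is_distr (x : action -> R) : Prop :=
  (forall a, 0 <= x a) /\ sum_action x = 1.

Definition completely_mixed (x : action -> R) : Prop :=
  is_distr x /\ forall a, 0 < x a.

(* Expected payoff of an action of Alice against the strategy [y] of Bob, and
   of an action of Bob against the strategy [x] of Alice. *)
Definition expA (g0 gp gm : R) (y : action -> R) (a : action) : R :=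
  sum_action (fun b => payoffA g0 gp gm a b * y b).
Definition expB (g0 gp gm : R) (x : action -> R) (b : action) : R :=
  sum_action (fun a => x a * payoffB g0 gp gm a b).

(* [a] is a best response when [u a'] is the expected payoff of action [a']. *)
Definition best_response (u : action -> R) (a : action) : Prop :=
  forall a', u a' <= u a.

(* (Alice's strategy, Bob's strategy) *)
Definition profile : Type := ((action -> R) * (action -> R))%type.

Definition THP (g0 gp gm : R) (s : profile) : Prop :=
  is_distr (fst s) /\ is_distr (snd s) /\
  exists x y : nat -> action -> R,
    (forall n, completely_mixed (x n)) /\
    (forall n, completely_mixed (y n)) /\
    (forall a, is_lim_seq (fun n => x n a) (fst s a)) /\
    (forall b, is_lim_seq (fun n => y n b) (snd s b)) /\
    (forall n a, 0 < fst s a -> best_response (expA g0 gp gm (y n)) a) /\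
    (forall n b, 0 < snd s b -> best_response (expB g0 gp gm (x n)) b).

(* There are exactly [n] trembling-hand perfect profiles, pure or mixed. *)
Definition N_THP (g0 gp gm : R) (n : nat) : Prop :=
  cardinal profile (THP g0 gp gm) n.

(* Main.v *)
Require Import Defs.
From Stdlib Require Import Reals.
From Stdlib Require Import Ensembles Finite_sets Classical Lra Lia Psatz List.
From Stdlib Require Import FunctionalExtensionality PropExtensionality.
From Coquelicot Require Import Coquelicot.
Import ListNotations.
Open Scope R_scope.

(** For this pulse the correlation is elementary:
    [corr zeta = T / (15 PI) * sin (PI |zeta| / (2 T)) ^ 5] on [[-2T, 2T]], a sum of
    two translates of the bump [cos (PI v / 2) ^ 5]. Partial fractions turn [H]
    into a combination of the principal values of [bump v / (a - v)], with [a]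
    outside [[-1, 1]] except for [a] near 0 and [91 / 100]. Outside, the bounds
    come from [0 <= cos (PI v / 2) <= 1 - v ^ 2] and the moments of powers of the
    cosine; inside, the principal value is the integral of
    [(bump (a - t) - bump (a + t)) / t], and the numerator factors. The integrand
    of [P] is [cos (PI x) ^ 2] times a rational function, which lies between
    explicit polynomials on the first periods of the cosine. In units of
    [1 / (252 PI ^ 3)], [P] lies between 1.28 and 1.67, which decides every sign.

    In the game, a Nash profile is perfect as soon as some completely mixed
    profile keeps its supports best responses. With all rewards positive and
    [g0] on one side of both [gp] and [gm], the entry actions form a coordination
    game, up to exchanging Bob's entry actions; both players then have equal
    supports, and each of the 7 supports carries exactly one equilibrium. *)

(** * Perfect equilibria of the timing game *)

(** The delays are chosen so that one term governs each sign. With [sigma = tau / T], the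
    correlation in [Q] peaks at [sigma = 11/10] and [31/10], where it contributes [PI] in the unit
    of the overview and exceeds [P] by itself. Around [0] and [42/10] it vanishes because
    [|sigma - 21/10| >= 2], and around [21/10] it is tiny, so there only [H] counts. The unit
    collects [4 PI ^ 2] from [H], [15 PI] from the correlation and the distance [21/5] between the
    poles. The order inside a triple of rewards is subtler: at [0] it comes from convexity of the
    potential of the bump; at [L - T] from the oddness of its principal value about its centre,
    which must outweigh the drop of [Q] beside its peak; at [L + T] that drop itself decides. At all
    sampled delays the pole [s + L] lies to the right of the support, so only the pole [s - L] is
    singular. *)

Lemma cardinal_list (U : Type) (l : list U) (A : Ensemble U) :
  NoDup l -> (forall s, A s <-> In s l) -> cardinal U A (length l).
Proof.
revert A; induction l as [|a l IH]; intros A nd hA.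
- replace A with (Empty_set U); [constructor|].
  apply functional_extensionality; intro s; apply propositional_extensionality.
  split; [intros []|intro H; destruct (proj1 (hA s) H)].
- inversion nd as [|? ? na nd']; subst.
  replace A with (Ensembles.Add U (fun s => In s l) a).
  + apply card_add; [apply IH; [exact nd'|reflexivity]|exact na].
  + apply functional_extensionality; intro s; apply propositional_extensionality.
    rewrite hA; split.
    * intros [y Hy|y Hy]; [right; exact Hy|left; inversion Hy; reflexivity].
    * intros [Hs|Hs]; [right; rewrite Hs; constructor|left; exact Hs].
Qed.

Definition strat (e p l : R) (a : action) : R :=
  match a with Exit => e | Early => p | Late => l end.

Lemma strat_eta (x : action -> R) : x = strat (x Exit) (x Early) (x Late).
Proof. apply functional_extensionality; intros []; reflexivity. Qed.

Definition best_response_support (u x : action -> R) : Prop :=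
  forall a, 0 < x a -> best_response u a.

Definition is_Nash (g0 gp gm : R) (s : profile) : Prop :=
  is_distr (fst s) /\ is_distr (snd s) /\
  best_response_support (expA g0 gp gm (snd s)) (fst s) /\
  best_response_support (expB g0 gp gm (fst s)) (snd s).

Lemma is_lim_seq_sum_action (u : nat -> action -> R) (l : action -> R) :
  (forall a, is_lim_seq (fun n => u n a) (l a)) ->
  is_lim_seq (fun n => sum_action (u n)) (sum_action l).
Proof.
intro H; unfold sum_action.
apply is_lim_seq_plus' ; [apply is_lim_seq_plus'|]; apply H.
Qed.

Lemma is_lim_seq_expA (g0 gp gm : R) (y : nat -> action -> R) (l : action -> R) a :
  (forall b, is_lim_seq (fun n => y n b) (l b)) ->
  is_lim_seq (fun n => expA g0 gp gm (y n) a) (expA g0 gp gm l a).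
Proof.
intro H; apply (is_lim_seq_sum_action (fun n b => payoffA g0 gp gm a b * y n b)).
intro b; apply (is_lim_seq_scal_l _ _ (l b)), H.
Qed.

Lemma is_lim_seq_expB (g0 gp gm : R) (x : nat -> action -> R) (l : action -> R) b :
  (forall a, is_lim_seq (fun n => x n a) (l a)) ->
  is_lim_seq (fun n => expB g0 gp gm (x n) b) (expB g0 gp gm l b).
Proof.
intro H; apply (is_lim_seq_sum_action (fun n a => x n a * payoffB g0 gp gm a b)).
intro a; apply (is_lim_seq_scal_r _ _ (l a)), H.
Qed.

(** Expected payoffs are continuous, so the weak best-response inequalities survive the limit. *)
Lemma THP_is_Nash (g0 gp gm : R) (s : profile) : THP g0 gp gm s -> is_Nash g0 gp gm s.
Proof.
intros (dx & dy & x & y & mx & my & lx & ly & bx & by').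
split; [exact dx|split; [exact dy|split]].
- intros a ha a'.
  apply (is_lim_seq_le (fun n => expA g0 gp gm (y n) a') (fun n => expA g0 gp gm (y n) a)
    (expA g0 gp gm (snd s) a') (expA g0 gp gm (snd s) a)).
  + intro n; apply (bx n a ha).
  + apply is_lim_seq_expA, ly.
  + apply is_lim_seq_expA, ly.
- intros a ha a'.
  apply (is_lim_seq_le (fun n => expB g0 gp gm (x n) a') (fun n => expB g0 gp gm (x n) a)
    (expB g0 gp gm (fst s) a') (expB g0 gp gm (fst s) a)).
  + intro n; apply (by' n a ha).
  + apply is_lim_seq_expB, lx.
  + apply is_lim_seq_expB, lx.
Qed.

Definition mix (e : R) (x z : action -> R) (a : action) : R := (1 - e) * x a + e * z a.

Lemma completely_mixed_mix (e : R) (x z : action -> R) :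
  0 < e <= 1 -> is_distr x -> completely_mixed z -> completely_mixed (mix e x z).
Proof.
intros he [px sx] [[pz sz] qz].
assert (pos : forall a, 0 < mix e x z a).
{ intro a; unfold mix; generalize (px a) (qz a); intros; nra. }
split; [split|exact pos].
- intro a; apply Rlt_le, pos.
- unfold sum_action, mix in *; nra.
Qed.

Lemma is_lim_seq_mix (x z : action -> R) (a : action) :
  is_lim_seq (fun n => mix (/ (INR n + 1)) x z a) (x a).
Proof.
apply (is_lim_seq_ext (fun n => x a + (z a - x a) * / (INR n + 1))).
{ intro n; unfold mix; ring. }
replace (Finite (x a)) with (Finite (x a + (z a - x a) * 0)) by (f_equal; ring).
apply is_lim_seq_plus'; [apply is_lim_seq_const|].
apply (is_lim_seq_scal_l _ (z a - x a) 0).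
replace (Finite 0) with (Rbar_inv p_infty) by reflexivity.
apply is_lim_seq_inv; [|discriminate].
replace p_infty with (Rbar_plus p_infty (Finite 1)) by reflexivity.
apply (is_lim_seq_plus _ _ p_infty 1); [apply is_lim_seq_INR|apply is_lim_seq_const|].
reflexivity.
Qed.

(* Mixing a Nash profile with a completely mixed one against which the supports
   are still best responses keeps them best responses, because expected payoffs
   are linear. *)
Lemma Nash_THP (g0 gp gm : R) (s : profile) (zA zB : action -> R) :
  is_Nash g0 gp gm s -> completely_mixed zA -> completely_mixed zB ->
  best_response_support (expA g0 gp gm zB) (fst s) ->
  best_response_support (expB g0 gp gm zA) (snd s) ->
  THP g0 gp gm s.
Proof.
intros (dx & dy & bA & bB) mA mB bzA bzB.
assert (he : forall n : nat, 0 < / (INR n + 1) <= 1).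
{ intro n; generalize (pos_INR n); intro; split.
  - apply Rinv_0_lt_compat; lra.
  - rewrite <- Rinv_1; apply Rinv_le_contravar; lra. }
split; [exact dx|split; [exact dy|]].
(* The weight of the tremble is 1 at [n = 0], so the sequence starts at [(zA, zB)] itself. *)
exists (fun n => mix (/ (INR n + 1)) (fst s) zA),
  (fun n => mix (/ (INR n + 1)) (snd s) zB).
repeat split; try (intros; apply completely_mixed_mix; auto);
  try (intros; apply is_lim_seq_mix).
- intros n a ha a'; specialize (bA a ha a'); specialize (bzA a ha a').
  specialize (he n); set (e := / (INR n + 1)) in *; clearbody e.
  assert (E : forall c, expA g0 gp gm (mix e (snd s) zB) c =
    (1 - e) * expA g0 gp gm (snd s) c + e * expA g0 gp gm zB c).
  { intro c; unfold expA, mix, sum_action; ring. }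
  rewrite !E; nra.
- intros n b hb b'; specialize (bB b hb b'); specialize (bzB b hb b').
  specialize (he n); set (e := / (INR n + 1)) in *; clearbody e.
  assert (E : forall c, expB g0 gp gm (mix e (fst s) zA) c =
    (1 - e) * expB g0 gp gm (fst s) c + e * expB g0 gp gm zA c).
  { intro c; unfold expB, mix, sum_action; ring. }
  rewrite !E; nra.
Qed.

(** The consequence of perfection that Nash equilibrium lacks: an action dominated against all
    completely mixed opponents carries no weight. The first profile of the sequence is witness
    enough. *)
Lemma THP_best_response_mixed (g0 gp gm : R) (s : profile) : THP g0 gp gm s ->
  (forall a, 0 < fst s a -> exists y, completely_mixed y /\ best_response (expA g0 gp gm y) a) /\
  (forall b, 0 < snd s b -> exists x, completely_mixed x /\ best_response (expB g0 gp gm x) b).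
Proof.
intros (dx & dy & x & y & mx & my & lx & ly & bx & by'); split.
- intros a ha; exists (y 0%nat); auto.
- intros b hb; exists (x 0%nat); auto.
Qed.

(* [u0] and [u1] are the payoffs of Early and Late, up to relabelling; Exit pays 0. *)
Definition best_weights (u0 u1 wE w0 w1 : R) : Prop :=
  (0 < wE -> u0 <= 0 /\ u1 <= 0) /\
  (0 < w0 -> 0 <= u0 /\ u1 <= u0) /\
  (0 < w1 -> 0 <= u1 /\ u0 <= u1).

(** * Coordination games with an exit option *)

(** The entry payoffs form the matrix with rows [(a, b)] and [(c, d)]: all positive, and the
    diagonal entry is the strict maximum of its column. *)
Definition coordination (a b c d : R) : Prop := 0 < c < a /\ 0 < b < d.

(** Support inclusion. If the opponent never plays 0, then row 1 beats row 0 as soon as the opponent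
    plays 1, and against pure Exit entry costs 1; likewise for 1. If the opponent never exits, some
    entry has a positive payoff, which rules out Exit. *)
Lemma coordination_response (a b c d xE x0 x1 yE y0 y1 : R) :
  coordination a b c d ->
  0 <= xE -> 0 <= x0 -> 0 <= x1 -> xE + x0 + x1 = 1 ->
  0 <= yE -> 0 <= y0 -> 0 <= y1 -> yE + y0 + y1 = 1 ->
  best_weights (- xE + a * x0 + b * x1) (- xE + c * x0 + d * x1) yE y0 y1 ->
  (x0 = 0 -> y0 = 0) /\ (x1 = 0 -> y1 = 0) /\ (xE = 0 -> yE = 0).
Proof.
intros [hac hbd] pxE px0 px1 sx pyE py0 py1 sy (bE & b0 & b1).
repeat split; intro z; apply Rle_antisym; auto; apply Rnot_lt_le; intro h.
- destruct (b0 h) as [h1 h2]; subst x0; destruct px1 as [px1|px1]; nra.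
- destruct (b1 h) as [h1 h2]; subst x1; destruct px0 as [px0|px0]; nra.
- destruct (bE h) as [h1 h2]; subst xE; destruct (Rlt_le_dec 0 x0); nra.
Qed.

(** The normalising sum of the full-support weights: solving [a x0 + b x1 = xE = c x0 + d x1] up to
    scale gives [x0 : x1 : xE = d - b : a - c : a d - b c]. *)
Definition coord_full_scale (a b c d : R) : R := d - b + (a - c) + (a * d - b * c).

(* One strategy for each support: the weights that make the payoffs
   [- xE + a x0 + b x1] and [- xE + c x0 + d x1] of an opponent with that support
   equal on it. *)
Definition coord_weights (a b c d : R) : list (R * R * R) :=
  [ (1, 0, 0); (0, 1, 0); (0, 0, 1);
    (a / (1 + a), 1 / (1 + a), 0);
    (d / (1 + d), 0, 1 / (1 + d));
    (0, (d - b) / (d - b + (a - c)), (a - c) / (d - b + (a - c)));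
    ((a * d - b * c) / coord_full_scale a b c d,
     (d - b) / coord_full_scale a b c d, (a - c) / coord_full_scale a b c d) ].

Lemma coordination_positive (a b c d : R) : coordination a b c d ->
  0 < a /\ 0 < d /\ 0 < d - b /\ 0 < a - c /\ 0 < a * d - b * c /\
  0 < d - b + (a - c) /\ 0 < coord_full_scale a b c d.
Proof.
intros [h1 h2]; assert (0 < a * d - b * c) by nra.
unfold coord_full_scale; repeat split; lra.
Qed.

Lemma div_eq_of_mult (n x D : R) : 0 < D -> x * D = n -> n / D = x.
Proof. intros h <-; field; lra. Qed.

(** On each support the indifference equations and the total weight 1 form a linear system with a
    single solution. The position [k] encodes the support, which the three equivalences spell
    out. *)
Lemma coord_weights_in (a b c d xE x0 x1 : R) :
  coordination a b c d ->
  0 <= xE -> 0 <= x0 -> 0 <= x1 -> xE + x0 + x1 = 1 ->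
  (0 < xE -> 0 < x0 -> - xE + a * x0 + b * x1 = 0) ->
  (0 < xE -> 0 < x1 -> - xE + c * x0 + d * x1 = 0) ->
  (0 < x0 -> 0 < x1 -> - xE + a * x0 + b * x1 = - xE + c * x0 + d * x1) ->
  exists k, (k < 7)%nat /\ nth k (coord_weights a b c d) (0, 0, 0) = (xE, x0, x1) /\
    (xE = 0 <-> (k = 1 \/ k = 2 \/ k = 5)%nat) /\
    (x0 = 0 <-> (k = 0 \/ k = 2 \/ k = 4)%nat) /\
    (x1 = 0 <-> (k = 0 \/ k = 1 \/ k = 3)%nat).
Proof.
intros hc pE p0 p1 s hE0 hE1 h01.
destruct (coordination_positive _ _ _ _ hc) as (qa & qd & q1 & q2 & q3 & q4 & q5).
(* Eight zero patterns; the last one, with all weights zero, contradicts the total weight 1. *)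
destruct pE as [pE|pE]; destruct p0 as [p0|p0]; destruct p1 as [p1|p1];
  try subst xE; try subst x0; try subst x1.
- specialize (hE0 pE p0); specialize (hE1 pE p1); specialize (h01 p0 p1).
  exists 6%nat; simpl; split; [lia|split; [|repeat split; intros; first [lra | lia | exfalso; lra | exfalso; lia]]].
  unfold coord_full_scale in *.
  assert (e0 : x0 * (d - b + (a - c) + (a * d - b * c)) = d - b).
  { replace xE with (1 - x0 - x1) in * by lra. nra. }
  assert (e1 : x1 * (d - b + (a - c) + (a * d - b * c)) = a - c).
  { replace xE with (1 - x0 - x1) in * by lra. nra. }
  assert (E0 : (d - b) / (d - b + (a - c) + (a * d - b * c)) = x0).
  { apply div_eq_of_mult; assumption. }
  assert (E1 : (a - c) / (d - b + (a - c) + (a * d - b * c)) = x1).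
  { apply div_eq_of_mult; assumption. }
  rewrite E0, E1; f_equal; f_equal.
  apply div_eq_of_mult; [assumption|].
  replace xE with (a * x0 + b * x1) by lra.
  rewrite Rmult_plus_distr_r, !Rmult_assoc, e0, e1; ring.
- specialize (hE0 pE p0).
  exists 3%nat; simpl; split; [lia|split; [|repeat split; intros; first [lra | lia | exfalso; lra | exfalso; lia]]].
  assert (e0 : x0 * (1 + a) = 1) by nra.
  assert (E0 : 1 / (1 + a) = x0) by (apply div_eq_of_mult; [lra|exact e0]).
  f_equal; f_equal; [|exact E0].
  apply div_eq_of_mult; [lra|]; replace xE with (a * x0) by lra; rewrite Rmult_assoc, e0; ring.
- specialize (hE1 pE p1).
  exists 4%nat; simpl; split; [lia|split; [|repeat split; intros; first [lra | lia | exfalso; lra | exfalso; lia]]].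
  assert (e0 : x1 * (1 + d) = 1) by nra.
  assert (E0 : 1 / (1 + d) = x1) by (apply div_eq_of_mult; [lra|exact e0]).
  f_equal; [f_equal|exact E0].
  apply div_eq_of_mult; [lra|]; replace xE with (d * x1) by lra; rewrite Rmult_assoc, e0; ring.
- exists 0%nat; simpl; split; [lia|split; [|repeat split; intros; first [lra | lia | exfalso; lra | exfalso; lia]]].
  f_equal; f_equal; lra.
- specialize (h01 p0 p1).
  exists 5%nat; simpl; split; [lia|split; [|repeat split; intros; first [lra | lia | exfalso; lra | exfalso; lia]]].
  assert (e0 : x0 * (d - b + (a - c)) = d - b) by nra.
  assert (e1 : x1 * (d - b + (a - c)) = a - c) by nra.
  f_equal; [f_equal|].
  + apply div_eq_of_mult; assumption.
  + apply div_eq_of_mult; assumption.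
- exists 1%nat; simpl; split; [lia|split; [|repeat split; intros; first [lra | lia | exfalso; lra | exfalso; lia]]].
  f_equal; f_equal; lra.
- exists 2%nat; simpl; split; [lia|split; [|repeat split; intros; first [lra | lia | exfalso; lra | exfalso; lia]]].
  f_equal; f_equal; lra.
- lra.
Qed.

Lemma same_support (x y : R) : 0 <= x -> 0 <= y -> (x = 0 -> y = 0) -> (y = 0 -> x = 0) ->
  (0 < x <-> 0 < y).
Proof.
intros px py h k; split; intro H; apply Rnot_le_lt; intro K.
- rewrite k in H; lra.
- rewrite h in H; lra.
Qed.

(** A player's weights are determined by the indifference of the opponent, hence the crossed
    parameters in [combine]. Support inclusion in both directions makes the supports equal, so both
    strategies sit at the same position. *)
Lemma coordination_equilibria (a b c d a' b' c' d' xE x0 x1 yE y0 y1 : R) :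
  coordination a b c d -> coordination a' b' c' d' ->
  0 <= xE -> 0 <= x0 -> 0 <= x1 -> xE + x0 + x1 = 1 ->
  0 <= yE -> 0 <= y0 -> 0 <= y1 -> yE + y0 + y1 = 1 ->
  best_weights (- yE + a * y0 + b * y1) (- yE + c * y0 + d * y1) xE x0 x1 ->
  best_weights (- xE + a' * x0 + b' * x1) (- xE + c' * x0 + d' * x1) yE y0 y1 ->
  In ((xE, x0, x1), (yE, y0, y1))
    (combine (coord_weights a' b' c' d') (coord_weights a b c d)).
Proof.
intros hc hc' pxE px0 px1 sx pyE py0 py1 sy bA bB.
destruct (coordination_response a b c d yE y0 y1 xE x0 x1) as (i0 & i1 & iE); auto.
destruct (coordination_response a' b' c' d' xE x0 x1 yE y0 y1) as (k0 & k1 & kE); auto.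
destruct bA as (aE & a0 & a1); destruct bB as (bE & b0 & b1).
assert (TE : 0 < xE <-> 0 < yE) by (apply same_support; auto).
assert (T0 : 0 < x0 <-> 0 < y0) by (apply same_support; auto).
assert (T1 : 0 < x1 <-> 0 < y1) by (apply same_support; auto).
destruct (coord_weights_in a' b' c' d' xE x0 x1) as (k & hk & ek & kkE & kk0 & kk1); auto.
{ intros u v; apply TE in u; apply T0 in v; specialize (bE u); specialize (b0 v); lra. }
{ intros u v; apply TE in u; apply T1 in v; specialize (bE u); specialize (b1 v); lra. }
{ intros u v; apply T0 in u; apply T1 in v; specialize (b0 u); specialize (b1 v); lra. }
destruct (coord_weights_in a b c d yE y0 y1) as (m & hm & em & mE & m0 & m1); auto.
{ intros u v; apply TE in u; apply T0 in v; specialize (aE u); specialize (a0 v); lra. }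
{ intros u v; apply TE in u; apply T1 in v; specialize (aE u); specialize (a1 v); lra. }
{ intros u v; apply T0 in u; apply T1 in v; specialize (a0 u); specialize (a1 v); lra. }
(* The seven positions have pairwise different zero patterns. *)
assert (k = m) as <-.
{ assert (E1 : ((k = 1 \/ k = 2 \/ k = 5) <-> (m = 1 \/ m = 2 \/ m = 5))%nat)
    by (rewrite <- kkE, <- mE; split; auto).
  assert (E2 : ((k = 0 \/ k = 2 \/ k = 4) <-> (m = 0 \/ m = 2 \/ m = 4))%nat)
    by (rewrite <- kk0, <- m0; split; auto).
  assert (E3 : ((k = 0 \/ k = 1 \/ k = 3) <-> (m = 0 \/ m = 1 \/ m = 3))%nat)
    by (rewrite <- kk1, <- m1; split; auto).
  clear - hk hm E1 E2 E3; lia. }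
rewrite <- ek, <- em, <- combine_nth by reflexivity.
apply nth_In; simpl; exact hk.
Qed.

(** The converse of [coord_weights_in]. The last three clauses list the positions whose support
    contains Exit, 0 and 1 respectively: there that action is a best response to the listed
    strategy, as needed when the opponent has the same support. *)
Lemma coord_weights_distr (a b c d : R) (k : nat) (w : R * R * R) :
  coordination a b c d -> nth_error (coord_weights a b c d) k = Some w ->
  let '(xE, x0, x1) := w in
  0 <= xE /\ 0 <= x0 /\ 0 <= x1 /\ xE + x0 + x1 = 1 /\
  (xE = 0 <-> (k = 1 \/ k = 2 \/ k = 5)%nat) /\
  (x0 = 0 <-> (k = 0 \/ k = 2 \/ k = 4)%nat) /\
  (x1 = 0 <-> (k = 0 \/ k = 1 \/ k = 3)%nat) /\
  ((k = 0 \/ k = 3 \/ k = 4 \/ k = 6)%nat ->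
    - xE + a * x0 + b * x1 <= 0 /\ - xE + c * x0 + d * x1 <= 0) /\
  ((k = 1 \/ k = 3 \/ k = 5 \/ k = 6)%nat ->
    0 <= - xE + a * x0 + b * x1 /\ c * x0 + d * x1 <= a * x0 + b * x1) /\
  ((k = 2 \/ k = 4 \/ k = 5 \/ k = 6)%nat ->
    0 <= - xE + c * x0 + d * x1 /\ a * x0 + b * x1 <= c * x0 + d * x1).
Proof.
intros hc hk.
destruct (coordination_positive _ _ _ _ hc) as (qa & qd & q1 & q2 & q3 & q4 & q5).
destruct hc as [hac hbd].
assert (ia : 0 < 1 / (1 + a)) by (apply Rdiv_lt_0_compat; lra).
assert (id : 0 < 1 / (1 + d)) by (apply Rdiv_lt_0_compat; lra).
assert (ja : a / (1 + a) = 1 - 1 / (1 + a)) by (field; lra).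
assert (jd : d / (1 + d) = 1 - 1 / (1 + d)) by (field; lra).
assert (ka : 1 / (1 + a) * (1 + a) = 1) by (field; lra).
assert (kd : 1 / (1 + d) * (1 + d) = 1) by (field; lra).
assert (la : 0 < a / (1 + a)) by (apply Rdiv_lt_0_compat; lra).
assert (ld : 0 < d / (1 + d)) by (apply Rdiv_lt_0_compat; lra).
assert (m1 : 0 < (d - b) / (d - b + (a - c))) by (apply Rdiv_lt_0_compat; lra).
assert (m2 : 0 < (a - c) / (d - b + (a - c))) by (apply Rdiv_lt_0_compat; lra).
assert (m3 : (d - b) / (d - b + (a - c)) + (a - c) / (d - b + (a - c)) = 1) by (field; lra).
assert (m4 : a * ((d - b) / (d - b + (a - c))) + b * ((a - c) / (d - b + (a - c)))
  = c * ((d - b) / (d - b + (a - c))) + d * ((a - c) / (d - b + (a - c)))) by (field; lra).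
assert (n0 : 0 < (a * d - b * c) / coord_full_scale a b c d) by (apply Rdiv_lt_0_compat; lra).
assert (n1 : 0 < (d - b) / coord_full_scale a b c d) by (apply Rdiv_lt_0_compat; lra).
assert (n2 : 0 < (a - c) / coord_full_scale a b c d) by (apply Rdiv_lt_0_compat; lra).
assert (n3 : (a * d - b * c) / coord_full_scale a b c d + (d - b) / coord_full_scale a b c d
  + (a - c) / coord_full_scale a b c d = 1) by (unfold coord_full_scale in *; field; lra).
assert (n4 : - ((a * d - b * c) / coord_full_scale a b c d) + a * ((d - b) / coord_full_scale a b c d)
  + b * ((a - c) / coord_full_scale a b c d) = 0) by (unfold coord_full_scale in *; field; lra).
assert (n5 : - ((a * d - b * c) / coord_full_scale a b c d) + c * ((d - b) / coord_full_scale a b c d)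
  + d * ((a - c) / coord_full_scale a b c d) = 0) by (unfold coord_full_scale in *; field; lra).
assert (o1 : c * (1 / (1 + a)) < a * (1 / (1 + a))) by (apply Rmult_lt_compat_r; lra).
assert (o2 : b * (1 / (1 + d)) < d * (1 / (1 + d))) by (apply Rmult_lt_compat_r; lra).
assert (o3 : 0 < a * ((d - b) / (d - b + (a - c)))) by (apply Rmult_lt_0_compat; lra).
assert (o4 : 0 < b * ((a - c) / (d - b + (a - c)))) by (apply Rmult_lt_0_compat; lra).
(* Once the quotients are abstract, the facts above are linear in them and in their products with
   the payoffs, so [lra] settles every position. *)
unfold coord_weights in hk; rewrite ja, jd in hk.
rewrite ja in la; rewrite jd in ld; clear ja jd.
set (i := 1 / (1 + a)) in *; set (j := 1 / (1 + d)) in *.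
set (u := (d - b) / (d - b + (a - c))) in *; set (v := (a - c) / (d - b + (a - c))) in *.
set (r := (a * d - b * c) / coord_full_scale a b c d) in *.
set (s := (d - b) / coord_full_scale a b c d) in *.
set (t := (a - c) / coord_full_scale a b c d) in *.
clearbody i j u v r s t; clear q5.
do 7 (destruct k as [|k]; [injection hk as <-;
  repeat split; intros; first [lra | lia | exfalso; lra | exfalso; lia]|]).
destruct k; discriminate hk.
Qed.

(* With [sw = true] the two entry actions are exchanged; applied to Bob only,
   this turns an anticoordination game into a coordination game. *)
Definition strat3 (sw : bool) (w : R * R * R) : action -> R :=
  let '(e, p, l) := w in if sw then strat e l p else strat e p l.

Definition swap_action (sw : bool) (a : action) : action :=
  match sw, a with true, Early => Late | true, Late => Early | _, _ => a end.

Lemma strat3_surj (sw : bool) (x : action -> R) :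
  x = strat3 sw (x Exit, x (swap_action sw Early), x (swap_action sw Late)).
Proof. destruct sw; apply strat_eta. Qed.

Lemma strat3_inj (sw : bool) (v w : R * R * R) : strat3 sw v = strat3 sw w -> v = w.
Proof.
destruct v as [[vE v0] v1]; destruct w as [[wE w0] w1]; intro h.
assert (h0 := f_equal (fun f => f Exit) h).
assert (h1 := f_equal (fun f => f Early) h).
assert (h2 := f_equal (fun f => f Late) h).
destruct sw; simpl in *; congruence.
Qed.

Lemma is_distr_strat3 (sw : bool) (e p l : R) :
  is_distr (strat3 sw (e, p, l)) <-> 0 <= e /\ 0 <= p /\ 0 <= l /\ e + p + l = 1.
Proof.
unfold is_distr, sum_action; split.
- intros [h s]; generalize (h Exit) (h Early) (h Late); destruct sw; simpl in *; lra.
- intros h; split; [intros []|]; destruct sw; simpl; lra.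
Qed.

Lemma best_response_support_strat3 (sw : bool) (u : action -> R) (e p l : R) : u Exit = 0 ->
  best_response_support u (strat3 sw (e, p, l)) <->
  best_weights (u (swap_action sw Early)) (u (swap_action sw Late)) e p l.
Proof.
intro uE; unfold best_response_support, best_response, best_weights; split.
- intro h; destruct sw; simpl in *; (split; [|split]); intro z; split;
  first [ generalize (h Exit z Early) (h Exit z Late); lra
        | generalize (h Early z Exit) (h Early z Late); lra
        | generalize (h Late z Exit) (h Late z Early); lra ].
- intros (h1 & h2 & h3); destruct sw; simpl in *; intros [] z []; simpl in z;
  try specialize (h1 z); try specialize (h2 z); try specialize (h3 z); lra.
Qed.

Lemma best_response_support_const (u x : action -> R) : u Exit = 0 ->
  u Early = 0 -> u Late = 0 -> best_response_support u x.
Proof. intros h1 h2 h3 a _ b; destruct a; destruct b; lra. Qed.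

Lemma nth_error_combine_Some (X Y : Type) (l : list X) (l' : list Y) (k : nat) (p : X * Y) :
  nth_error (combine l l') k = Some p ->
  nth_error l k = Some (fst p) /\ nth_error l' k = Some (snd p).
Proof.
revert l l'; induction k as [|k IH]; intros [|x l] [|y l']; simpl; try discriminate.
- intros [= <-]; auto.
- apply IH.
Qed.

(** [a b c d] is Alice's matrix and [a' b' c' d'] is Bob's, both written from the player's own point
    of view after the possible relabelling of Bob's entries by [sw]. *)
Lemma N_THP_coordination (sw : bool) (g0 gp gm a b c d a' b' c' d' : R) :
  coordination a b c d -> coordination a' b' c' d' ->
  (forall yE y0 y1,
    expA g0 gp gm (strat3 sw (yE, y0, y1)) Early = - yE + a * y0 + b * y1 /\
    expA g0 gp gm (strat3 sw (yE, y0, y1)) Late = - yE + c * y0 + d * y1) ->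
  (forall xE x0 x1,
    expB g0 gp gm (strat3 false (xE, x0, x1)) (swap_action sw Early) = - xE + a' * x0 + b' * x1 /\
    expB g0 gp gm (strat3 false (xE, x0, x1)) (swap_action sw Late) = - xE + c' * x0 + d' * x1) ->
  N_THP g0 gp gm 7.
Proof.
intros hc hc' hA hB.
assert (eA : forall y, expA g0 gp gm y Exit = 0) by (intro y; unfold expA, sum_action; simpl; ring).
assert (eB : forall x, expB g0 gp gm x Exit = 0) by (intro y; unfold expB, sum_action; simpl; ring).
set (l := combine (coord_weights a' b' c' d') (coord_weights a b c d)).
set (prof := fun w : (R * R * R) * (R * R * R) => (strat3 false (fst w), strat3 sw (snd w)) : profile).
assert (sound : forall k w, nth_error l k = Some w -> is_Nash g0 gp gm (prof w)).
{ intros k [[[xE x0] x1] [[yE y0] y1]] hk; apply nth_error_combine_Some in hk.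
  destruct hk as [hx hy]; simpl in hx, hy.
  assert (hk : (k < 7)%nat) by (apply (nth_error_Some (coord_weights a b c d)); congruence).
  destruct (coord_weights_distr _ _ _ _ _ _ hc' hx) as (px & px0 & px1 & sx & kxE & kx0 & kx1 & bE & b0 & b1).
  destruct (coord_weights_distr _ _ _ _ _ _ hc hy) as (py & py0 & py1 & sy & kyE & ky0 & ky1 & aE & a0 & a1).
  destruct (hA yE y0 y1) as [hA0 hA1]; destruct (hB xE x0 x1) as [hB0 hB1].
  unfold is_Nash, prof, fst, snd.
  rewrite !is_distr_strat3, !best_response_support_strat3 by auto.
  rewrite hB0, hB1; simpl; simpl in hA0, hA1; rewrite hA0, hA1.
  (* A positive weight excludes the positions where that weight vanishes, which leaves exactly the
     positions in the best-response clauses. *)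
  assert (dE : forall z, (z = 0 <-> (k = 1 \/ k = 2 \/ k = 5)%nat) -> 0 < z ->
    (k = 0 \/ k = 3 \/ k = 4 \/ k = 6)%nat).
  { intros z h1 h2; assert (h3 : ~ (k = 1 \/ k = 2 \/ k = 5)%nat) by (rewrite <- h1; lra).
    clear - hk h3; lia. }
  assert (d0 : forall z, (z = 0 <-> (k = 0 \/ k = 2 \/ k = 4)%nat) -> 0 < z ->
    (k = 1 \/ k = 3 \/ k = 5 \/ k = 6)%nat).
  { intros z h1 h2; assert (h3 : ~ (k = 0 \/ k = 2 \/ k = 4)%nat) by (rewrite <- h1; lra).
    clear - hk h3; lia. }
  assert (d1 : forall z, (z = 0 <-> (k = 0 \/ k = 1 \/ k = 3)%nat) -> 0 < z ->
    (k = 2 \/ k = 4 \/ k = 5 \/ k = 6)%nat).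
  { intros z h1 h2; assert (h3 : ~ (k = 0 \/ k = 1 \/ k = 3)%nat) by (rewrite <- h1; lra).
    clear - hk h3; lia. }
  unfold best_weights; do 2 (split; [auto|]).
  (split; [split; [|split]|split; [|split]]); intro z.
  - exact (aE (dE _ kxE z)).
  - specialize (a0 (d0 _ kx0 z)); split; lra.
  - specialize (a1 (d1 _ kx1 z)); split; lra.
  - exact (bE (dE _ kyE z)).
  - specialize (b0 (d0 _ ky0 z)); split; lra.
  - specialize (b1 (d1 _ ky1 z)); split; lra. }
unfold N_THP; replace 7%nat with (length (map prof l)) by reflexivity.
apply cardinal_list.
(* Alice's zero pattern already tells the seven profiles apart. *)
- apply NoDup_nth_error; intros i j hi h.
  rewrite length_map in hi; simpl in hi; rewrite !nth_error_map in h.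
  destruct (nth_error l i) as [[[[xE x0] x1] y]|] eqn:ei; [|apply nth_error_None in ei; simpl in ei; lia].
  destruct (nth_error l j) as [[[[xE' x0'] x1'] y']|] eqn:ej; [|discriminate h].
  assert (hj : (j < 7)%nat) by (apply (nth_error_Some l); congruence).
  apply nth_error_combine_Some in ei; apply nth_error_combine_Some in ej.
  destruct ei as [ei _]; destruct ej as [ej _]; simpl in ei, ej, h.
  injection h as h _; apply (strat3_inj false (xE, x0, x1) (xE', x0', x1')) in h; injection h as -> -> ->.
  destruct (coord_weights_distr _ _ _ _ _ _ hc' ei) as (_ & _ & _ & _ & kxE & kx0 & kx1 & _).
  destruct (coord_weights_distr _ _ _ _ _ _ hc' ej) as (_ & _ & _ & _ & mxE & mx0 & mx1 & _).
  rewrite kxE in mxE; rewrite kx0 in mx0; rewrite kx1 in mx1.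
  clear - hi hj mxE mx0 mx1; lia.
- intro s; rewrite in_map_iff; split.
  + intro h; apply THP_is_Nash in h; destruct s as [x y]; destruct h as (dx & dy & bA & bB).
    unfold fst, snd in *.
    assert (ex : exists w, x = strat3 false w) by (eexists; apply strat3_surj).
    assert (ey : exists w, y = strat3 sw w) by (eexists; apply strat3_surj).
    destruct ex as [[[xE x0] x1] ->]; destruct ey as [[[yE y0] y1] ->].
    exists ((xE, x0, x1), (yE, y0, y1)); split; [reflexivity|].
    apply is_distr_strat3 in dx; apply is_distr_strat3 in dy.
    apply best_response_support_strat3 in bA; [|apply eA].
    apply best_response_support_strat3 in bB; [|apply eB].
    destruct (hA yE y0 y1) as [hA0 hA1]; destruct (hB xE x0 x1) as [hB0 hB1].
    rewrite hB0, hB1 in bB; change (swap_action false Early) with Early in bA;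
      change (swap_action false Late) with Late in bA; rewrite hA0, hA1 in bA.
    apply coordination_equilibria; tauto.
  + intros [w [<- hw]].
    apply In_nth_error in hw; destruct hw as [k hk].
    apply sound in hk.
    (* The last weights make all actions indifferent. *)
    set (zA := nth 6 (coord_weights a' b' c' d') (0, 0, 0)).
    set (zB := nth 6 (coord_weights a b c d) (0, 0, 0)).
    assert (hzA : nth_error (coord_weights a' b' c' d') 6 = Some zA) by reflexivity.
    assert (hzB : nth_error (coord_weights a b c d) 6 = Some zB) by reflexivity.
    clearbody zA zB; destruct zA as [[xE x0] x1]; destruct zB as [[yE y0] y1].
    destruct (coord_weights_distr _ _ _ _ _ _ hc' hzA) as (px & px0 & px1 & sx & kxE & kx0 & kx1 & bE & b0 & b1).
    destruct (coord_weights_distr _ _ _ _ _ _ hc hzB) as (py & py0 & py1 & sy & kyE & ky0 & ky1 & aE & a0 & a1).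
    specialize (bE ltac:(lia)); specialize (b0 ltac:(lia)); specialize (b1 ltac:(lia)).
    specialize (aE ltac:(lia)); specialize (a0 ltac:(lia)); specialize (a1 ltac:(lia)).
    assert (pos : forall P z, 0 <= z -> (z = 0 <-> P) -> ~ P -> 0 < z).
    { intros P z [h1|h1] h2 h3; [exact h1|]; symmetry in h1; tauto. }
    apply (pos _ _ px) in kxE; [|lia]; apply (pos _ _ px0) in kx0; [|lia]; apply (pos _ _ px1) in kx1; [|lia].
    apply (pos _ _ py) in kyE; [|lia]; apply (pos _ _ py0) in ky0; [|lia]; apply (pos _ _ py1) in ky1; [|lia].
    destruct (hA yE y0 y1) as [hA0 hA1]; destruct (hB xE x0 x1) as [hB0 hB1].
    apply (Nash_THP g0 gp gm _ (strat3 false (xE, x0, x1)) (strat3 sw (yE, y0, y1)) hk).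
    * split; [apply is_distr_strat3; auto|intros []; simpl; auto].
    * split; [apply is_distr_strat3; auto|intros []; destruct sw; simpl; auto].
    * apply best_response_support_const; auto; rewrite ?hA0, ?hA1; lra.
    * destruct sw; simpl in hB0, hB1; apply best_response_support_const; auto;
        simpl; rewrite ?hB0, ?hB1; lra.
Qed.

Lemma N_THP_coordination_game (g0 gp gm : R) :
  0 < gp < g0 -> 0 < gm < g0 -> N_THP g0 gp gm 7.
Proof.
intros h1 h2.
(* Bob's matrix is the transpose of Alice's, which exchanges [gp] and [gm]. *)
apply (N_THP_coordination false g0 gp gm g0 gp gm g0 g0 gm gp g0);
  try (split; lra); intros; unfold expA, expB, sum_action; simpl; split; ring.
Qed.

Lemma N_THP_anticoordination_game (g0 gp gm : R) :
  0 < g0 -> g0 < gp -> g0 < gm -> N_THP g0 gp gm 7.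
Proof.
intros h0 h1 h2.
(* Exchanging Bob's entries exchanges the columns of Alice's matrix and the rows of Bob's, so that
   [gp] and [gm] land on the diagonals. *)
apply (N_THP_coordination true g0 gp gm gp g0 g0 gm gp g0 g0 gm);
  try (split; lra); intros; unfold expA, expB, sum_action; simpl; split; ring.
Qed.

(** * Games decided by dominance *)

Lemma completely_mixed_strat (e p l : R) :
  0 < e -> 0 < p -> 0 < l -> e + p + l = 1 -> completely_mixed (strat e p l).
Proof.
intros; split; [split; [intros []; simpl; lra|exact H2]|intros []; assumption].
Qed.

(** Entry has a negative payoff against every strategy, pure ones included, so Exit is strictly
    dominant and any tremble, here the uniform one, supports it. *)
Lemma N_THP_negative_rewards (g0 gp gm : R) :
  g0 < 0 -> gp < 0 -> gm < 0 -> N_THP g0 gp gm 1.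
Proof.
intros h0 hp hm.
assert (neg : forall e p l u v, 0 <= e -> 0 <= p -> 0 <= l -> e + p + l = 1 ->
  u < 0 -> v < 0 -> - e + u * p + v * l < 0).
{ intros e p l u v he hp' hl hs hu hv.
  assert (u * p <= 0) by nra; assert (v * l <= 0) by nra.
  destruct (Rlt_le_dec 0 e); [lra|]; destruct (Rlt_le_dec 0 p); nra. }
assert (bA : forall y a, is_distr y -> a <> Exit -> expA g0 gp gm y a < 0).
{ intros y a [py sy] ha; unfold sum_action in sy.
  destruct a; [congruence|generalize (neg _ _ _ g0 gp (py Exit) (py Early) (py Late) sy h0 hp)
    |generalize (neg _ _ _ gm g0 (py Exit) (py Early) (py Late) sy hm h0)];
  unfold expA, sum_action; simpl; lra. }
assert (bB : forall x a, is_distr x -> a <> Exit -> expB g0 gp gm x a < 0).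
{ intros y a [py sy] ha; unfold sum_action in sy.
  destruct a; [congruence|generalize (neg _ _ _ g0 gm (py Exit) (py Early) (py Late) sy h0 hm)
    |generalize (neg _ _ _ gp g0 (py Exit) (py Early) (py Late) sy hp h0)];
  unfold expB, sum_action; simpl; lra. }
assert (eA : forall y, expA g0 gp gm y Exit = 0) by (intro y; unfold expA, sum_action; simpl; ring).
assert (eB : forall x, expB g0 gp gm x Exit = 0) by (intro y; unfold expB, sum_action; simpl; ring).
unfold N_THP; change 1%nat with (length [(strat 1 0 0, strat 1 0 0) : profile]).
apply cardinal_list; [repeat constructor; simpl; tauto|].
assert (pure : forall x u, is_distr x -> u Exit = 0 -> (forall a, a <> Exit -> u a < 0) ->
  best_response_support u x -> x = strat 1 0 0).
{ intros x u [px sx] uE hu h; rewrite (strat_eta x).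
  assert (z : forall a, a <> Exit -> x a = 0).
  { intros a ha; apply Rle_antisym; [|apply px]; apply Rnot_lt_le; intro pa.
    specialize (h a pa Exit); specialize (hu a ha); lra. }
  unfold sum_action in sx; rewrite (z Early), (z Late) in * by discriminate.
  f_equal; lra. }
intro s; split.
- intro h; apply THP_is_Nash in h; destruct s as [x y]; destruct h as (dx & dy & nA & nB); simpl in *.
  left; f_equal; symmetry.
  + apply (pure x (expA g0 gp gm y)); auto.
    
  + apply (pure y (expB g0 gp gm x)); auto.
- intros [<-|[]].
  set (z := strat (1/3) (1/3) (1/3)).
  assert (mz : completely_mixed z) by (apply completely_mixed_strat; lra).
  assert (d1 : is_distr (strat 1 0 0)) by (apply (is_distr_strat3 false); lra).
  assert (bs : forall u, u Exit = 0 -> (forall a, a <> Exit -> u a < 0) ->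
    best_response_support u (strat 1 0 0)).
  { intros u uE hu a ha b.
    assert (a = Exit) as -> by (destruct a; simpl in ha; [reflexivity|lra|lra]).
    destruct b; [lra| |]; rewrite uE; apply Rlt_le, hu; discriminate. }
  apply (Nash_THP g0 gp gm _ z z); auto.
  + split; [exact d1|split; [exact d1|split]].
    * apply bs; auto; intros a ha; apply bA; auto.
    * apply bs; auto; intros a ha; apply bB; auto.
  + apply bs; auto; intros a ha; apply bA; auto; apply mz.
  + apply bs; auto; intros a ha; apply bB; auto; apply mz.
Qed.

(* Here Late dominates Early for Alice and Early dominates Late for Bob against
   completely mixed opponents. *)
Lemma N_THP_leader_game (g0 gp gm : R) :
  0 < gp -> gp < g0 -> g0 < gm -> N_THP g0 gp gm 3.
Proof.
intros hp h0 hm.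
(* With Alice on Exit and Late and Bob on Exit and Early, weight [i] on entry makes the opponent
   indifferent: [- (1 - i) + gm * i = 0]. *)
set (i := 1 / (1 + gm)).
assert (ip : 0 < i) by (apply Rdiv_lt_0_compat; lra).
assert (ie : i * (1 + gm) = 1) by (unfold i; field; lra).
assert (eA : forall y, expA g0 gp gm y Exit = 0) by (intro y; unfold expA, sum_action; simpl; ring).
assert (eB : forall x, expB g0 gp gm x Exit = 0) by (intro y; unfold expB, sum_action; simpl; ring).
set (l := [(strat 1 0 0, strat 1 0 0); (strat 0 0 1, strat 0 1 0);
  (strat (1 - i) 0 i, strat (1 - i) i 0)] : list profile).
unfold N_THP; change 3%nat with (length l).
apply cardinal_list.
- assert (i1 : i < 1) by nra.
  repeat constructor; simpl; intros H; repeat (destruct H as [H|H]); try exact H;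
    injection H as _ H; apply (f_equal (fun f => f Early)) in H; simpl in H; lra.
- intro s; split.
  + intro h; assert (hN := THP_is_Nash _ _ _ _ h).
    apply THP_best_response_mixed in h; destruct h as [mA mB].
    destruct s as [x y]; destruct hN as (dx & dy & nA & nB); unfold fst, snd in *.
    rewrite (strat_eta x), (strat_eta y).
    (* Against a mixed opponent, Late exceeds Early for Alice by [(gm - g0) * z Early + (g0 - gp) *
       z Late > 0]. *)
    assert (zx : x Early = 0).
    { apply Rle_antisym; [|apply dx]; apply Rnot_lt_le; intro p.
      destruct (mA _ p) as [z [[_ pz] bz]]; specialize (bz Late).
      generalize (pz Early) (pz Late); intros.
      unfold expA, sum_action in bz; simpl in bz; nra. }
    assert (zy : y Late = 0).
    { apply Rle_antisym; [|apply dy]; apply Rnot_lt_le; intro p.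
      destruct (mB _ p) as [z [[_ pz] bz]]; specialize (bz Early).
      generalize (pz Early) (pz Late); intros.
      unfold expB, sum_action in bz; simpl in bz; nra. }
    (* What remains is a two-by-two game: joint entry pays [gm] to both and lone entry costs 1. It
       has two pure equilibria and one mixed. *)
    destruct dx as [px sx]; destruct dy as [py sy]; unfold sum_action in sx, sy.
    rewrite zx in *; rewrite zy in *.
    assert (aL : expA g0 gp gm y Late = - y Exit + gm * y Early).
    { unfold expA, sum_action; simpl; rewrite zy; ring. }
    assert (bL : expB g0 gp gm x Early = - x Exit + gm * x Late).
    { unfold expB, sum_action; simpl; rewrite zx; ring. }
    assert (aE := fun p => nA Exit p Late); assert (a1 := fun p => nA Late p Exit).
    assert (bE := fun p => nB Exit p Early); assert (b1 := fun p => nB Early p Exit).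
    rewrite eA, aL in *; rewrite eB, bL in *.
    generalize (px Exit) (px Late) (py Exit) (py Early); intros pE p1 qE q0.
    set (xE := x Exit) in *; set (x1 := x Late) in *; set (yE := y Exit) in *; set (y0 := y Early) in *.
    clearbody xE x1 yE y0; clear mA mB nA nB aL bL px py zx zy.
    destruct p1 as [p1|p1].
    * specialize (a1 p1).
      destruct q0 as [q0|q0]; [|nra].
      specialize (b1 q0).
      destruct pE as [pE|pE].
      -- specialize (aE pE).
         assert (ey : y0 = i) by (apply (Rmult_eq_reg_r (1 + gm)); lra || nra).
         destruct qE as [qE|qE]; [|nra].
         specialize (bE qE).
         assert (ex : x1 = i) by (apply (Rmult_eq_reg_r (1 + gm)); lra || nra).
         right; right; left; subst; f_equal; f_equal; lra.
      -- destruct qE as [qE|qE]; [specialize (bE qE); nra|].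
         right; left; f_equal; f_equal; lra.
    * destruct q0 as [q0|q0]; [specialize (b1 q0); nra|].
      left; f_equal; f_equal; lra.
  + intro hs.
    (* The Exit weight of [z] is tuned so that Alice's Late and Bob's Early pay exactly 0, like
       Exit, while the dominated entry pays [r * (gp - gm) < 0]. The same [z] serves as tremble for
       both players. *)
    set (r := 1 / (2 + gm + g0)).
    assert (rp : 0 < r) by (apply Rdiv_lt_0_compat; lra).
    assert (re : r * (2 + gm + g0) = 1) by (unfold r; field; lra).
    set (z := strat ((gm + g0) * r) r r).
    assert (mz : completely_mixed z) by (apply completely_mixed_strat; nra).
    assert (i1 : i < 1) by nra.
    assert (zA : forall x, x Early = 0 -> best_response_support (expA g0 gp gm z) x).
    { intros x hx a ha b; assert (a <> Early) by (intros ->; lra).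
      destruct a; [|congruence|]; destruct b; unfold expA, sum_action, z; simpl; nra. }
    assert (zB : forall x, x Late = 0 -> best_response_support (expB g0 gp gm z) x).
    { intros x hx a ha b; assert (a <> Late) by (intros ->; lra).
      destruct a; [| |congruence]; destruct b; unfold expB, sum_action, z; simpl; nra. }
    assert (dis : forall e p q, 0 <= e -> 0 <= p -> 0 <= q -> e + p + q = 1 -> is_distr (strat e p q)).
    { intros; apply (is_distr_strat3 false); auto. }
    destruct hs as [<-|[<-|[<-|[]]]];
    (apply (Nash_THP g0 gp gm _ z z); [|exact mz|exact mz|apply zA; reflexivity|apply zB; reflexivity]);
    (split; [apply dis; lra|split; [apply dis; lra|]]);
    split; intros [] ha; simpl in ha; try lra; intros [];
    unfold expA, expB, sum_action; simpl; nra.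
Qed.

(** * The correlation of the pulse *)

Lemma is_RInt_antiderivative (F f : R -> R) (a b : R) :
  (forall x, is_derive F x (f x)) -> (forall x, continuous f x) ->
  is_RInt f a b (F b - F a).
Proof. intros hF hf; apply (is_RInt_derive F f a b); auto. Qed.

Lemma is_RInt_zero {V : NormedModule R_AbsRing} (f : R -> V) (a b : R) :
  (forall x, Rmin a b < x < Rmax a b -> f x = zero) -> is_RInt f a b zero.
Proof.
intro h; apply (is_RInt_ext (fun _ => zero)).
- intros x hx; symmetry; auto.
- refine (eq_rect _ (fun l => is_RInt (fun _ : R => zero) a b l) (is_RInt_const a b zero) _ _).
  exact (@scal_zero_r _ (NormedModule.ModuleSpace R_AbsRing V) (b - a)).
Qed.

Lemma is_RInt_extend_zero {V : NormedModule R_AbsRing} (f : R -> V) (a b a' b' : R) (l : V) :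
  a' <= a -> a <= b -> b <= b' ->
  (forall x, x < a \/ b < x -> f x = zero) -> is_RInt f a b l -> is_RInt f a' b' l.
Proof.
intros h1 h2 h3 h hl.
replace l with (plus (plus zero l) zero) by (rewrite plus_zero_l, plus_zero_r; reflexivity).
apply (is_RInt_Chasles _ _ b); [apply (is_RInt_Chasles _ _ a)|]; auto; apply is_RInt_zero.
- intros x; rewrite Rmin_left, Rmax_right by lra; intro; apply h; lra.
- intros x; rewrite Rmin_left, Rmax_right by lra; intro; apply h; lra.
Qed.

Lemma RInt_line_compact {V : CompleteNormedModule R_AbsRing} (f : R -> V) (a b : R) (l : V) :
  a <= b -> (forall x, x < a \/ b < x -> f x = zero) -> is_RInt f a b l -> RInt_line f = l.
Proof.
intros hab h hl; apply is_RInt_gen_unique; intros P HP.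
apply (Filter_prod _ _ _ (fun x => x < a) (fun x => b < x)).
- exists a; auto.
- exists b; auto.
- intros x y hx hy; exists l; split; [|apply locally_singleton, HP].
  apply (is_RInt_extend_zero f a b); simpl; auto; lra.
Qed.

Definition bump (v : R) : R := if Rle_dec (Rabs v) 1 then cos (PI * v / 2) ^ 5 else 0.

Lemma bump_in (v : R) : -1 <= v <= 1 -> bump v = cos (PI * v / 2) ^ 5.
Proof.
intro h; unfold bump; destruct (Rle_dec (Rabs v) 1) as [_|n]; [reflexivity|].
exfalso; apply n, Rabs_le; exact h.
Qed.

Lemma cos_half_PI_mult_1 (v : R) : Rabs v = 1 -> cos (PI * v / 2) = 0.
Proof.
intro h; rewrite <- cos_PI2; unfold Rabs in h; destruct (Rcase_abs v).
- rewrite <- cos_neg; f_equal; replace v with (-1) by lra; field.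
- f_equal; replace v with 1 by lra; field.
Qed.

Lemma bump_out (v : R) : 1 <= Rabs v -> bump v = 0.
Proof.
intro h; unfold bump; destruct (Rle_dec (Rabs v) 1) as [n|_]; [|reflexivity].
rewrite cos_half_PI_mult_1 by lra; ring.
Qed.

Lemma bump_even (v : R) : bump (- v) = bump v.
Proof.
unfold bump; rewrite Rabs_Ropp; destruct (Rle_dec (Rabs v) 1); [|reflexivity].
replace (PI * - v / 2) with (- (PI * v / 2)) by field; rewrite cos_neg; reflexivity.
Qed.

(** Equal to [sin (PI |u| / 2) ^ 5] on [[-2, 2]]. Written as a sum of translates, it splits every
    integral against it into integrals against [bump]. *)
Definition corr1 (u : R) : R := bump (u - 1) + bump (u + 1).

Lemma corr1_even (u : R) : corr1 (- u) = corr1 u.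
Proof.
unfold corr1; rewrite <- (bump_even (- u - 1)), <- (bump_even (- u + 1)).
rewrite Rplus_comm; f_equal; f_equal; ring.
Qed.

Lemma corr1_out (u : R) : 2 <= Rabs u -> corr1 u = 0.
Proof.
intro h; unfold corr1; rewrite !bump_out; [ring| |];
unfold Rabs in *; repeat destruct Rcase_abs; lra.
Qed.

Lemma corr1_in (u : R) : 0 <= u <= 2 -> corr1 u = sin (PI * u / 2) ^ 5.
Proof.
intro h; unfold corr1; rewrite bump_in by lra; rewrite bump_out.
- replace (PI * (u - 1) / 2) with (- (PI / 2 - PI * u / 2)) by field.
  rewrite cos_neg, cos_shift; ring.
- rewrite Rabs_right; lra.
Qed.

Lemma cos_triple (x : R) : cos (3 * x) = 4 * cos x ^ 3 - 3 * cos x.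
Proof.
replace (3 * x) with (2 * x + x) by ring.
rewrite cos_plus, cos_2a_cos, sin_2a.
assert (h : sin x * sin x = 1 - cos x * cos x) by (generalize (sin2_cos2 x); unfold Rsqr; lra).
replace (2 * sin x * cos x * sin x) with (2 * cos x * (sin x * sin x)) by ring.
rewrite h; ring.
Qed.

Lemma cos_half_sqr (x : R) : cos (x / 2) ^ 2 = (1 + cos x) / 2.
Proof.
replace x with (2 * (x / 2)) at 2 by field; rewrite cos_2a_cos; field.
Qed.

(** Product-to-sum turns [(cos X + k) ^ 2 * cos (3 X) / 4] into cosines of multiples of [X]. The
    resulting sines are expanded in [sin X] and [cos X], so that the identities become algebraic. *)
Definition corr_primitive (k X : R) : R :=
  ((3 * sin X - 4 * sin X ^ 3) / 6
   + ((16 * sin X ^ 5 - 20 * sin X ^ 3 + 5 * sin X) / 5 + sin X) / 4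
   + k * (sin X * cos X * (1 - 2 * sin X ^ 2) + sin X * cos X)
   + k ^ 2 * (3 * sin X - 4 * sin X ^ 3) / 3) / 4.

Lemma is_derive_corr_primitive (k X : R) :
  is_derive (corr_primitive k) X ((cos X + k) ^ 2 * cos (3 * X) / 4).
Proof.
unfold corr_primitive; auto_derive; [exact I|].
rewrite cos_triple.
assert (h : cos X ^ 2 = 1 - sin X ^ 2) by (generalize (sin2_cos2 X); unfold Rsqr; lra).
set (c := cos X) in *; set (s := sin X) in *; clearbody c s.
assert (h3 : c ^ 3 = c * (1 - s ^ 2)) by (rewrite <- h; ring).
assert (h4 : c ^ 4 = (1 - s ^ 2) ^ 2) by (rewrite <- h; ring).
assert (h5 : c ^ 5 = c * (1 - s ^ 2) ^ 2) by (rewrite <- h; ring).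
field_simplify; rewrite ?h5, ?h4, ?h3, ?h; field_simplify; rewrite ?h5, ?h4, ?h3, ?h; field.
Qed.

Lemma corr_primitive_value (t : R) :
  corr_primitive (cos t) (PI - t) - corr_primitive (cos t) (- (PI - t)) = sin t ^ 5 / 15.
Proof.
unfold corr_primitive; rewrite sin_neg, cos_neg.
replace (sin (PI - t)) with (sin t) by (rewrite <- sin_PI_x; reflexivity).
replace (cos (PI - t)) with (- cos t) by (symmetry; apply Rtrigo_facts.cos_pi_minus).
assert (h : cos t ^ 2 = 1 - sin t ^ 2) by (generalize (sin2_cos2 t); unfold Rsqr; lra).
set (c := cos t) in *; set (s := sin t) in *; clearbody c s.
field_simplify; rewrite ?h; field.
Qed.

(** In the variable [X = PI z / T] with [t = PI zeta / (2 T)], the two pulses multiply to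
    [(cos X + cos t) ^ 2 / 4], and the frequency [2 Omega] becomes 3. *)
Lemma corr_cos2_pulse (T z : R) : 0 < T ->
  corr (cos2_pulse T) (3 * PI / (2 * T)) z = T / (15 * PI) * corr1 (z / T).
Proof.
intro hT; generalize PI_RGT_0; intro hpi.
assert (ev : forall w, corr (cos2_pulse T) (3 * PI / (2 * T)) (- w) =
  corr (cos2_pulse T) (3 * PI / (2 * T)) w).
{ intro w; unfold corr; f_equal; apply functional_extensionality; intro x.
  replace (x + - w / 2) with (x - w / 2) by field.
  replace (x - - w / 2) with (x + w / 2) by field; ring. }
assert (pos : forall w, 0 <= w ->
  corr (cos2_pulse T) (3 * PI / (2 * T)) w = T / (15 * PI) * corr1 (w / T)).
2: { destruct (Rle_lt_dec 0 z) as [h|h]; [auto|].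
  rewrite <- (Ropp_involutive z), ev, pos by lra.
  replace (- - z / T) with (- (- z / T)) by (field; lra); rewrite corr1_even; reflexivity. }
intros w hw.
assert (out : forall x, T <= Rabs x -> cos2_pulse T x = 0).
{ intros x hx; unfold cos2_pulse; destruct Rle_dec as [h|h]; [|reflexivity].
  replace (PI * x / (2 * T)) with (PI * (x / T) / 2) by (field; lra).
  rewrite cos_half_PI_mult_1; [ring|].
  unfold Rdiv; rewrite Rabs_mult, (Rabs_right (/ T)) by (apply Rle_ge, Rlt_le, Rinv_0_lt_compat; lra).
  replace (Rabs x) with T by lra; field; lra. }
destruct (Rle_lt_dec (2 * T) w) as [h2|h2].
- rewrite corr1_out.
  + rewrite Rmult_0_r; apply (RInt_line_compact (V := R_CompleteNormedModule) _ 0 0); [lra| |].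
    * intros x hx; destruct hx; [rewrite (out (x - w / 2))|rewrite (out (x + w / 2))];
      try (unfold zero; simpl; ring); unfold Rabs; destruct Rcase_abs; lra.
    * apply (is_RInt_zero (V := R_NormedModule)); intros x hx; rewrite Rmin_left, Rmax_right in hx by lra; lra.
  + rewrite Rabs_right; [|apply Rle_ge, Rdiv_le_0_compat; lra].
    apply (Rmult_le_reg_r T); [lra|]; unfold Rdiv; rewrite Rmult_assoc, Rinv_l; lra.
- rewrite corr1_in.
  2: { split; [apply Rdiv_le_0_compat; lra|].
    apply (Rmult_le_reg_r T); [lra|]; unfold Rdiv; rewrite Rmult_assoc, Rinv_l; lra. }
  set (t := PI * w / (2 * T)).
  replace (PI * (w / T) / 2) with t by (unfold t; field; lra).
  (* The overlap of the two supports; its ends correspond to [X = PI - t] and [X = - (PI - t)]. *)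
  apply (RInt_line_compact (V := R_CompleteNormedModule) _ (- (T - w / 2)) (T - w / 2)); [lra| |].
  + intros x hx; destruct hx; [rewrite (out (x - w / 2))|rewrite (out (x + w / 2))];
      try (unfold zero; simpl; ring); unfold Rabs; destruct Rcase_abs; lra.
  + assert (main : is_RInt (fun X => (cos X + cos t) ^ 2 * cos (3 * X) / 4)
      (PI / T * (- (T - w / 2)) + 0) (PI / T * (T - w / 2) + 0) (sin t ^ 5 / 15)).
    { rewrite <- corr_primitive_value.
      replace (PI / T * (T - w / 2) + 0) with (PI - t) by (unfold t; field; lra).
      replace (PI / T * - (T - w / 2) + 0) with (- (PI - t)) by (unfold t; field; lra).
      apply is_RInt_antiderivative; [intro; apply is_derive_corr_primitive|].
      intro x; apply (ex_derive_continuous (V := R_NormedModule)); auto_derive; exact I. }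
    apply is_RInt_comp_lin in main.
    apply (is_RInt_scal _ _ _ (T / PI)) in main.
    replace (T / (15 * PI) * sin t ^ 5) with (scal (T / PI) (sin t ^ 5 / 15)).
    2: { unfold scal; simpl; unfold mult; simpl; field; lra. }
    revert main; apply is_RInt_ext.
    intros x; rewrite Rmin_left, Rmax_right by lra; intro hx.
    unfold scal; simpl; unfold mult; simpl.
    assert (inn : forall y, - T <= y <= T -> cos2_pulse T y = (1 + cos (PI * y / T)) / 2).
    { intros y hy; unfold cos2_pulse; destruct Rle_dec as [h|h].
      - rewrite <- cos_half_sqr; f_equal; f_equal; field; lra.
      - exfalso; apply h, Rabs_le; exact hy. }
    rewrite !inn by lra.
    replace (2 * (3 * PI / (2 * T)) * x) with (3 * (PI / T * x + 0)) by (field; lra).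
    replace (PI * (x + w / 2) / T) with ((PI / T * x + 0) + t) by (unfold t; field; lra).
    replace (PI * (x - w / 2) / T) with ((PI / T * x + 0) - t) by (unfold t; field; lra).
    set (X := PI / T * x + 0); rewrite cos_plus, cos_minus.
    assert (e1 : sin X ^ 2 = 1 - cos X ^ 2) by (generalize (sin2_cos2 X); unfold Rsqr; lra).
    assert (e2 : sin t ^ 2 = 1 - cos t ^ 2) by (generalize (sin2_cos2 t); unfold Rsqr; lra).
    transitivity ((1 + 2 * (cos X * cos t) + cos X ^ 2 * cos t ^ 2 - sin X ^ 2 * sin t ^ 2)
      / 4 * cos (3 * X)); [rewrite e1, e2; field; lra|field].
Qed.

(** * The principal value *)

(** Gives the derivative of [bump] at 1, where its two formulas meet, without one-sided
    derivatives. *)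
Lemma is_derive_quadratic_bound (f : R -> R) (a C : R) :
  (forall x, Rabs (f x - f a) <= C * (x - a) ^ 2) -> is_derive f a 0.
Proof.
intro h; apply is_derive_Reals; intros eps heps.
assert (hC : 0 < Rabs C + 1) by (generalize (Rabs_pos C); lra).
assert (hd : 0 < eps / (Rabs C + 1)) by (apply Rdiv_lt_0_compat; lra).
exists (mkposreal _ hd); simpl; intros x hx hlt.
specialize (h (a + x)); replace (a + x - a) with x in h by ring.
rewrite Rminus_0_r; unfold Rdiv; rewrite Rabs_mult, Rabs_inv.
assert (px : 0 < Rabs x) by (apply Rabs_pos_lt; exact hx).
apply (Rmult_lt_reg_r (Rabs x)); [exact px|].
rewrite Rmult_assoc, Rinv_l, Rmult_1_r by lra.
apply Rle_lt_trans with (1 := h).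
rewrite <- (pow2_abs x).
apply Rle_lt_trans with (Rabs C * Rabs x ^ 2).
{ apply Rmult_le_compat_r; [apply pow2_ge_0|apply Rle_abs]. }
apply (Rmult_lt_compat_r (Rabs C + 1)) in hlt; [|lra].
unfold Rdiv in hlt; rewrite Rmult_assoc, Rinv_l in hlt by lra.
generalize (Rabs_pos C); intro; nra.
Qed.

Lemma cos_half_PI_bounds (v : R) : -1 <= v <= 1 ->
  0 <= cos (PI * v / 2) <= 1.
Proof.
intro h; split; [|apply COS_bound]; generalize PI_RGT_0; intro.
apply cos_ge_0; nra.
Qed.

Lemma cos_half_PI_le (v : R) : v <= 1 -> cos (PI * v / 2) <= PI / 2 * (1 - v).
Proof.
intro h; generalize PI_RGT_0; intro.
replace (PI * v / 2) with (PI / 2 - PI / 2 * (1 - v)) by field.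
rewrite cos_shift; destruct (Req_dec v 1) as [->|n].
- replace (PI / 2 * (1 - 1)) with 0 by ring; rewrite sin_0; lra.
- apply Rlt_le, sin_lt_x; nra.
Qed.

Lemma bump_pos (v : R) : 0 <= bump v.
Proof.
destruct (Rle_dec (Rabs v) 1) as [h|h]; [|rewrite bump_out; lra].
apply Rabs_le_between in h; rewrite bump_in by lra; apply pow_le.
apply cos_half_PI_bounds; lra.
Qed.

Lemma bump_le_quadratic (v : R) : bump v <= (PI / 2) ^ 2 * (v - 1) ^ 2.
Proof.
assert (0 <= (PI / 2) ^ 2 * (v - 1) ^ 2) by (apply Rmult_le_pos; apply pow2_ge_0).
destruct (Rle_dec (Rabs v) 1) as [h|h]; [|rewrite bump_out; lra].
apply Rabs_le_between in h; rewrite bump_in by lra.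
generalize (cos_half_PI_bounds v h) (cos_half_PI_le v ltac:(lra)).
set (c := cos (PI * v / 2)); intros h1 h2.
apply Rle_trans with (c ^ 2).
- replace (c ^ 5) with (c ^ 2 * c ^ 3) by ring; rewrite <- (Rmult_1_r (c ^ 2)) at 2.
  apply Rmult_le_compat_l; [apply pow2_ge_0|]; rewrite <- (pow1 3); apply pow_incr; lra.
- replace ((PI / 2) ^ 2 * (v - 1) ^ 2) with ((PI / 2 * (1 - v)) ^ 2) by ring.
  apply pow_incr; lra.
Qed.

Lemma ex_derive_bump (v : R) : ex_derive bump v.
Proof.
assert (one : is_derive bump 1 0).
{ apply (is_derive_quadratic_bound _ _ ((PI / 2) ^ 2)); intro x.
  rewrite (bump_out 1) by (rewrite Rabs_R1; lra).
  rewrite Rminus_0_r, Rabs_right by (apply Rle_ge, bump_pos); apply bump_le_quadratic. }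
destruct (Rtotal_order (Rabs v) 1) as [h|[h|h]].
- apply Rabs_lt_between in h.
  apply (ex_derive_ext_loc (fun x => cos (PI * x / 2) ^ 5)).
  + apply (locally_interval _ v (-1) 1); simpl; [lra|lra|].
    intros y h1 h2; symmetry; apply bump_in; lra.
  + auto_derive; exact I.
- unfold Rabs in h; destruct (Rcase_abs v).
  + replace v with (-1) by lra.
    apply (ex_derive_ext (fun x => bump (- x))); [intro; apply bump_even|].
    apply (ex_derive_comp bump (fun x => - x)).
    * exists 0; replace (- -1) with 1 by ring; exact one.
    * auto_derive; exact I.
  + subst v; exists 0; exact one.
- exists 0; apply (is_derive_ext_loc (fun _ => 0)); [|apply (is_derive_const 0)].
  assert (o : open (fun x => 1 < Rabs x)).
  { apply (open_comp Rabs (fun y => 1 < y)); [|apply open_gt].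
    intros x _; apply continuous_Rabs. }
  generalize (o v h); apply filter_imp; intros y hy; symmetry; apply bump_out; lra.
Qed.

Lemma continuous_of_ex_derive (f : R -> R) (x : R) : ex_derive f x -> continuous f x.
Proof. apply (ex_derive_continuous (V := R_NormedModule)). Qed.

Lemma ex_derive_corr1 (u : R) : ex_derive corr1 u.
Proof.
apply (ex_derive_plus (V := R_NormedModule) (fun u => bump (u - 1)) (fun u => bump (u + 1)));
  apply (ex_derive_comp bump); try apply ex_derive_bump; auto_derive; exact I.
Qed.

(** The point [q] lies beyond the support of [corr1], so the quotient is 0 around it; at [q] itself
    this holds whatever value division by zero takes. *)
Lemma ex_derive_corr1_div (q u : R) : 2 < q -> ex_derive (fun u => corr1 u / (q - u)) u.
Proof.
intro hq; destruct (Rlt_le_dec u q) as [h|h].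
- apply (ex_derive_div corr1 (fun u => q - u)); [apply ex_derive_corr1|auto_derive; exact I|lra].
- exists 0; apply (is_derive_ext_loc (fun _ => 0)); [|apply (is_derive_const 0)].
  apply (locally_interval _ u 2 p_infty); simpl; [lra|exact I|].
  intros y hy _; rewrite corr1_out; [unfold Rdiv; ring|rewrite Rabs_right; lra].
Qed.

Definition sym_quot (f : R -> R) (p t : R) : R := (f (p + t) - f (p - t)) / t.

(** The value at 0 is [2 f'(p)]: continuity there is the differentiability at 0 of
    [f (p + t) - f (p - t)], so [f] need not be continuously differentiable. *)
Lemma sym_quot_extension (f : R -> R) (p : R) :
  (forall x, ex_derive f x) ->
  exists E : R -> R, (forall t, continuous E t) /\ (forall t, t <> 0 -> E t = sym_quot f p t).
Proof.
intro hf; destruct (hf p) as [d hd].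
exists (fun t => if Req_EM_T t 0 then 2 * d else sym_quot f p t); split.
2: { intros t ht; destruct (Req_EM_T t 0); tauto. }
intro t; destruct (Req_dec t 0) as [->|ht].
- assert (hD : is_derive (fun t => f (p + t) - f (p - t)) 0 (2 * d)).
  { replace (2 * d) with (1 * d - (-1) * d) by ring.
    apply (is_derive_minus (V := R_NormedModule) (fun t => f (p + t)) (fun t => f (p - t))).
    - apply (is_derive_comp (V := R_NormedModule) f (fun t => p + t)).
      + rewrite Rplus_0_r; exact hd.
      + auto_derive; [exact I|ring].
    - apply (is_derive_comp (V := R_NormedModule) f (fun t => p - t)).
      + rewrite Rminus_0_r; exact hd.
      + auto_derive; [exact I|ring]. }
  apply continuity_pt_filterlim; intros eps heps.
  apply is_derive_Reals in hD; destruct (hD eps heps) as [delta h].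
  exists delta; split; [apply delta|].
  intros x [[_ nx] hx]; simpl in *; unfold R_dist in *.
  destruct (Req_EM_T 0 0) as [_|]; [|tauto].
  destruct (Req_EM_T x 0) as [e|e]; [congruence|].
  specialize (h x e); rewrite Rminus_0_r in hx; specialize (h hx).
  rewrite !Rplus_0_l, Rplus_0_r, Rminus_0_r in h.
  unfold sym_quot; replace (f p - f p) with 0 in h by ring; rewrite Rminus_0_r in h; exact h.
- apply (continuous_ext_loc _ (sym_quot f p)).
  + assert (o : open (fun x : R => x <> 0)) by apply open_neq.
    generalize (o t ht); apply filter_imp; intros y hy; destruct (Req_EM_T y 0); tauto.
  + apply continuous_of_ex_derive; unfold sym_quot.
    apply (ex_derive_div (fun t => f (p + t) - f (p - t)) (fun t => t)); [|auto_derive; exact I|exact ht].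
    apply (ex_derive_minus (V := R_NormedModule) (fun t => f (p + t)) (fun t => f (p - t)));
      apply (ex_derive_comp f); try apply hf; auto_derive; exact I.
Qed.

Lemma ex_RInt_sym_quot (f : R -> R) (p a b : R) :
  (forall x, ex_derive f x) -> 0 <= a -> 0 <= b -> ex_RInt (sym_quot f p) a b.
Proof.
intros hf ha hb; destruct (sym_quot_extension f p hf) as [E [hE eE]].
apply (ex_RInt_ext E).
- intros x [hx _]; apply eE; generalize (Rmin_glb a b 0 ha hb); lra.
- apply (ex_RInt_continuous (V := R_CompleteNormedModule)); auto.
Qed.

(** Replacing the quotient by its continuous extension makes the integral differentiable in its
    lower endpoint, hence continuous there. *)
Lemma RInt_sym_quot_right (f : R -> R) (p B : R) :
  (forall x, ex_derive f x) -> 0 < B ->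
  filterlim (fun eps => RInt (sym_quot f p) eps B) (at_right 0) (locally (RInt (sym_quot f p) 0 B)).
Proof.
intros hf hB; destruct (sym_quot_extension f p hf) as [E [hE eE]].
assert (eq : forall a, 0 <= a -> RInt E a B = RInt (sym_quot f p) a B).
{ intros a ha; apply RInt_ext; intros x [hx _]; apply eE.
  generalize (Rmin_glb a B 0 ha (Rlt_le _ _ hB)); lra. }
apply (filterlim_ext_loc (fun eps => RInt E eps B)).
- exists (mkposreal 1 Rlt_0_1); intros y _ hy; apply eq; lra.
- rewrite <- eq by lra.
  apply (filterlim_filter_le_1 (F := locally 0) (G := at_right 0)).
  { intros P [d hd]; exists d; intros y hy _; auto. }
  assert (D : is_derive (fun a => RInt E a B) 0 (opp (E 0))).
  { apply (is_derive_RInt' (V := R_NormedModule) E (fun a => RInt E a B) 0 B); [|apply hE].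
    apply filter_forall; intro a; apply (RInt_correct (V := R_CompleteNormedModule)).
    apply (ex_RInt_continuous (V := R_CompleteNormedModule)); auto. }
  apply (continuous_of_ex_derive (fun a => RInt E a B) 0); exists (opp (E 0)); exact D.
Qed.

(** The integrand of [PV_truncated] in units of [T] and up to a constant: with [p = sigma - ell] and
    [q = sigma + ell], the denominator [L ^ 2 - (zeta - s) ^ 2] is [T ^ 2 * ((q - u) * (u - p))]. *)
Definition truncated (p q eps u : R) : R :=
  if Rlt_dec eps (Rmin (Rabs (u - p)) (Rabs (u - q)))
  then corr1 u / ((q - u) * (u - p)) else 0.

(* Reflecting the part left of the pole [p] onto the part right of it. *)
Lemma is_RInt_truncated (p q eps : R) :
  2 < q -> -3 <= p <= 3 -> 0 < eps -> eps < q - 2 -> eps < 5 ->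
  is_RInt (truncated p q eps) (-2) 2
    (RInt (sym_quot (fun u => corr1 u / (q - u)) p) eps 5).
Proof.
intros hq hp h0 h1 h2.
set (g := fun u => corr1 u / (q - u)).
assert (hg : forall u, ex_derive g u) by (intro; apply ex_derive_corr1_div; exact hq).
assert (cont : forall s t, t <> 0 -> continuous (fun t => g (p + s * t) / t) t).
{ intros s t ht; apply continuous_of_ex_derive.
  apply (ex_derive_div (fun t => g (p + s * t)) (fun t => t)); [|auto_derive; exact I|exact ht].
  apply (ex_derive_comp g); [apply hg|auto_derive; exact I]. }
assert (exq : forall s, ex_RInt (fun t => g (p + s * t) / t) eps 5).
{ intro s; apply (ex_RInt_continuous (V := R_CompleteNormedModule)).
  intros t; rewrite Rmin_left, Rmax_right by lra; intro; apply cont; lra. }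
(* The two half-integrals on either side of [p]. The radius 5 makes [[p - 5, p + 5]] contain
   [[-2, 2]], since [|p| <= 3]. *)
set (I1 := RInt (fun t => g (p + 1 * t) / t) eps 5).
set (I2 := RInt (fun t => g (p + -1 * t) / t) eps 5).
assert (H1 : is_RInt (fun t => g (p + 1 * t) / t) eps 5 I1)
  by apply (RInt_correct (V := R_CompleteNormedModule)), exq.
assert (H2 : is_RInt (fun t => g (p + -1 * t) / t) eps 5 I2)
  by apply (RInt_correct (V := R_CompleteNormedModule)), exq.
assert (e0 : RInt (sym_quot g p) eps 5 = - I2 + I1).
{ apply is_RInt_unique; apply (is_RInt_ext (fun t => minus (g (p + 1 * t) / t) (g (p + -1 * t) / t))).
  - intros t; rewrite Rmin_left, Rmax_right by lra; intro; unfold sym_quot, minus, plus, opp; simpl.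
    replace (p + 1 * t) with (p + t) by ring; replace (p + -1 * t) with (p - t) by ring; field; lra.
  - replace (- I2 + I1) with (minus I1 I2) by (unfold minus, plus, opp; simpl; ring).
    apply (is_RInt_minus (V := R_NormedModule)); assumption. }
rewrite e0; clear e0.
(* The exclusion around [q] has no effect: inside the support [q - u > q - 2 > eps], and outside it
   both sides are 0. *)
assert (inside : forall u, eps < Rabs (u - p) -> truncated p q eps u = g u / (u - p)).
{ intros u hu; unfold truncated, g.
  destruct (Rle_lt_dec 2 (Rabs u)) as [o|o].
  - rewrite corr1_out by exact o; destruct Rlt_dec; unfold Rdiv; ring.
  - assert (u < q) by (apply Rabs_lt_between in o; lra).
    assert (hp' : u - p <> 0) by (intro z; rewrite z, Rabs_R0 in hu; lra).
    destruct Rlt_dec as [i|i]; [field; lra|].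
    exfalso; apply i, Rmin_glb_lt; [exact hu|].
    rewrite Rabs_left by lra; apply Rabs_lt_between in o; lra. }
assert (J1 : is_RInt (truncated p q eps) (p + eps) (p + 5) I1).
{ assert (H := is_RInt_comp_lin (V := R_NormedModule) (fun t => g (p + 1 * t) / t) 1 (- p) (p + eps) (p + 5) I1).
  replace (1 * (p + eps) + - p) with eps in H by ring.
  replace (1 * (p + 5) + - p) with 5 in H by ring.
  specialize (H H1); revert H; apply is_RInt_ext.
  intros u; rewrite Rmin_left, Rmax_right by lra; intro hu.
  rewrite inside by (rewrite Rabs_right; lra).
  unfold scal; simpl; unfold mult; simpl.
  replace (p + 1 * (1 * u + - p)) with u by ring; field; lra. }
assert (J2 : is_RInt (truncated p q eps) (p - 5) (p - eps) (- I2)).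
{ apply (is_RInt_swap (V := R_NormedModule)) in H2.
  assert (H := is_RInt_comp_lin (V := R_NormedModule) (fun t => g (p + -1 * t) / t) (-1) p (p - 5) (p - eps) (opp I2)).
  replace (-1 * (p - eps) + p) with eps in H by ring.
  replace (-1 * (p - 5) + p) with 5 in H by ring.
  specialize (H H2); revert H; apply is_RInt_ext.
  intros u; rewrite Rmin_left, Rmax_right by lra; intro hu.
  rewrite inside by (rewrite Rabs_left; lra).
  unfold scal; simpl; unfold mult; simpl.
  replace (p + -1 * (-1 * u + p)) with u by ring; field; lra. }
assert (J0 : is_RInt (truncated p q eps) (p - eps) (p + eps) 0).
{ apply (is_RInt_zero (V := R_NormedModule)).
  intros u; rewrite Rmin_left, Rmax_right by lra; intro hu; unfold truncated.
  destruct Rlt_dec as [i|i]; [|reflexivity].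
  exfalso; apply Rlt_le_trans with (2 := Rmin_l _ _) in i.
  apply Rlt_not_le in i; apply i, Rabs_le; lra. }
assert (J : is_RInt (truncated p q eps) (p - 5) (p + 5) (- I2 + I1)).
{ replace (- I2 + I1) with (plus (plus (- I2) 0) I1) by (unfold plus; simpl; ring).
  apply (is_RInt_Chasles (V := R_NormedModule) _ _ (p + eps)); [|exact J1].
  apply (is_RInt_Chasles (V := R_NormedModule) _ _ (p - eps)); [exact J2|exact J0]. }
assert (ex : ex_RInt (truncated p q eps) (-2) 2).
{ apply (ex_RInt_Chasles_1 (V := R_CompleteNormedModule) _ _ _ (p + 5)); [lra|].
  apply (ex_RInt_Chasles_2 (V := R_CompleteNormedModule) _ (p - 5)); [lra|].
  exists (- I2 + I1); exact J. }
destruct ex as [l hl].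
assert (hl' := is_RInt_extend_zero (V := R_NormedModule) (truncated p q eps) (-2) 2 (p - 5) (p + 5) l).
replace (- I2 + I1) with l; [exact hl|].
apply (is_RInt_unique (V := R_CompleteNormedModule)) in J; rewrite <- J; symmetry.
apply (is_RInt_unique (V := R_CompleteNormedModule)), hl'; try lra; [|exact hl].
intros x hx; unfold truncated; rewrite corr1_out.
- destruct Rlt_dec; unfold Rdiv; rewrite ?Rmult_0_l; reflexivity.
- unfold Rabs; destruct Rcase_abs; lra.
Qed.

(** Rescaling by [T] turns the exclusion radius [eps] into [eps / T], which also tends to 0 from the
    right. The powers of [T] cancel, so the value depends on [sigma] and [ell] only. *)
Lemma PV_corr (T ell sigma : R) :
  0 < T -> 2 < sigma + ell -> -3 <= sigma - ell <= 3 -> 0 < ell ->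
  PV (sigma * T - ell * T) (sigma * T + ell * T)
    (fun zeta => corr (cos2_pulse T) (3 * PI / (2 * T)) zeta
       / ((ell * T) ^ 2 - (zeta - sigma * T) ^ 2)) (- (2 * T)) (2 * T)
  = / (15 * PI) * RInt (sym_quot (fun u => corr1 u / (sigma + ell - u)) (sigma - ell)) 0 5.
Proof.
intros hT hq hp hell; generalize PI_RGT_0; intro hpi.
set (p := sigma - ell) in *; set (q := sigma + ell) in *.
set (V := fun eps => RInt (sym_quot (fun u => corr1 u / (q - u)) p) eps 5).
apply (iota_filterlim_locally (V := R_CompleteNormedModule)).
apply (filterlim_ext_loc (fun eps => / (15 * PI) * V (eps / T))).
- assert (hd : 0 < T * Rmin (q - 2) 5) by (apply Rmult_lt_0_compat; [lra|apply Rmin_pos; lra]).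
  exists (mkposreal _ hd); intros eps hb he.
  assert (hlt : eps / T < Rmin (q - 2) 5).
  { apply (Rmult_lt_reg_r T); [lra|]; unfold Rdiv; rewrite Rmult_assoc, Rinv_l, Rmult_1_r by lra.
    unfold ball in hb; simpl in hb; unfold AbsRing_ball, abs, minus, plus, opp in hb; simpl in hb.
    rewrite Rabs_right in hb by lra; lra. }
  assert (he' : 0 < eps / T) by (apply Rdiv_lt_0_compat; lra).
  symmetry; apply is_RInt_unique.
  assert (main : is_RInt (truncated p q (eps / T)) (/ T * - (2 * T) + 0) (/ T * (2 * T) + 0) (V (eps / T))).
  { replace (/ T * - (2 * T) + 0) with (-2) by (field; lra).
    replace (/ T * (2 * T) + 0) with 2 by (field; lra).
    apply is_RInt_truncated; try lra; apply Rlt_le_trans with (1 := hlt); [apply Rmin_l|apply Rmin_r]. }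
  apply (is_RInt_comp_lin (V := R_NormedModule)) in main.
  apply (is_RInt_scal (V := R_NormedModule) _ _ _ (/ (15 * PI))) in main.
  revert main; apply is_RInt_ext.
  intros z _; unfold scal; simpl; unfold mult; simpl.
  rewrite corr_cos2_pulse by lra.
  replace (/ T * z + 0) with (z / T) by (field; lra).
  set (u := z / T); assert (ez : z = u * T) by (unfold u; field; lra).
  rewrite ez; unfold truncated.
  assert (Ra : forall r, Rabs (u * T - (r * T)) = T * Rabs (u - r)).
  { intro r; rewrite <- Rmult_minus_distr_r, Rabs_mult, (Rabs_right T) by lra; ring. }
  replace (u * T - (sigma * T - ell * T)) with (u * T - p * T) by (unfold p; ring).
  replace (u * T - (sigma * T + ell * T)) with (u * T - q * T) by (unfold q; ring).
  rewrite !Ra.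
  replace (ell * T * (ell * T * 1) - (u * T - sigma * T) * ((u * T - sigma * T) * 1)) with (T * T * ((q - u) * (u - p)))
    by (unfold p, q; ring).
  assert (hT' : T * (eps / T) = eps) by (field; lra).
  match goal with |- @eq _ ?x ?y => change (@eq R x y) end.
  destruct Rlt_dec as [h1|h1]; destruct Rlt_dec as [h2|h2].
  + unfold Rdiv; rewrite (Rinv_mult (T * T)); generalize (/ ((q - u) * (u - p))); intro X; field; lra.
  + exfalso; apply h2, Rmin_Rgt; apply Rmin_Rgt in h1.
    rewrite <- hT'; split; apply Rmult_lt_compat_l; lra.
  + exfalso; apply h1, Rmin_Rgt; apply Rmin_Rgt in h2.
    split; apply (Rmult_lt_reg_l T); lra.
  + ring.
- apply (filterlim_comp _ _ _ (fun eps => eps / T) (fun e => / (15 * PI) * V e) _ (at_right 0)).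
  + intros P [d hd].
    assert (hd' : 0 < d * T) by (apply Rmult_lt_0_compat; [apply d|lra]).
    exists (mkposreal _ hd'); intros y hy h0; apply hd; [|apply Rdiv_lt_0_compat; lra].
    unfold ball in *; simpl in *; unfold AbsRing_ball, abs, minus, plus, opp in *; simpl in *.
    replace (y / T + - 0) with ((y + - 0) * / T) by (field; lra).
    rewrite Rabs_mult, (Rabs_right (/ T)) by (apply Rle_ge, Rlt_le, Rinv_0_lt_compat; lra).
    apply (Rmult_lt_reg_r T); [lra|]; rewrite Rmult_assoc, Rinv_l by lra; lra.
  + apply (filterlim_comp _ _ _ V (fun v => / (15 * PI) * v) _ (locally (RInt (sym_quot (fun u => corr1 u / (q - u)) p) 0 5))).
    * apply RInt_sym_quot_right; [intro; apply ex_derive_corr1_div; exact hq|lra].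
    * apply (filterlim_scal_r (V := R_NormedModule) (/ (15 * PI))).
Qed.

(** * Hilbert transform of the bump *)

(* The principal value of the integral of [bump v / (a - v)] when [|a| <= 4]. *)
Definition hilbert_bump (a : R) : R := RInt (fun t => (bump (a - t) - bump (a + t)) / t) 0 5.
Definition potential_bump (a : R) : R := RInt (fun v => bump v / (a - v)) (-1) 1.

Lemma hilbert_integrand (a t : R) : (bump (a - t) - bump (a + t)) / t = - sym_quot bump a t.
Proof. unfold sym_quot, Rdiv; ring. Qed.

Lemma ex_RInt_hilbert (a b c : R) : 0 <= b -> 0 <= c ->
  ex_RInt (fun t => (bump (a - t) - bump (a + t)) / t) b c.
Proof.
intros hb hc; apply (ex_RInt_ext (fun t => opp (sym_quot bump a t))).
- intros x _; rewrite hilbert_integrand; reflexivity.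
- apply (ex_RInt_opp (V := R_NormedModule)), ex_RInt_sym_quot; auto; apply ex_derive_bump.
Qed.

Lemma hilbert_bump_odd (a : R) : hilbert_bump (- a) = - hilbert_bump a.
Proof.
unfold hilbert_bump; rewrite <- (RInt_opp (V := R_CompleteNormedModule)) by (apply ex_RInt_hilbert; lra).
apply RInt_ext; intros t _; unfold opp; simpl.
replace (- a - t) with (- (a + t)) by ring; replace (- a + t) with (- (a - t)) by ring.
rewrite !bump_even; unfold Rdiv; ring.
Qed.

Lemma ex_RInt_potential (a b c : R) : 1 < a -> ex_RInt (fun v => bump v / (a - v)) b c.
Proof.
intro ha; apply (ex_RInt_continuous (V := R_CompleteNormedModule)); intros v _.
destruct (Rlt_le_dec v a) as [h|h].
- apply continuous_of_ex_derive.
  apply (ex_derive_div bump (fun v => a - v)); [apply ex_derive_bump|auto_derive; exact I|lra].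
- apply continuous_of_ex_derive; exists 0; apply (is_derive_ext_loc (fun _ => 0)); [|apply (is_derive_const 0)].
  apply (locally_interval _ v 1 p_infty); simpl; [lra|exact I|].
  intros y hy _; rewrite bump_out; [unfold Rdiv; ring|rewrite Rabs_right; lra].
Qed.

(** Substitute [v = a - t]. For [a > 1] the reflected half [a + t] misses the support, and [a <= 4]
    puts all of [[-1, 1]] within distance 5 of [a]. *)
Lemma hilbert_potential (a : R) : 1 < a <= 4 -> hilbert_bump a = potential_bump a.
Proof.
intro ha.
assert (H := RInt_correct (V := R_CompleteNormedModule) _ (-1) 1 (ex_RInt_potential a (-1) 1 ltac:(lra))).
apply (is_RInt_extend_zero (V := R_NormedModule) _ _ _ (a - 5) a) in H; try lra.
2: { intros x hx; rewrite bump_out; [unfold Rdiv; rewrite Rmult_0_l; reflexivity|unfold Rabs; destruct Rcase_abs; lra]. }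
apply (is_RInt_swap (V := R_NormedModule)) in H.
assert (K := is_RInt_comp_lin (V := R_NormedModule) (fun v => bump v / (a - v)) (-1) a 0 5
  (opp (potential_bump a))).
replace (-1 * 0 + a) with a in K by ring; replace (-1 * 5 + a) with (a - 5) in K by ring.
specialize (K H); apply (is_RInt_opp (V := R_NormedModule)) in K.
rewrite opp_opp in K.
apply is_RInt_unique; revert K; apply is_RInt_ext; intros t.
rewrite Rmin_left, Rmax_right by lra; intro ht.
rewrite (bump_out (a + t)) by (rewrite Rabs_right; lra).
unfold opp, scal; simpl; unfold mult; simpl.
replace (-1 * t + a) with (a - t) by ring; field; lra.
Qed.

(** Partial fractions: [1 / ((q - u) (u - p))] is [(1 / (q - u) + 1 / (u - p)) / (q - p)]. The first
    term is regular on the support; the second has the pole at [p], with the sign opposite to that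
    of [hilbert_bump]. *)
Lemma RInt_sym_quot_corr1 (p q : R) : 2 < q -> -3 <= p <= 3 -> p < q ->
  RInt (sym_quot (fun u => corr1 u / (q - u)) p) 0 5 =
  / (q - p) * (potential_bump (q - 1) + potential_bump (q + 1)
               - hilbert_bump (p - 1) - hilbert_bump (p + 1)).
Proof.
intros hq hp hpq.
set (g := fun u => corr1 u / (q - u)).
assert (hg : forall u, ex_derive g u) by (intro; apply ex_derive_corr1_div; exact hq).
assert (cg : forall u, continuous g u) by (intro; apply continuous_of_ex_derive, hg).
assert (G : is_RInt g (-2) 2 (potential_bump (q - 1) + potential_bump (q + 1))).
{ assert (G1 := RInt_correct (V := R_CompleteNormedModule) _ (-1) 1 (ex_RInt_potential (q - 1) (-1) 1 ltac:(lra))).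
  assert (G2 := RInt_correct (V := R_CompleteNormedModule) _ (-1) 1 (ex_RInt_potential (q + 1) (-1) 1 ltac:(lra))).
  apply (is_RInt_extend_zero (V := R_NormedModule) _ _ _ (-3) 1) in G1; try lra.
  2: { intros x hx; rewrite bump_out; [unfold Rdiv; rewrite Rmult_0_l; reflexivity|unfold Rabs; destruct Rcase_abs; lra]. }
  apply (is_RInt_extend_zero (V := R_NormedModule) _ _ _ (-1) 3) in G2; try lra.
  2: { intros x hx; rewrite bump_out; [unfold Rdiv; rewrite Rmult_0_l; reflexivity|unfold Rabs; destruct Rcase_abs; lra]. }
  assert (K1 := is_RInt_comp_lin (V := R_NormedModule) (fun v => bump v / (q - 1 - v)) 1 (-1) (-2) 2
    (potential_bump (q - 1))).
  assert (K2 := is_RInt_comp_lin (V := R_NormedModule) (fun v => bump v / (q + 1 - v)) 1 1 (-2) 2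
    (potential_bump (q + 1))).
  replace (1 * -2 + -1) with (-3) in K1 by ring; replace (1 * 2 + -1) with 1 in K1 by ring.
  replace (1 * -2 + 1) with (-1) in K2 by ring; replace (1 * 2 + 1) with 3 in K2 by ring.
  specialize (K1 G1); specialize (K2 G2).
  assert (K := is_RInt_plus (V := R_NormedModule) _ _ _ _ _ _ K1 K2); revert K.
  apply is_RInt_ext; intros u _; unfold plus, scal, g, corr1; simpl; unfold mult; simpl.
  replace (1 * u + -1) with (u - 1) by ring; replace (1 * u + 1) with (u + 1) by ring.
  replace (q - 1 - (u - 1)) with (q - u) by ring; replace (q + 1 - (u + 1)) with (q - u) by ring.
  unfold Rdiv; ring. }
apply (is_RInt_extend_zero (V := R_NormedModule) _ _ _ (p - 5) (p + 5)) in G; try lra.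
2: { intros x hx; unfold g; rewrite corr1_out; [unfold Rdiv; rewrite Rmult_0_l; reflexivity|unfold Rabs; destruct Rcase_abs; lra]. }
assert (exg : forall a b, ex_RInt g a b).
{ intros; apply (ex_RInt_continuous (V := R_CompleteNormedModule)); auto. }
assert (E1 := RInt_correct (V := R_CompleteNormedModule) _ _ _ (exg (p - 5) p)).
assert (E2 := RInt_correct (V := R_CompleteNormedModule) _ _ _ (exg p (p + 5))).
assert (eG : RInt g (p - 5) p + RInt g p (p + 5) = potential_bump (q - 1) + potential_bump (q + 1)).
{ rewrite <- (is_RInt_unique (V := R_CompleteNormedModule) _ _ _ _ G).
  apply (RInt_Chasles (V := R_CompleteNormedModule)); apply exg. }
(* The regular part is folded about [p], to match the half-line form of the singular part. *)
apply (is_RInt_swap (V := R_NormedModule)) in E1.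
assert (F1 := is_RInt_comp_lin (V := R_NormedModule) g (-1) p 0 5 (opp (RInt g (p - 5) p))).
assert (F2 := is_RInt_comp_lin (V := R_NormedModule) g 1 p 0 5 (RInt g p (p + 5))).
replace (-1 * 0 + p) with p in F1 by ring; replace (-1 * 5 + p) with (p - 5) in F1 by ring.
replace (1 * 0 + p) with p in F2 by ring; replace (1 * 5 + p) with (p + 5) in F2 by ring.
specialize (F1 E1); specialize (F2 E2).
assert (B1 := RInt_correct (V := R_CompleteNormedModule) _ _ _ (ex_RInt_hilbert (p - 1) 0 5 ltac:(lra) ltac:(lra))).
assert (B2 := RInt_correct (V := R_CompleteNormedModule) _ _ _ (ex_RInt_hilbert (p + 1) 0 5 ltac:(lra) ltac:(lra))).
assert (A := is_RInt_minus (V := R_NormedModule) _ _ _ _ _ _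
  (is_RInt_minus (V := R_NormedModule) _ _ _ _ _ _ F2 F1)
  (is_RInt_plus (V := R_NormedModule) _ _ _ _ _ _ B1 B2)).
apply (is_RInt_scal (V := R_NormedModule) _ _ _ (/ (q - p))) in A.
apply is_RInt_unique.
match type of A with is_RInt _ _ _ ?l => replace (/ (q - p) * _) with l end.
2: { rewrite <- eG; unfold hilbert_bump, scal, minus, plus, opp; simpl; unfold mult; simpl; ring. }
revert A; apply is_RInt_ext; intros t; rewrite Rmin_left, Rmax_right by lra; intro ht.
unfold scal, minus, plus, opp; simpl; unfold mult; simpl.
assert (gd : forall u, u <> p -> g u / (u - p) = / (q - p) * (corr1 u / (u - p) + g u)).
{ intros u hu; unfold g; destruct (Req_dec u q) as [->|n].
  - rewrite corr1_out by (rewrite Rabs_right; lra); unfold Rdiv; ring.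
  - field; lra. }
unfold sym_quot.
replace ((g (p + t) - g (p - t)) / t) with (g (p + t) / (p + t - p) + g (p - t) / (p - t - p)) by (field; lra).
rewrite !gd by lra; unfold corr1.
replace (1 * t + p) with (p + t) by ring; replace (-1 * t + p) with (p - t) by ring.
replace (p - 1 - t) with (p - t - 1) by ring; replace (p - 1 + t) with (p + t - 1) by ring.
replace (p + 1 - t) with (p - t + 1) by ring; replace (p + 1 + t) with (p + t + 1) by ring.
field; lra.
Qed.

(** The range of [sigma] keeps the pole [sigma + 21/10] above 2 and the pole [sigma - 21/10] in
    [[-3, 3]]. *)
Lemma resp_H_formula (T sigma : R) : 0 < T -> - (9 / 100) <= sigma <= 5 ->
  resp_H (cos2_pulse T) T (3 * PI / (2 * T)) (21 / 10 * T) (sigma * T) =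
  (potential_bump (sigma + 11 / 10) + potential_bump (sigma + 31 / 10)
   - hilbert_bump (sigma - 31 / 10) - hilbert_bump (sigma - 11 / 10)) / (252 * PI ^ 3).
Proof.
intros hT hs; generalize PI_RGT_0; intro hpi; unfold resp_H.
rewrite PV_corr by lra; rewrite RInt_sym_quot_corr1 by lra.
replace (sigma + 21 / 10 - 1) with (sigma + 11 / 10) by field.
replace (sigma + 21 / 10 + 1) with (sigma + 31 / 10) by field.
replace (sigma - 21 / 10 - 1) with (sigma - 31 / 10) by field.
replace (sigma - 21 / 10 + 1) with (sigma - 11 / 10) by field.
replace (sigma + 21 / 10 - (sigma - 21 / 10)) with (21 / 5) by field.
field; lra.
Qed.

Lemma resp_Q_formula (T sigma : R) : 0 < T -> - (9 / 100) <= sigma ->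
  resp_Q (cos2_pulse T) (3 * PI / (2 * T)) (21 / 10 * T) (sigma * T) =
  - (PI * corr1 (sigma - 21 / 10)) / (252 * PI ^ 3).
Proof.
intros hT hs; generalize PI_RGT_0; intro hpi; unfold resp_Q.
rewrite !corr_cos2_pulse by lra.
replace ((sigma * T - 21 / 10 * T) / T) with (sigma - 21 / 10) by (field; lra).
replace ((sigma * T + 21 / 10 * T) / T) with (sigma + 21 / 10) by (field; lra).
rewrite (corr1_out (sigma + 21 / 10)) by (rewrite Rabs_right; lra).
field; lra.
Qed.

(** * The spectral integral *)

(* Bernstein form with the binomial factors absorbed in the coefficients. *)
Fixpoint bernstein (l : list R) (y z : R) : R :=
  match l with
  | [] => 0
  | c :: l' => c * z ^ length l' + y * bernstein l' y z
  end.

Lemma bernstein_pos (l : list R) (y z : R) :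
  List.Forall (Rle 0) l -> 0 <= y -> 0 <= z -> 0 <= bernstein l y z.
Proof.
intros hl hy hz; induction hl as [|c l hc hl IH]; simpl; [lra|].
apply Rplus_le_le_0_compat; apply Rmult_le_pos; auto; apply pow_le; exact hz.
Qed.

(** Applied with [y + z = 1]: then a polynomial can be written in this form at any larger degree,
    and raising the degree removes negative coefficients. The factor [k] makes the coefficients
    integers. *)
Lemma bernstein_certificate (k : R) (l : list R) (y z a b : R) :
  0 < k -> List.Forall (Rle 0) l -> 0 <= y -> 0 <= z -> b - a = bernstein l y z / k -> a <= b.
Proof.
intros hk hl hy hz e; apply Rminus_le_0; rewrite e.
apply Rdiv_le_0_compat; [apply bernstein_pos; assumption|exact hk].
Qed.

(** Polynomial bounds for the rational factor of [spectral], one per piece between zeros of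
    [cos (PI x)], with [w] measured from the nearest integer. On this first piece the factor [x] is
    left out, to be multiplied back exactly. Where both bounds occur, they differ only in the
    constant term. *)
Lemma spectral_weight_upper_0 (w : R) : 0 <= w <= 1 / 2 ->
  1 <= (286 / 1000 - 1492 / 1000 * w + 3353 / 1000 * w ^ 2 - 2782 / 1000 * w ^ 3)
    * ((w + 1 / 2) * (w + 3 / 2) * (w + 5 / 2)) ^ 2.
Proof.
intro hw; apply (bernstein_certificate 256000
    [1400; 136160; 1134241; 4014806; 7258654; 6232928; 1221049; 1133650; 9340440; 15510288;
     12071824; 4824608; 849920; 25088]
    (2 * w) (1 - 2 * w)); [lra|repeat (constructor; [lra|]); constructor|lra|lra|simpl; field].
Qed.

Lemma spectral_weight_lower_0 (w : R) : 0 <= w <= 1 / 2 ->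
  (275 / 1000 - 1492 / 1000 * w + 3353 / 1000 * w ^ 2 - 2782 / 1000 * w ^ 3)
    * ((w + 1 / 2) * (w + 3 / 2) * (w + 5 / 2)) ^ 2 <= 1.
Proof.
intro hw; apply (bernstein_certificate 256000
    [8500; 5900; 17135; 1186436; 6243567; 14593946; 18534360; 13081232; 4663664; 652960;
     129536; 76288]
    (2 * w) (1 - 2 * w)); [lra|repeat (constructor; [lra|]); constructor|lra|lra|simpl; field].
Qed.

Lemma spectral_weight_upper_1 (w : R) : - (1 / 2) <= w <= 1 / 2 ->
  1 + w <= (583 / 100000 - 996 / 100000 * w + 979 / 100000 * w ^ 2 - 537 / 100000 * w ^ 3)
    * ((1 + w + 1 / 2) * (1 + w + 3 / 2) * (1 + w + 5 / 2)) ^ 2.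
Proof.
intro hw; apply (bernstein_certificate 800000
    [1148; 1008; 76183; 762935; 2935547; 5893615; 6701669; 4398305; 2164957; 1976101; 1994448;
     1076260; 244448; 10176]
    (1 / 2 + w) (1 / 2 - w)); [lra|repeat (constructor; [lra|]); constructor|lra|lra|simpl; field].
Qed.

Lemma spectral_weight_lower_1 (w : R) : - (1 / 2) <= w <= 1 / 2 ->
  (577 / 100000 - 996 / 100000 * w + 979 / 100000 * w ^ 2 - 537 / 100000 * w ^ 3)
    * ((1 + w + 1 / 2) * (1 + w + 3 / 2) * (1 + w + 5 / 2)) ^ 2 <= 1 + w.
Proof.
intro hw; apply (bernstein_certificate 800000
    [580; 26632; 90053; 51527; 82210; 1115926; 2959069; 3369151; 1785560; 356892; 20128; 17472]
    (1 / 2 + w) (1 / 2 - w)); [lra|repeat (constructor; [lra|]); constructor|lra|lra|simpl; field].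
Qed.

Lemma spectral_weight_upper_2 (w : R) : - (1 / 2) <= w <= 1 / 2 ->
  2 + w <= (133 / 100000 - 186 / 100000 * w + 144 / 100000 * w ^ 2)
    * ((2 + w + 1 / 2) * (2 + w + 3 / 2) * (2 + w + 5 / 2)) ^ 2.
Proof.
intro hw; apply (bernstein_certificate 50000
    [456; 23008; 167252; 539080; 939475; 915751; 456775; 80581; 11942; 29280; 11800]
    (1 / 2 + w) (1 / 2 - w)); [lra|repeat (constructor; [lra|]); constructor|lra|lra|simpl; field].
Qed.

Lemma spectral_weight_upper_3 (w : R) : - (1 / 2) <= w <= 1 / 2 ->
  3 + w <= (50 / 100000 - 40 / 100000 * w)
    * ((3 + w + 1 / 2) * (3 + w + 3 / 2) * (3 + w + 5 / 2)) ^ 2.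
Proof.
intro hw; apply (bernstein_certificate 10000
    [200; 16480; 97663; 242255; 311664; 214308; 71720; 8200]
    (1 / 2 + w) (1 / 2 - w)); [lra|repeat (constructor; [lra|]); constructor|lra|lra|simpl; field].
Qed.

Lemma PI_bounds : 31415 / 10000 < PI < 31416 / 10000.
Proof.
(* Alternating arctangent series at [1/3] and [1/7]. *)
generalize (PI_2_3_7_ineq 2); unfold tg_alt, PI_2_3_7_tg, Ratan_seq; simpl; lra.
Qed.

Lemma cos_sqr_shift (x : R) : cos (PI * (x - 1)) ^ 2 = cos (PI * x) ^ 2.
Proof.
replace (PI * (x - 1)) with (- (PI - PI * x)) by ring.
rewrite cos_neg, Rtrigo_facts.cos_pi_minus; ring.
Qed.

Lemma cos_sqr_shift_nat (k : nat) (x : R) : cos (PI * (x - INR k)) ^ 2 = cos (PI * x) ^ 2.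
Proof.
induction k as [|k IH]; [simpl; rewrite Rminus_0_r; reflexivity|].
rewrite S_INR, <- IH; replace (x - (INR k + 1)) with (x - INR k - 1) by ring; apply cos_sqr_shift.
Qed.

Definition quartic (c1 c2 c3 c4 c0 x : R) : R := c0 + c1 * x + c2 * x ^ 2 + c3 * x ^ 3 + c4 * x ^ 4.

(** From [cos ^ 2 = (1 + cos (2 PI x)) / 2] and repeated integration by parts. *)
Definition quartic_cos2_primitive (c1 c2 c3 c4 c0 x : R) : R :=
  (c0 * x + c1 * x ^ 2 / 2 + c2 * x ^ 3 / 3 + c3 * x ^ 4 / 4 + c4 * x ^ 5 / 5) / 2
  + (c0 + c1 * x + c2 * x ^ 2 + c3 * x ^ 3 + c4 * x ^ 4) * sin (2 * (PI * x)) / (4 * PI)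
  + (c1 + 2 * c2 * x + 3 * c3 * x ^ 2 + 4 * c4 * x ^ 3) * cos (2 * (PI * x)) / (8 * PI ^ 2)
  - (2 * c2 + 6 * c3 * x + 12 * c4 * x ^ 2) * sin (2 * (PI * x)) / (16 * PI ^ 3)
  - (6 * c3 + 24 * c4 * x) * cos (2 * (PI * x)) / (32 * PI ^ 4)
  + 24 * c4 * sin (2 * (PI * x)) / (64 * PI ^ 5).

Lemma is_RInt_quartic_cos2 (c1 c2 c3 c4 c0 n a b : R) :
  is_RInt (fun x => quartic c1 c2 c3 c4 c0 (x - n) * cos (PI * (x - n)) ^ 2) a b
    (quartic_cos2_primitive c1 c2 c3 c4 c0 (b - n) - quartic_cos2_primitive c1 c2 c3 c4 c0 (a - n)).
Proof.
generalize PI_RGT_0; intro hpi.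
apply (is_RInt_antiderivative (fun x => quartic_cos2_primitive c1 c2 c3 c4 c0 (x - n))).
- intro x; unfold quartic, quartic_cos2_primitive; auto_derive; [exact I|].
  change (x + - n) with (x - n); rewrite cos_2a_cos; field; lra.
- intro x; apply continuous_of_ex_derive; unfold quartic; auto_derive; exact I.
Qed.

Lemma quartic_cos2_half_period (c1 c2 c3 c4 : R) :
  is_RInt (fun x => quartic c1 c2 c3 c4 0 x * cos (PI * x) ^ 2) 0 (1 / 2)
   (c1 * (1 / 16 - 1 / (4 * PI ^ 2)) + c2 * (1 / 48 - 1 / (8 * PI ^ 2))
    + c3 * (1 / 128 - 3 / (32 * PI ^ 2) + 3 / (8 * PI ^ 4))
    + c4 * (1 / 320 - 1 / (16 * PI ^ 2) + 3 / (8 * PI ^ 4))).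
Proof.
generalize PI_RGT_0; intro hpi.
assert (H := is_RInt_quartic_cos2 c1 c2 c3 c4 0 0 0 (1 / 2)).
rewrite !Rminus_0_r in H.
match type of H with is_RInt _ _ _ ?l => match goal with |- is_RInt _ _ _ ?l' =>
  replace l' with l end end.
- revert H; apply is_RInt_ext; intros x _; rewrite Rminus_0_r; reflexivity.
- unfold quartic_cos2_primitive.
  replace (2 * (PI * (1 / 2))) with PI by field; replace (2 * (PI * 0)) with 0 by ring.
  rewrite sin_PI, cos_PI, sin_0, cos_0; field; lra.
Qed.

(** Over a full period centred at [k] the odd powers integrate to 0, so [c1] and [c3] leave no trace
    in the value. *)
Lemma quartic_cos2_period (c1 c2 c3 c0 : R) (k : nat) :
  is_RInt (fun x => quartic c1 c2 c3 0 c0 (x - INR k) * cos (PI * x) ^ 2)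
    (INR k - 1 / 2) (INR k + 1 / 2) (c0 / 2 + c2 * (1 / 24 - 1 / (4 * PI ^ 2))).
Proof.
generalize PI_RGT_0; intro hpi.
assert (H := is_RInt_quartic_cos2 c1 c2 c3 0 c0 (INR k) (INR k - 1 / 2) (INR k + 1 / 2)).
match type of H with is_RInt _ _ _ ?l => match goal with |- is_RInt _ _ _ ?l' =>
  replace l' with l end end.
- revert H; apply is_RInt_ext; intros x _; rewrite cos_sqr_shift_nat; reflexivity.
- unfold quartic_cos2_primitive.
  replace (INR k + 1 / 2 - INR k) with (1 / 2) by ring.
  replace (INR k - 1 / 2 - INR k) with (- (1 / 2)) by ring.
  replace (2 * (PI * (1 / 2))) with PI by field.
  replace (2 * (PI * - (1 / 2))) with (- PI) by field.
  rewrite sin_neg, cos_neg, sin_PI, cos_PI; field; lra.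
Qed.

(* [4 PI^2 P] is the integral of this function on [0, oo), with k = PI x / T. *)
Definition spectral (x : R) : R :=
  x * cos (PI * x) ^ 2 / ((x + 1 / 2) * (x + 3 / 2) * (x + 5 / 2)) ^ 2.

Lemma ex_derive_spectral (x : R) : 0 <= x -> ex_derive spectral x.
Proof.
intro hx; unfold spectral; auto_derive.
repeat apply conj; try exact I; repeat apply Rmult_integral_contrapositive_currified; lra.
Qed.

Lemma ex_RInt_spectral (a b : R) : 0 <= a -> 0 <= b -> ex_RInt spectral a b.
Proof.
intros ha hb; apply (ex_RInt_continuous (V := R_CompleteNormedModule)).
intros x [hx _]; apply continuous_of_ex_derive, ex_derive_spectral.
generalize (Rmin_glb a b 0 ha hb); lra.
Qed.

Lemma spectral_pos (x : R) : 0 <= x -> 0 <= spectral x.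
Proof.
intro hx; unfold spectral; apply Rdiv_le_0_compat.
- apply Rmult_le_pos; [exact hx|apply pow2_ge_0].
- apply pow_lt; repeat apply Rmult_lt_0_compat; lra.
Qed.

Lemma RInt_spectral_le (a b l : R) (f : R -> R) : 0 <= a <= b ->
  is_RInt (fun x => f x * cos (PI * x) ^ 2) a b l ->
  (forall x, a <= x <= b -> x <= f x * ((x + 1 / 2) * (x + 3 / 2) * (x + 5 / 2)) ^ 2) ->
  RInt spectral a b <= l.
Proof.
intros hab hl h; rewrite <- (is_RInt_unique (V := R_CompleteNormedModule) _ _ _ _ hl).
apply RInt_le; [lra|apply ex_RInt_spectral; lra|exists l; exact hl|].
intros x hx; unfold spectral.
assert (hD : 0 < ((x + 1 / 2) * (x + 3 / 2) * (x + 5 / 2)) ^ 2)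
  by (apply pow_lt; repeat apply Rmult_lt_0_compat; lra).
apply (proj2 (Rle_div_l _ _ _ hD)).
apply Rle_trans with ((f x * ((x + 1 / 2) * (x + 3 / 2) * (x + 5 / 2)) ^ 2) * cos (PI * x) ^ 2).
- apply Rmult_le_compat_r; [apply pow2_ge_0|apply h; lra].
- right; ring.
Qed.

Lemma RInt_spectral_ge (a b l : R) (f : R -> R) : 0 <= a <= b ->
  is_RInt (fun x => f x * cos (PI * x) ^ 2) a b l ->
  (forall x, a <= x <= b -> f x * ((x + 1 / 2) * (x + 3 / 2) * (x + 5 / 2)) ^ 2 <= x) ->
  l <= RInt spectral a b.
Proof.
intros hab hl h; rewrite <- (is_RInt_unique (V := R_CompleteNormedModule) _ _ _ _ hl).
apply RInt_le; [lra|exists l; exact hl|apply ex_RInt_spectral; lra|].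
intros x hx; unfold spectral.
assert (hD : 0 < ((x + 1 / 2) * (x + 3 / 2) * (x + 5 / 2)) ^ 2)
  by (apply pow_lt; repeat apply Rmult_lt_0_compat; lra).
apply (proj1 (Rle_div_r _ _ _ hD)).
apply Rle_trans with ((f x * ((x + 1 / 2) * (x + 3 / 2) * (x + 5 / 2)) ^ 2) * cos (PI * x) ^ 2).
- right; ring.
- apply Rmult_le_compat_r; [apply pow2_ge_0|apply h; lra].
Qed.

Lemma RInt_spectral_Chasles (a b c : R) : 0 <= a -> 0 <= b -> 0 <= c ->
  RInt spectral a c = RInt spectral a b + RInt spectral b c.
Proof.
intros ha hb hc; symmetry; apply (RInt_Chasles (V := R_CompleteNormedModule)); apply ex_RInt_spectral; assumption.
Qed.

(** Bound [cos ^ 2] by 1 and the squared denominator below by [x * (x + 7/4) ^ 5]. Five shifts of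
    [7/4] total [35/4], just under the total 9 of the six shifts in the denominator, and the
    minorant leaves an explicit primitive. *)
Lemma spectral_tail (M : R) : 7 / 2 <= M -> RInt spectral (7 / 2) M <= 1 / 4 / (21 / 4) ^ 4.
Proof.
intro hM.
set (f := fun x => / (x + 7 / 4) ^ 5); set (F := fun x => - / 4 / (x + 7 / 4) ^ 4).
assert (hf : is_RInt f (7 / 2) M (F M - F (7 / 2))).
{ apply (is_RInt_derive (V := R_CompleteNormedModule) F f).
  - intros x; rewrite Rmin_left, Rmax_right by lra; intro hx.
    unfold F, f; auto_derive; [repeat apply conj; try exact I; repeat apply Rmult_integral_contrapositive_currified; lra|field; lra].
  - intros x; rewrite Rmin_left, Rmax_right by lra; intro hx.
    apply continuous_of_ex_derive; unfold f; auto_derive.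
    repeat apply conj; try exact I; repeat apply Rmult_integral_contrapositive_currified; lra. }
apply Rle_trans with (RInt f (7 / 2) M).
- apply RInt_le; [lra|apply ex_RInt_spectral; lra|eexists; exact hf|].
  intros x hx; unfold spectral, f.
  assert (hD : 0 < ((x + 1 / 2) * (x + 3 / 2) * (x + 5 / 2)) ^ 2)
    by (apply pow_lt; repeat apply Rmult_lt_0_compat; lra).
  assert (hE : 0 < (x + 7 / 4) ^ 5) by (apply pow_lt; lra).
  apply (proj2 (Rle_div_l _ _ _ hD)); rewrite (Rmult_comm (/ _)); apply (proj1 (Rle_div_r _ _ _ hE)).
  assert (hc : cos (PI * x) ^ 2 <= 1) by (generalize (COS_bound (PI * x)); intro; nra).
  apply Rle_trans with (x * (x + 7 / 4) ^ 5).
  + apply Rmult_le_compat_r; [lra|]; apply (Rmult_le_compat_l x) in hc; lra.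
  + set (t := x - 7 / 2); assert (ht : 0 <= t) by (unfold t; lra).
    replace x with (7 / 2 + t) by (unfold t; ring).
    apply (proj2 (Rminus_le_0 _ _)).
    replace (((7 / 2 + t + 1 / 2) * (7 / 2 + t + 3 / 2) * (7 / 2 + t + 5 / 2)) ^ 2 -
      (7 / 2 + t) * (7 / 2 + t + 7 / 4) ^ 5) with
      (902493 / 2048 + 488469 / 1024 * t + 54511 / 256 * t ^ 2 + 1545 / 32 * t ^ 3
       + 11 / 2 * t ^ 4 + 1 / 4 * t ^ 5) by field.
    repeat apply Rplus_le_le_0_compat; try lra; apply Rmult_le_pos; try lra; apply pow_le; exact ht.
- rewrite (is_RInt_unique (V := R_CompleteNormedModule) _ _ _ _ hf); unfold F.
  assert (0 < / (M + 7 / 4) ^ 4) by (apply Rinv_0_lt_compat, pow_lt; lra).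
  replace (7 / 2 + 7 / 4) with (21 / 4) by field; unfold Rdiv; lra.
Qed.

Lemma inv_PI_sqr_bounds : 101320 / 1000000 < / PI ^ 2 < 101328 / 1000000.
Proof.
destruct PI_bounds as [h1 h2].
assert (0 < PI ^ 2) by (apply pow_lt; lra).
split.
- apply (Rmult_lt_reg_r (PI ^ 2)); [assumption|rewrite Rinv_l by lra; nra].
- apply (Rmult_lt_reg_r (PI ^ 2)); [assumption|rewrite Rinv_l by lra; nra].
Qed.

Lemma RInt_spectral_upper (M : R) : 0 <= M -> RInt spectral 0 M <= 83 / 10000.
Proof.
intro hM.
(* The integrand is nonnegative, so the range may be enlarged to contain the four pieces up to
   [7/2]. *)
apply Rle_trans with (RInt spectral 0 (Rmax M (7 / 2))).
{ assert (M <= Rmax M (7 / 2)) by apply Rmax_l.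
  rewrite (RInt_spectral_Chasles 0 M (Rmax M (7 / 2))) by lra.
  assert (0 <= RInt spectral M (Rmax M (7 / 2))); [|lra].
  apply RInt_ge_0; [lra|apply ex_RInt_spectral; lra|intros; apply spectral_pos; lra]. }
assert (hN : 7 / 2 <= Rmax M (7 / 2)) by apply Rmax_r.
set (N := Rmax M (7 / 2)) in *; clearbody N; clear M hM.
assert (w0 := RInt_spectral_le 0 (1 / 2) _ _ ltac:(lra)
  (quartic_cos2_half_period (286 / 1000) (- (1492 / 1000)) (3353 / 1000) (- (2782 / 1000)))).
assert (w1 := RInt_spectral_le (INR 1 - 1 / 2) (INR 1 + 1 / 2) _ _ ltac:(simpl; lra)
  (quartic_cos2_period (- (996 / 100000)) (979 / 100000) (- (537 / 100000)) (583 / 100000) 1)).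
assert (w2 := RInt_spectral_le (INR 2 - 1 / 2) (INR 2 + 1 / 2) _ _ ltac:(simpl; lra)
  (quartic_cos2_period (- (186 / 100000)) (144 / 100000) 0 (133 / 100000) 2)).
assert (w3 := RInt_spectral_le (INR 3 - 1 / 2) (INR 3 + 1 / 2) _ _ ltac:(simpl; lra)
  (quartic_cos2_period (- (40 / 100000)) 0 0 (50 / 100000) 3)).
replace (INR 1 - 1 / 2) with (1 / 2) in w1 by (simpl; field).
replace (INR 1 + 1 / 2) with (3 / 2) in w1 by (simpl; field).
replace (INR 2 - 1 / 2) with (3 / 2) in w2 by (simpl; field).
replace (INR 2 + 1 / 2) with (5 / 2) in w2 by (simpl; field).
replace (INR 3 - 1 / 2) with (5 / 2) in w3 by (simpl; field).
replace (INR 3 + 1 / 2) with (7 / 2) in w3 by (simpl; field).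
assert (t := spectral_tail N hN).
rewrite (RInt_spectral_Chasles 0 (1 / 2) N), (RInt_spectral_Chasles (1 / 2) (3 / 2) N),
  (RInt_spectral_Chasles (3 / 2) (5 / 2) N), (RInt_spectral_Chasles (5 / 2) (7 / 2) N) by lra.
lapply w0; [clear w0; intro w0|].
2: { intros x hx; generalize (spectral_weight_upper_0 x ltac:(lra)); unfold quartic; intro h.
  apply (Rmult_le_compat_l x) in h; [|lra]; lra. }
lapply w1; [clear w1; intro w1|].
2: { intros x hx; generalize (spectral_weight_upper_1 (x - 1) ltac:(lra)); unfold quartic; simpl INR.
  replace (1 + (x - 1)) with x by ring; intro h; lra. }
lapply w2; [clear w2; intro w2|].
2: { intros x hx; generalize (spectral_weight_upper_2 (x - 2) ltac:(lra)); unfold quartic; simpl INR.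
  replace (1 + 1) with 2 by ring; replace (2 + (x - 2)) with x by ring; intro h; lra. }
lapply w3; [clear w3; intro w3|].
2: { intros x hx; generalize (spectral_weight_upper_3 (x - 3) ltac:(lra)); unfold quartic; simpl INR.
  replace (1 + 1 + 1) with 3 by ring; replace (3 + (x - 3)) with x by ring; intro h; lra. }
generalize PI_RGT_0; intro.
replace (1 / (4 * PI ^ 2)) with (/ PI ^ 2 / 4) in * by (field; lra).
replace (1 / (8 * PI ^ 2)) with (/ PI ^ 2 / 8) in * by (field; lra).
replace (3 / (32 * PI ^ 2)) with (3 / 32 * / PI ^ 2) in * by (field; lra).
replace (1 / (16 * PI ^ 2)) with (/ PI ^ 2 / 16) in * by (field; lra).
replace (3 / (8 * PI ^ 4)) with (3 / 8 * (/ PI ^ 2) ^ 2) in * by (field; lra).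
(* All piece values are polynomials in [u], the inverse square of [PI]. *)
destruct inv_PI_sqr_bounds as [h1 h2]; set (u := / PI ^ 2) in *; clearbody u.
nra.
Qed.

Lemma RInt_spectral_lower : 65 / 10000 <= RInt spectral 0 (3 / 2).
Proof.
assert (w0 := RInt_spectral_ge 0 (1 / 2) _ _ ltac:(lra)
  (quartic_cos2_half_period (275 / 1000) (- (1492 / 1000)) (3353 / 1000) (- (2782 / 1000)))).
assert (w1 := RInt_spectral_ge (INR 1 - 1 / 2) (INR 1 + 1 / 2) _ _ ltac:(simpl; lra)
  (quartic_cos2_period (- (996 / 100000)) (979 / 100000) (- (537 / 100000)) (577 / 100000) 1)).
replace (INR 1 - 1 / 2) with (1 / 2) in w1 by (simpl; field).
replace (INR 1 + 1 / 2) with (3 / 2) in w1 by (simpl; field).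
rewrite (RInt_spectral_Chasles 0 (1 / 2) (3 / 2)) by lra.
lapply w0; [clear w0; intro w0|].
2: { intros x hx; generalize (spectral_weight_lower_0 x ltac:(lra)); unfold quartic; intro h.
  apply (Rmult_le_compat_l x) in h; [|lra]; lra. }
lapply w1; [clear w1; intro w1|].
2: { intros x hx; generalize (spectral_weight_lower_1 (x - 1) ltac:(lra)); unfold quartic; simpl INR.
  replace (1 + (x - 1)) with x by ring; intro h; lra. }
generalize PI_RGT_0; intro.
replace (1 / (4 * PI ^ 2)) with (/ PI ^ 2 / 4) in * by (field; lra).
replace (1 / (8 * PI ^ 2)) with (/ PI ^ 2 / 8) in * by (field; lra).
replace (3 / (32 * PI ^ 2)) with (3 / 32 * / PI ^ 2) in * by (field; lra).
replace (1 / (16 * PI ^ 2)) with (/ PI ^ 2 / 16) in * by (field; lra).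
replace (3 / (8 * PI ^ 4)) with (3 / 8 * (/ PI ^ 2) ^ 2) in * by (field; lra).
destruct inv_PI_sqr_bounds as [h1 h2]; set (u := / PI ^ 2) in *; clearbody u.
nra.
Qed.

(** * Fourier transform of the pulse *)

Lemma cos2_pulse_in (T t : R) : 0 < T -> - T <= t <= T ->
  cos2_pulse T t = (1 + cos (PI / T * t)) / 2.
Proof.
intros hT ht; unfold cos2_pulse; destruct Rle_dec as [h|h].
- rewrite <- cos_half_sqr; f_equal; f_equal; field; lra.
- exfalso; apply h, Rabs_le; exact ht.
Qed.

(** [P] only uses [omega >= Omega], where [omega T >= 3 PI / 2]; the hypothesis stays clear of the
    removable singularities at [omega T = 0] and [PI]. *)
Lemma fourier_cos2_pulse (T omega : R) : 0 < T -> PI < omega * T ->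
  fourier (cos2_pulse T) omega =
  RtoC (T * (PI ^ 2 * sin (omega * T)) / (omega * T * (PI ^ 2 - (omega * T) ^ 2))).
Proof.
intros hT hw; generalize PI_RGT_0; intro hpi.
set (a := PI / T).
assert (ha : 0 < a) by (apply Rdiv_lt_0_compat; lra).
assert (hoa : a < omega).
{ apply (Rmult_lt_reg_r T); [lra|]; unfold a, Rdiv; rewrite Rmult_assoc, Rinv_l; lra. }
apply (RInt_line_compact (V := C_R_CompleteNormedModule) _ (- T) T); [lra| |].
- intros t ht; unfold cos2_pulse; destruct Rle_dec as [h|h].
  + apply Rabs_le_between in h; lra.
  + apply injective_projections; simpl; unfold zero; simpl; ring.
- apply (is_RInt_fct_extend_pair (U := R_NormedModule) (V := R_NormedModule)).
  + set (F := fun t => sin (omega * t) / (2 * omega) + sin ((omega + a) * t) / (4 * (omega + a))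
      + sin ((omega - a) * t) / (4 * (omega - a))).
    apply (is_RInt_ext (fun t => (1 + cos (a * t)) / 2 * cos (omega * t))).
    { intros t; rewrite Rmin_left, Rmax_right by lra; intro ht; simpl.
      rewrite cos2_pulse_in by lra; unfold a; ring. }
    replace (T * (PI ^ 2 * sin (omega * T)) / (omega * T * (PI ^ 2 - (omega * T) ^ 2)))
      with (F T - F (- T)).
    * apply is_RInt_antiderivative.
      -- intro t; unfold F; auto_derive; [exact I|].
         replace ((omega + a) * t) with (omega * t + a * t) by ring.
         replace ((omega - a) * t) with (omega * t - a * t) by ring.
         rewrite cos_plus, cos_minus; field; lra.
      -- intro t; apply continuous_of_ex_derive; auto_derive; exact I.
    * unfold F; replace (omega * - T) with (- (omega * T)) by ring.
      replace ((omega + a) * - T) with (- ((omega + a) * T)) by ring.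
      replace ((omega - a) * - T) with (- ((omega - a) * T)) by ring.
      rewrite !sin_neg.
      replace ((omega + a) * T) with (omega * T + PI) by (unfold a; field; lra).
      replace ((omega - a) * T) with (- (PI - omega * T)) by (unfold a; field; lra).
      rewrite sin_neg, neg_sin, Rtrigo_facts.sin_pi_minus.
      replace PI with (a * T) by (unfold a; field; lra).
      field; repeat apply conj; try lra.
      replace ((a * T) ^ 2 - (omega * T) ^ 2) with (- (T * T * ((omega - a) * (omega + a)))) by ring.
      apply Ropp_neq_0_compat; repeat (apply Rmult_integral_contrapositive_currified; try lra).
  (* The imaginary part: its primitive is even, so the integral over [[-T, T]] vanishes. *)
  + set (F := fun t => - cos (omega * t) / (2 * omega) - cos ((omega + a) * t) / (4 * (omega + a))
      - cos ((omega - a) * t) / (4 * (omega - a))).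
    apply (is_RInt_ext (fun t => (1 + cos (a * t)) / 2 * sin (omega * t))).
    { intros t; rewrite Rmin_left, Rmax_right by lra; intro ht; simpl.
      rewrite cos2_pulse_in by lra; unfold a; ring. }
    replace 0 with (F T - F (- T)).
    * apply is_RInt_antiderivative.
      -- intro t; unfold F; auto_derive; [exact I|].
         replace ((omega + a) * t) with (omega * t + a * t) by ring.
         replace ((omega - a) * t) with (omega * t - a * t) by ring.
         rewrite sin_plus, sin_minus; field; lra.
      -- intro t; apply continuous_of_ex_derive; auto_derive; exact I.
    * unfold F; replace (omega * - T) with (- (omega * T)) by ring.
      replace ((omega + a) * - T) with (- ((omega + a) * T)) by ring.
      replace ((omega - a) * - T) with (- ((omega - a) * T)) by ring.
      rewrite !cos_neg; ring.
Qed.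

Lemma bounded_increasing_limit (F : R -> R) (U : R) :
  (forall x y, 0 <= x <= y -> F x <= F y) -> (forall x, 0 <= x -> F x <= U) ->
  exists l, filterlim F (Rbar_locally p_infty) (locally l) /\
    l <= U /\ forall x, 0 <= x -> F x <= l.
Proof.
intros mono bd.
set (E := fun y => exists x, 0 <= x /\ y = F x).
destruct (completeness E) as [l [ub lub]].
- exists U; intros y [x [hx ->]]; auto.
- exists (F 0), 0; split; [lra|reflexivity].
- exists l; split; [|split].
  + intros P [eps heps].
    destruct (classic (exists x, 0 <= x /\ l - eps < F x)) as [[x0 [hx0 h0]]|no].
    * exists x0; intros x hx; apply heps.
      unfold ball; simpl; unfold AbsRing_ball, abs, minus, plus, opp; simpl.
      assert (F x0 <= F x) by (apply mono; lra).
      assert (F x <= l) by (apply ub; exists x; split; [lra|reflexivity]).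
      apply Rabs_lt_between; destruct eps as [e he]; simpl in *; lra.
    * exfalso; assert (l <= l - eps); [|destruct eps as [e he]; simpl in *; lra].
      apply lub; intros y [x [hx ->]]; apply Rnot_lt_le; intro h; apply no; exists x; auto.
  + apply lub; intros y [x [hx ->]]; auto.
  + intros x hx; apply ub; exists x; auto.
Qed.

(** For [k = PI x / T] one has [(Omega + k) T = PI (x + 3/2)], so the sine becomes [- cos (PI x)]
    and the denominator factors with shifts [1/2], [3/2], [5/2]. The measure [k dk] absorbs all
    remaining powers of [T] and [PI]. *)
Lemma resp_P_spectral (T l : R) : 0 < T ->
  filterlim (fun M => RInt spectral 0 M) (Rbar_locally p_infty) (locally l) ->
  resp_P (cos2_pulse T) (3 * PI / (2 * T)) = l / (4 * PI ^ 2).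
Proof.
intros hT hl; generalize PI_RGT_0; intro hpi.
unfold resp_P; rewrite (is_RInt_gen_unique (V := R_CompleteNormedModule) _ l); [field; lra|].
intros P HP.
destruct (hl P HP) as [M0 hM0].
apply (Filter_prod _ _ _ (fun x => x = 0) (fun x => Rmax 0 (M0 * PI / T) < x)).
- reflexivity.
- exists (Rmax 0 (M0 * PI / T)); auto.
- intros x M -> hM; simpl.
  assert (h0 := Rmax_l 0 (M0 * PI / T)); assert (h1 := Rmax_r 0 (M0 * PI / T)).
  assert (hMT : M0 < M * T / PI).
  { apply (Rmult_lt_reg_r (PI / T)); [apply Rdiv_lt_0_compat; lra|].
    replace (M * T / PI * (PI / T)) with M by (field; lra).
    replace (M0 * (PI / T)) with (M0 * PI / T) by (field; lra); lra. }
  assert (hMp : 0 <= M * T / PI) by (apply Rdiv_le_0_compat; [apply Rmult_le_pos; lra|lra]).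
  exists (RInt spectral 0 (M * T / PI)); split; [|apply hM0, hMT].
  assert (H := RInt_correct (V := R_CompleteNormedModule) _ _ _ (ex_RInt_spectral 0 (M * T / PI) (Rle_refl 0) hMp)).
  assert (K := is_RInt_comp_lin (V := R_NormedModule) spectral (T / PI) 0 0 M (RInt spectral 0 (M * T / PI))).
  replace (T / PI * 0 + 0) with 0 in K by ring.
  replace (T / PI * M + 0) with (M * T / PI) in K by (field; lra).
  specialize (K H); revert K; apply is_RInt_ext.
  intros k; rewrite Rmin_left, Rmax_right by lra; intro hk.
  unfold scal; simpl; unfold mult; simpl.
  set (x := T / PI * k + 0).
  assert (hx : 0 < x).
  { unfold x; rewrite Rplus_0_r; apply Rmult_lt_0_compat; [apply Rdiv_lt_0_compat; lra|lra]. }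
  assert (ew : (3 * PI / (2 * T) + k) * T = PI * (x + 3 / 2)) by (unfold x; field; lra).
  assert (ek : k = PI * x / T) by (unfold x; field; lra).
  rewrite fourier_cos2_pulse by (rewrite ?ew; nra).
  rewrite Cmod_R, ew, Rmult_1_r, <- Rabs_mult, Rabs_right by (apply Rle_ge, Rle_0_sqr).
  replace (sin (PI * (x + 3 / 2))) with (- cos (PI * x)).
  2: { replace (PI * (x + 3 / 2)) with ((PI * x + PI / 2) + PI) by field.
    rewrite neg_sin, sin_plus, cos_PI2, sin_PI2; ring. }
  clearbody x; unfold spectral; rewrite ek; field; repeat apply conj; try lra.
  replace (PI ^ 2 * 4 - (PI * (x * 2 + 3)) ^ 2) with (- (PI * PI * ((2 * x + 1) * (2 * x + 5)))) by ring.
  apply Ropp_neq_0_compat; repeat (apply Rmult_integral_contrapositive_currified; try lra).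
Qed.

Lemma resp_P_bounds (T : R) : 0 < T -> exists l, 65 / 10000 <= l <= 83 / 10000 /\
  resp_P (cos2_pulse T) (3 * PI / (2 * T)) = l / (4 * PI ^ 2).
Proof.
intro hT.
destruct (bounded_increasing_limit (fun M => RInt spectral 0 M) (83 / 10000)) as (l & hl & hu & hlo).
- intros x y h; rewrite (RInt_spectral_Chasles 0 x y) by lra.
  assert (0 <= RInt spectral x y); [|lra].
  apply RInt_ge_0; [lra|apply ex_RInt_spectral; lra|intros; apply spectral_pos; lra].
- apply RInt_spectral_upper.
- exists l; split; [split; [|exact hu]|apply resp_P_spectral; assumption].
  apply Rle_trans with (1 := RInt_spectral_lower), hlo; lra.
Qed.

(** * Estimates of the response *)

#[local] Arguments pow : simpl never.

Lemma sin_sqr_half (v : R) : sin (PI * v / 2) ^ 2 = 1 - cos (PI * v / 2) ^ 2.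
Proof. generalize (sin2_cos2 (PI * v / 2)); unfold Rsqr; lra. Qed.

Lemma sin_half_PI_1 : sin (PI * 1 / 2) = 1.
Proof. replace (PI * 1 / 2) with (PI / 2) by field; apply sin_PI2. Qed.

Lemma sin_half_PI_m1 : sin (PI * -1 / 2) = -1.
Proof. replace (PI * -1 / 2) with (- (PI / 2)) by field; rewrite sin_neg, sin_PI2; ring. Qed.

Lemma cos_half_PI_1 : cos (PI * 1 / 2) = 0.
Proof. apply cos_half_PI_mult_1, Rabs_R1. Qed.

Lemma cos_half_PI_m1 : cos (PI * -1 / 2) = 0.
Proof. apply cos_half_PI_mult_1; rewrite Rabs_left; lra. Qed.

Lemma is_RInt_bump : is_RInt bump (-1) 1 (32 / (15 * PI)).
Proof.
generalize PI_RGT_0; intro hpi.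
set (F := fun v => 2 / PI * (sin (PI * v / 2) - 2 * sin (PI * v / 2) ^ 3 / 3 + sin (PI * v / 2) ^ 5 / 5)).
apply (is_RInt_ext (fun v => cos (PI * v / 2) ^ 5)).
{ intros v; rewrite Rmin_left, Rmax_right by lra; intro hv; symmetry; apply bump_in; lra. }
replace (32 / (15 * PI)) with (F 1 - F (-1)).
- apply is_RInt_antiderivative.
  + intro v; unfold F; auto_derive; [exact I|].
    change (PI * v * / 2) with (PI * v / 2).
    generalize (sin_sqr_half v); set (s := sin (PI * v / 2)); set (c := cos (PI * v / 2)); intro h.
    transitivity (c * (1 - s ^ 2) ^ 2); [field; lra|rewrite h; ring].
  + intro v; apply continuous_of_ex_derive; auto_derive; exact I.
- unfold F; rewrite sin_half_PI_1, sin_half_PI_m1; field; lra.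
Qed.

Lemma is_RInt_cos4 (a b : R) : is_RInt (fun v => cos (PI * v / 2) ^ 4) a b
  ((3 * b / 8 + 2 / PI * (cos (PI * b / 2) ^ 3 * sin (PI * b / 2) / 4 + 3 * cos (PI * b / 2) * sin (PI * b / 2) / 8))
   - (3 * a / 8 + 2 / PI * (cos (PI * a / 2) ^ 3 * sin (PI * a / 2) / 4 + 3 * cos (PI * a / 2) * sin (PI * a / 2) / 8))).
Proof.
generalize PI_RGT_0; intro hpi.
apply (is_RInt_antiderivative (fun v => 3 * v / 8 + 2 / PI * (cos (PI * v / 2) ^ 3 * sin (PI * v / 2) / 4
  + 3 * cos (PI * v / 2) * sin (PI * v / 2) / 8))).
- intro v; auto_derive; [exact I|].
  change (PI * v * / 2) with (PI * v / 2).
  generalize (sin_sqr_half v); set (s := sin (PI * v / 2)); set (c := cos (PI * v / 2)); intro h.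
  transitivity (3 / 8 + (c ^ 4 - 3 * c ^ 2 * s ^ 2) / 4 + 3 * (c ^ 2 - s ^ 2) / 8); [field; lra|rewrite h; field].
- intro v; apply continuous_of_ex_derive; auto_derive; exact I.
Qed.

Lemma is_RInt_cos6 : is_RInt (fun v => cos (PI * v / 2) ^ 6) (-1) 1 (5 / 8).
Proof.
generalize PI_RGT_0; intro hpi.
set (F := fun v => 5 * v / 16 + 2 / PI * (cos (PI * v / 2) ^ 5 * sin (PI * v / 2) / 6
  + 5 * cos (PI * v / 2) ^ 3 * sin (PI * v / 2) / 24 + 5 * cos (PI * v / 2) * sin (PI * v / 2) / 16)).
replace (5 / 8) with (F 1 - F (-1)).
- apply is_RInt_antiderivative.
  + intro v; unfold F; auto_derive; [exact I|].
    change (PI * v * / 2) with (PI * v / 2).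
    generalize (sin_sqr_half v); set (s := sin (PI * v / 2)); set (c := cos (PI * v / 2)); intro h.
    transitivity (5 / 16 + (c ^ 6 - 5 * c ^ 4 * s ^ 2) / 6 + 5 * (c ^ 4 - 3 * c ^ 2 * s ^ 2) / 24
      + 5 * (c ^ 2 - s ^ 2) / 16); [field; lra|rewrite h; field].
  + intro v; apply continuous_of_ex_derive; auto_derive; exact I.
- unfold F; rewrite cos_half_PI_1, cos_half_PI_m1; field; lra.
Qed.

Lemma cos_taylor (x : R) : -2 <= x <= 2 -> 1 - x ^ 2 / 2 <= cos x <= 1 - x ^ 2 / 2 + x ^ 4 / 24.
Proof.
intro hx; destruct (pre_cos_bound x 0 (proj1 hx) (proj2 hx)) as [h1 h2].
unfold cos_approx, cos_term in h1, h2; simpl in h1, h2; unfold pow in *; lra.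
Qed.

(* The Taylor bound gives this away from 1, the tangent to sin at 0 near 1. *)
Lemma cos_half_PI_le_parabola (v : R) : -1 <= v <= 1 -> cos (PI * v / 2) <= 1 - v ^ 2.
Proof.
assert (pos : forall v, 0 <= v <= 1 -> cos (PI * v / 2) <= 1 - v ^ 2).
{ clear v; intros v hv; destruct PI_bounds as [p1 p2].
  destruct (Rle_lt_dec v (9 / 10)) as [h|h].
  - assert (hb : -2 <= PI * v / 2 <= 2) by nra.
    apply Rle_trans with (1 := proj2 (cos_taylor _ hb)).
    assert (hp2 : 986 / 100 <= PI ^ 2 <= 988 / 100) by nra.
    assert (v2 : 0 <= v ^ 2 <= 81 / 100) by nra.
    replace ((PI * v / 2) ^ 2) with (PI ^ 2 * v ^ 2 / 4) by field.
    replace ((PI * v / 2) ^ 4) with (PI ^ 2 * PI ^ 2 * v ^ 2 * v ^ 2 / 16) by field.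
    set (P := PI ^ 2) in *; set (V := v ^ 2) in *.
    assert (P / 8 - P * P * V / 384 >= 1) by nra; nra.
  - apply Rle_trans with (1 := cos_half_PI_le v ltac:(lra)); nra. }
intro hv; destruct (Rle_lt_dec 0 v) as [h|h]; [apply pos; lra|].
replace (PI * v / 2) with (- (PI * - v / 2)) by field; rewrite cos_neg.
replace (v ^ 2) with ((- v) ^ 2) by ring; apply pos; lra.
Qed.

(** Averaging the integral with its reflection [v -> - v] replaces the kernel by its even part,
    which is monotone and convex in [v ^ 2]. *)
Lemma potential_bump_sym (a : R) : 1 < a ->
  is_RInt (fun v => bump v * (a / (a ^ 2 - v ^ 2))) (-1) 1 (potential_bump a).
Proof.
intro ha.
assert (H := RInt_correct (V := R_CompleteNormedModule) _ (-1) 1 (ex_RInt_potential a (-1) 1 ha)).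
assert (H' := H); apply (is_RInt_swap (V := R_NormedModule)) in H'.
assert (K := is_RInt_comp_opp (V := R_NormedModule) (fun v => bump v / (a - v)) (-1) 1 (opp (potential_bump a))).
replace (- -1) with 1 in K by ring; replace (- (1)) with (-1) in K by ring.
specialize (K H').
assert (S := is_RInt_minus (V := R_NormedModule) _ _ _ _ _ _ H K).
apply (is_RInt_scal (V := R_NormedModule) _ _ _ (/ 2)) in S.
match type of S with is_RInt _ _ _ ?l => replace (potential_bump a) with l end.
2: { unfold scal, minus, plus, opp; simpl; unfold mult; simpl; unfold potential_bump; field. }
revert S; apply is_RInt_ext; intros v; rewrite Rmin_left, Rmax_right by lra; intro hv.
unfold scal, minus, plus, opp; simpl; unfold mult; simpl; rewrite bump_even.
field; repeat apply conj; try lra; nra.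
Qed.

Lemma potential_bump_lower (a : R) : 1 < a -> 32 / (15 * PI) / a <= potential_bump a.
Proof.
intro ha.
assert (B := is_RInt_scal (V := R_NormedModule) _ _ _ (/ a) _ is_RInt_bump).
assert (S := potential_bump_sym a ha).
match type of B with is_RInt _ _ _ ?l => match goal with |- ?r <= _ => replace r with l end end.
2: { unfold scal; simpl; unfold mult; simpl; unfold Rdiv; ring. }
rewrite <- (is_RInt_unique (V := R_CompleteNormedModule) _ _ _ _ B), <- (is_RInt_unique (V := R_CompleteNormedModule) _ _ _ _ S).
apply RInt_le; [lra|eexists; exact B|eexists; exact S|].
intros v hv; unfold scal; simpl; unfold mult; simpl; rewrite Rmult_comm.
apply Rmult_le_compat_l; [apply bump_pos|].
assert (0 < a ^ 2 - v ^ 2) by nra.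
apply (proj2 (Rminus_le_0 _ _)); replace (a / (a ^ 2 - v ^ 2) - / a) with (v ^ 2 / (a * (a ^ 2 - v ^ 2))) by (field; lra).
apply Rdiv_le_0_compat; [apply pow2_ge_0|apply Rmult_lt_0_compat; lra].
Qed.

(** The even kernel lies below its chord in [v ^ 2] on [[0, 1]], which is
    [(1 + v ^ 2 / (a ^ 2 - 1)) / a]. The second moment of the bump is bounded through
    [v ^ 2 <= 1 - cos (PI v / 2)], whence the moment [5/8] of the sixth power. *)
Lemma potential_bump_upper (a : R) : 1 < a ->
  potential_bump a <= (32 / (15 * PI) + (32 / (15 * PI) - 5 / 8) / (a ^ 2 - 1)) / a.
Proof.
intro ha; assert (ha2 : 0 < a ^ 2 - 1) by nra.
assert (B := is_RInt_scal (V := R_NormedModule) _ _ _ (/ a) _ (is_RInt_plus (V := R_NormedModule) _ _ _ _ _ _ is_RInt_bump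
  (is_RInt_scal (V := R_NormedModule) _ _ _ (/ (a ^ 2 - 1)) _
   (is_RInt_minus (V := R_NormedModule) _ _ _ _ _ _ is_RInt_bump is_RInt_cos6)))).
assert (S := potential_bump_sym a ha).
match type of B with is_RInt _ _ _ ?l => match goal with |- _ <= ?r => replace r with l end end.
2: { unfold scal, minus, plus, opp; simpl; unfold mult; simpl; unfold Rdiv; ring. }
rewrite <- (is_RInt_unique (V := R_CompleteNormedModule) _ _ _ _ B), <- (is_RInt_unique (V := R_CompleteNormedModule) _ _ _ _ S).
apply RInt_le; [lra|eexists; exact S|eexists; exact B|].
intros v hv; unfold scal, minus, plus, opp; simpl; unfold mult; simpl.
assert (b5 := bump_in v ltac:(lra)).
set (c := cos (PI * v / 2)) in *.
assert (hc : 0 <= c <= 1) by (apply cos_half_PI_bounds; lra).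
assert (hv2 : c <= 1 - v ^ 2) by (apply cos_half_PI_le_parabola; lra).
assert (hb := bump_pos v).
assert (hd : 0 < a ^ 2 - v ^ 2) by nra.
assert (e1 : a / (a ^ 2 - v ^ 2) <= / a * (1 + / (a ^ 2 - 1) * v ^ 2)).
{ apply (proj2 (Rminus_le_0 _ _)).
  replace (/ a * (1 + / (a ^ 2 - 1) * v ^ 2) - a / (a ^ 2 - v ^ 2))
    with (v ^ 2 * (1 - v ^ 2) / (a * (a ^ 2 - 1) * (a ^ 2 - v ^ 2))) by (field; lra).
  apply Rdiv_le_0_compat; [apply Rmult_le_pos; nra|repeat apply Rmult_lt_0_compat; lra]. }
apply Rle_trans with (bump v * (/ a * (1 + / (a ^ 2 - 1) * v ^ 2))); [apply Rmult_le_compat_l; assumption|].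
replace (bump v * (/ a * (1 + / (a ^ 2 - 1) * v ^ 2))) with (/ a * (bump v + / (a ^ 2 - 1) * (bump v * v ^ 2))) by ring.
assert (0 < / a) by (apply Rinv_0_lt_compat; lra).
assert (0 < / (a ^ 2 - 1)) by (apply Rinv_0_lt_compat; lra).
apply Rmult_le_compat_l; [lra|]; apply Rplus_le_compat_l.
assert (e2 : bump v * v ^ 2 <= bump v - c ^ 6).
{ replace (c ^ 6) with (bump v * c) by (rewrite b5; ring); nra. }
apply Rmult_le_compat_l; lra.
Qed.

(** For [a] near 1, where the chord bound blows up. Here one cosine factor absorbs the kernel:
    [(1 - v ^ 2) * a <= a ^ 2 - v ^ 2], and the fourth power has integral [3/4]. *)
Lemma potential_bump_le (a : R) : 1 < a -> potential_bump a <= 3 / 4.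
Proof.
intro ha.
assert (S := potential_bump_sym a ha); assert (B := is_RInt_cos4 (-1) 1).
match type of B with is_RInt _ _ _ ?l => replace l with (3 / 4) in B end.
2: { rewrite cos_half_PI_1, cos_half_PI_m1; generalize PI_RGT_0; intro; field; lra. }
rewrite <- (is_RInt_unique (V := R_CompleteNormedModule) _ _ _ _ B), <- (is_RInt_unique (V := R_CompleteNormedModule) _ _ _ _ S).
apply RInt_le; [lra|eexists; exact S|eexists; exact B|].
intros v hv; rewrite bump_in by lra.
assert (hc := cos_half_PI_bounds v ltac:(lra)).
assert (hp := cos_half_PI_le_parabola v ltac:(lra)).
set (c := cos (PI * v / 2)) in *.
assert (hd : 0 < a ^ 2 - v ^ 2) by nra.
replace (c ^ 5 * (a / (a ^ 2 - v ^ 2))) with (c ^ 4 * (c * a / (a ^ 2 - v ^ 2))) by (field; lra).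
rewrite <- (Rmult_1_r (c ^ 4)) at 2; apply Rmult_le_compat_l; [apply pow_le; lra|].
apply (proj2 (Rle_div_l _ _ _ hd)); nra.
Qed.

(** The second difference of [1 / x] is [2 d ^ 2 / (x (x ^ 2 - d ^ 2))], and [x = a - v <= 5] bounds
    that denominator by 125. The explicit margin [d ^ 2 / 125] gives the strict inequality, since
    comparing integrals only yields a weak one. *)
Lemma potential_bump_convex (a d : R) : 0 < d -> 1 + d < a -> a <= 4 ->
  2 * potential_bump a < potential_bump (a + d) + potential_bump (a - d).
Proof.
intros hd ha ha4.
assert (H0 := RInt_correct (V := R_CompleteNormedModule) _ (-1) 1 (ex_RInt_potential a (-1) 1 ltac:(lra))).
assert (H1 := RInt_correct (V := R_CompleteNormedModule) _ (-1) 1 (ex_RInt_potential (a + d) (-1) 1 ltac:(lra))).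
assert (H2 := RInt_correct (V := R_CompleteNormedModule) _ (-1) 1 (ex_RInt_potential (a - d) (-1) 1 ltac:(lra))).
assert (L := is_RInt_plus (V := R_NormedModule) _ _ _ _ _ _ (is_RInt_scal (V := R_NormedModule) _ _ _ 2 _ H0)
  (is_RInt_scal (V := R_NormedModule) _ _ _ (d ^ 2 / 125) _ is_RInt_bump)).
assert (U := is_RInt_plus (V := R_NormedModule) _ _ _ _ _ _ H1 H2).
apply Rlt_le_trans with (2 * potential_bump a + d ^ 2 / 125 * (32 / (15 * PI))).
{ assert (0 < d ^ 2 / 125 * (32 / (15 * PI))); [|lra].
  generalize PI_RGT_0; intro; apply Rmult_lt_0_compat; apply Rdiv_lt_0_compat; nra. }
match type of L with is_RInt _ _ _ ?l => change (l <= potential_bump (a + d) + potential_bump (a - d)) end.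
match type of U with is_RInt _ _ _ ?l => match type of L with is_RInt _ _ _ ?l' => change (l' <= l) end end.
rewrite <- (is_RInt_unique (V := R_CompleteNormedModule) _ _ _ _ L), <- (is_RInt_unique (V := R_CompleteNormedModule) _ _ _ _ U).
apply RInt_le; [lra|eexists; exact L|eexists; exact U|].
intros v hv; unfold scal, plus; simpl; unfold mult; simpl.
set (x := a - v); assert (hx : d < x <= 5) by (unfold x; lra).
replace (a + d - v) with (x + d) by (unfold x; ring); replace (a - d - v) with (x - d) by (unfold x; ring).
clearbody x.
replace (2 * (bump v / x) + d ^ 2 / 125 * bump v) with (bump v * (2 / x + d ^ 2 / 125)) by (field; lra).
replace (bump v / (x + d) + bump v / (x - d)) with (bump v * (2 / x + 2 * d ^ 2 / (x * (x ^ 2 - d ^ 2))))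
  by (field; repeat apply conj; try lra; nra).
apply Rmult_le_compat_l; [apply bump_pos|]; apply Rplus_le_compat_l.
assert (hD : 0 < x * (x ^ 2 - d ^ 2)) by (apply Rmult_lt_0_compat; nra).
apply (proj1 (Rle_div_r _ _ _ hD)).
assert (x * (x ^ 2 - d ^ 2) <= 125).
{ apply Rle_trans with (x ^ 3); [nra|]. replace 125 with (5 ^ 3) by ring; apply pow_incr; lra. }
nra.
Qed.

(** * Principal values with the pole inside the bump *)

Lemma Rdiv_le_of_mult (a b c : R) : 0 < c -> a <= b * c -> a / c <= b.
Proof. intros hc; apply (proj2 (Rle_div_l _ _ _ hc)). Qed.

Lemma bump_antitone (u v : R) : Rabs u <= Rabs v -> bump v <= bump u.
Proof.
assert (abs : forall w, bump w = bump (Rabs w)).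
{ intro w; unfold Rabs; destruct Rcase_abs; [rewrite bump_even|]; reflexivity. }
rewrite (abs u), (abs v); generalize (Rabs_pos u) (Rabs_pos v).
generalize (Rabs u) (Rabs v); clear u v; intros u v hu hv huv.
destruct (Rle_lt_dec 1 v) as [h|h]; [rewrite (bump_out v); [apply bump_pos|rewrite Rabs_right; lra]|].
rewrite !bump_in by lra; apply pow_incr; split; [apply cos_half_PI_bounds; lra|].
generalize PI_RGT_0; intro; apply cos_decr_1; nra.
Qed.

Lemma bump_near_1 (v : R) : 82 / 100 <= v -> bump v <= 2 / 1000.
Proof.
intro hv; apply Rle_trans with (bump (82 / 100)).
{ apply bump_antitone; rewrite !Rabs_right; lra. }
rewrite bump_in by lra.
assert (h := cos_half_PI_le (82 / 100) ltac:(lra)).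
assert (h0 := cos_half_PI_bounds (82 / 100) ltac:(lra)).
destruct PI_bounds as [p1 p2].
apply Rle_trans with ((283 / 1000) ^ 5); [apply pow_incr; lra|lra].
Qed.

Lemma Rle_div_of_mult (a b c : R) : 0 < c -> a * c <= b -> a <= b / c.
Proof. intros hc; apply (proj1 (Rle_div_r _ _ _ hc)). Qed.

(** [5 X ^ 4 + 10 X ^ 2 Y ^ 2 + Y ^ 4] for [X] the product of the cosines and [Y] that of the sines,
    grouped by the variables [a] and [t]. *)
Definition bump_difference_factor (a t : R) : R :=
  5 * cos (PI * a / 2) ^ 4 * cos (PI * t / 2) ^ 4
  + 10 * (cos (PI * a / 2) * sin (PI * a / 2)) ^ 2 * (cos (PI * t / 2) * sin (PI * t / 2)) ^ 2
  + sin (PI * a / 2) ^ 4 * sin (PI * t / 2) ^ 4.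

(* (X + Y)^5 - (X - Y)^5 with X = cos cos and Y = sin sin. *)
Lemma bump_difference (a t : R) : 0 <= a -> 0 <= t -> a + t <= 1 ->
  bump (a - t) - bump (a + t) =
  2 * sin (PI * a / 2) * sin (PI * t / 2) * bump_difference_factor a t.
Proof.
intros ha ht hat; rewrite !bump_in by lra; unfold bump_difference_factor.
replace (PI * (a - t) / 2) with (PI * a / 2 - PI * t / 2) by field.
replace (PI * (a + t) / 2) with (PI * a / 2 + PI * t / 2) by field.
rewrite cos_minus, cos_plus; ring.
Qed.

Lemma bump_difference_factor_pos (a t : R) : 0 <= bump_difference_factor a t.
Proof.
unfold bump_difference_factor.
replace (cos (PI * a / 2) ^ 4) with ((cos (PI * a / 2) ^ 2) ^ 2) by ring.
replace (cos (PI * t / 2) ^ 4) with ((cos (PI * t / 2) ^ 2) ^ 2) by ring.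
replace (sin (PI * a / 2) ^ 4) with ((sin (PI * a / 2) ^ 2) ^ 2) by ring.
replace (sin (PI * t / 2) ^ 4) with ((sin (PI * t / 2) ^ 2) ^ 2) by ring.
repeat first [apply pow2_ge_0 | apply Rplus_le_le_0_compat | apply Rmult_le_pos | lra].
Qed.

Lemma sin_half_PI_bounds (t : R) : 0 <= t <= 1 -> 0 <= sin (PI * t / 2) <= PI * t / 2.
Proof.
intro ht; generalize PI_RGT_0; intro hpi; split; [apply sin_ge_0; nra|].
destruct (Req_dec t 0) as [->|n].
- replace (PI * 0 / 2) with 0 by field; rewrite sin_0; lra.
- apply Rlt_le, sin_lt_x; nra.
Qed.

Lemma sin_cubic_lower (x : R) : 0 <= x <= 4 -> x * (1 - x ^ 2 / 6) <= sin x.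
Proof.
intro hx; destruct (pre_sin_bound x 0 (proj1 hx) (proj2 hx)) as [h _].
apply Rle_trans with (2 := h); unfold sin_approx, sin_term; simpl; unfold pow; lra.
Qed.

Lemma hilbert_integrand_pos (a t : R) : 0 <= a -> 0 < t ->
  0 <= (bump (a - t) - bump (a + t)) / t.
Proof.
intros ha ht; apply Rdiv_le_0_compat; [|exact ht].
assert (bump (a + t) <= bump (a - t)); [|lra].
apply bump_antitone; rewrite (Rabs_right (a + t)) by lra; apply Rabs_le; lra.
Qed.

Lemma hilbert_integrand_le (a t : R) : 0 <= a -> 0 < t -> a + t <= 1 ->
  (bump (a - t) - bump (a + t)) / t <= PI ^ 2 * a / 2 * bump_difference_factor a t.
Proof.
intros ha ht hat; rewrite bump_difference by lra.
apply (proj2 (Rle_div_l _ _ _ ht)).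
assert (h1 := sin_half_PI_bounds a ltac:(lra)); assert (h2 := sin_half_PI_bounds t ltac:(lra)).
replace (PI ^ 2 * a / 2 * bump_difference_factor a t * t) with
  (2 * (PI * a / 2) * (PI * t / 2) * bump_difference_factor a t) by field.
apply Rmult_le_compat_r; [apply bump_difference_factor_pos|].
apply Rmult_le_compat; lra.
Qed.

Lemma hilbert_integrand_ge (a t : R) : 0 <= a -> 0 < t -> a + t <= 1 ->
  PI ^ 2 * a / 2 * (1 - (PI * a / 2) ^ 2 / 6) * (1 - (PI * t / 2) ^ 2 / 6) * bump_difference_factor a t
  <= (bump (a - t) - bump (a + t)) / t.
Proof.
intros ha ht hat; rewrite bump_difference by lra.
apply (proj1 (Rle_div_r _ _ _ ht)).
destruct PI_bounds as [p1 p2].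
assert (ra : 0 <= PI * a / 2 <= 16 / 10) by nra.
assert (rt : 0 <= PI * t / 2 <= 16 / 10) by nra.
assert (h1 := sin_cubic_lower (PI * a / 2) ltac:(lra)).
assert (h2 := sin_cubic_lower (PI * t / 2) ltac:(lra)).
replace (PI ^ 2 * a / 2 * (1 - (PI * a / 2) ^ 2 / 6) * (1 - (PI * t / 2) ^ 2 / 6) * bump_difference_factor a t * t)
  with (2 * ((PI * a / 2) * (1 - (PI * a / 2) ^ 2 / 6)) * ((PI * t / 2) * (1 - (PI * t / 2) ^ 2 / 6)) * bump_difference_factor a t) by field.
set (A := PI * a / 2) in *; set (B := PI * t / 2) in *.
apply Rmult_le_compat_r; [apply bump_difference_factor_pos|].
assert (0 <= A * (1 - A ^ 2 / 6)) by (apply Rmult_le_pos; nra).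
assert (0 <= B * (1 - B ^ 2 / 6)) by (apply Rmult_le_pos; nra).
apply Rmult_le_compat; lra.
Qed.

Lemma hilbert_bump_split (a b c : R) : 0 <= a -> 0 <= b <= c -> c <= 5 -> a + 1 <= c ->
  hilbert_bump a = RInt (fun t => (bump (a - t) - bump (a + t)) / t) 0 b
    + RInt (fun t => (bump (a - t) - bump (a + t)) / t) b c.
Proof.
intros ha hb hc hac; unfold hilbert_bump; symmetry.
assert (z : RInt (fun t => (bump (a - t) - bump (a + t)) / t) c 5 = 0).
{ apply (is_RInt_unique (V := R_CompleteNormedModule)), (is_RInt_zero (V := R_NormedModule)).
  intros t; rewrite Rmin_left, Rmax_right by lra; intro ht.
  rewrite !bump_out; [unfold Rdiv, zero; simpl; ring|rewrite Rabs_right; lra|rewrite Rabs_left; lra]. }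
rewrite <- (Rplus_0_r (_ + _)), <- z, Rplus_assoc.
assert (Ch : forall f u v w, ex_RInt f u v -> ex_RInt f v w -> RInt f u v + RInt f v w = RInt f u w)
  by (intros; apply (RInt_Chasles (V := R_CompleteNormedModule)); assumption).
rewrite !Ch; try reflexivity; apply ex_RInt_hilbert; lra.
Qed.

Lemma hilbert_bump_pos (a : R) : 0 <= a -> 0 <= hilbert_bump a.
Proof.
intro ha; apply RInt_ge_0; [lra|apply ex_RInt_hilbert; lra|].
intros t ht; apply hilbert_integrand_pos; lra.
Qed.

Lemma hilbert_bump_9_100_upper : hilbert_bump (9 / 100) <= 84 / 100.
Proof.
destruct PI_bounds as [p1 p2].
rewrite (hilbert_bump_split _ 1 (109 / 100)) by lra.
(* The bump is at most [2/1000] there; [22/10000] also covers the division by [t >= 91/100]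
   below. *)
assert (t1 : RInt (fun t => (bump (9 / 100 - t) - bump (9 / 100 + t)) / t) 1 (109 / 100) <= 22 / 10000).
{ apply Rle_trans with (RInt (fun _ => 22 / 10000) 1 (109 / 100)).
  - apply RInt_le; [lra|apply ex_RInt_hilbert; lra|apply ex_RInt_const|].
    intros t ht; apply Rdiv_le_of_mult; [lra|].
    replace (9 / 100 - t) with (- (t - 9 / 100)) by ring; rewrite bump_even.
    assert (h1 := bump_near_1 (t - 9 / 100) ltac:(lra)); assert (h2 := bump_pos (9 / 100 + t)); lra.
  - rewrite RInt_const; unfold scal; simpl; unfold mult; simpl; lra. }
set (c := cos (PI * (9 / 100) / 2)); set (s := sin (PI * (9 / 100) / 2)).
assert (hs : s ^ 2 = 1 - c ^ 2) by apply sin_sqr_half.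
(* On [91/100, 1] the difference formula fails, but the integrand is tiny. *)
set (G := fun t => PI ^ 2 * (9 / 100) / 2 * bump_difference_factor (9 / 100) t + 22 / 10000).
(* The integrals over [[0, 1]] of [cos ^ 4], [cos ^ 2 sin ^ 2] and [sin ^ 4] are [3/8], [1/8] and
   [3/8]. *)
assert (hG : is_RInt G 0 1 (PI ^ 2 * (9 / 100) / 2 * (5 * c ^ 4 * (3 / 8) + 10 * (c * s) ^ 2 * (1 / 8) + s ^ 4 * (3 / 8)) + 22 / 10000)).
{ set (F := fun t => PI ^ 2 * (9 / 100) / 2 *
    (5 * c ^ 4 * (3 * t / 8 + 2 / PI * (cos (PI * t / 2) ^ 3 * sin (PI * t / 2) / 4 + 3 * cos (PI * t / 2) * sin (PI * t / 2) / 8))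
     + 10 * (c * s) ^ 2 * (t / 8 + 2 / PI * (- cos (PI * t / 2) ^ 3 * sin (PI * t / 2) / 4 + cos (PI * t / 2) * sin (PI * t / 2) / 8))
     + s ^ 4 * (3 * t / 8 - 2 / PI * (sin (PI * t / 2) ^ 3 * cos (PI * t / 2) / 4 + 3 * cos (PI * t / 2) * sin (PI * t / 2) / 8)))
    + 22 / 10000 * t).
  replace (_ + 22 / 10000) with (F 1 - F 0).
  - apply is_RInt_antiderivative.
    + intro t; unfold F, G, bump_difference_factor; fold c s; auto_derive; [exact I|].
      change (PI * t * / 2) with (PI * t / 2).
      assert (h := sin_sqr_half t); set (C := cos (PI * t / 2)) in *; set (S := sin (PI * t / 2)) in *.
      assert (h4 : S ^ 4 = (1 - C ^ 2) ^ 2) by (rewrite <- h; ring).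
      transitivity (PI ^ 2 * (9 / 100) / 2 *
        (5 * c ^ 4 * (3 / 8 + (C ^ 4 - 3 * C ^ 2 * S ^ 2) / 4 + 3 * (C ^ 2 - S ^ 2) / 8)
         + 10 * (c * s) ^ 2 * (1 / 8 + (- C ^ 4 + 3 * C ^ 2 * S ^ 2) / 4 + (C ^ 2 - S ^ 2) / 8)
         + s ^ 4 * (3 / 8 - (3 * S ^ 2 * C ^ 2 - S ^ 4) / 4 - 3 * (C ^ 2 - S ^ 2) / 8)) + 22 / 10000);
        [field; lra|].
      replace ((C * S) ^ 2) with (C ^ 2 * S ^ 2) by ring; rewrite h4, h; field.
    + intro t; apply continuous_of_ex_derive; unfold G, bump_difference_factor; auto_derive; exact I.
  - unfold F; rewrite cos_half_PI_1; replace (PI * 0 / 2) with 0 by field; rewrite sin_0; field; lra. }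
assert (t0 : RInt (fun t => (bump (9 / 100 - t) - bump (9 / 100 + t)) / t) 0 1 <= RInt G 0 1).
{ apply RInt_le; [lra|apply ex_RInt_hilbert; lra|eexists; exact hG|].
  intros t ht; unfold G; destruct (Rle_lt_dec t (91 / 100)) as [h|h].
  - generalize (hilbert_integrand_le (9 / 100) t ltac:(lra) ltac:(lra) ltac:(lra)); lra.
  - assert (0 <= PI ^ 2 * (9 / 100) / 2 * bump_difference_factor (9 / 100) t).
    { apply Rmult_le_pos; [nra|apply bump_difference_factor_pos]. }
    apply Rle_trans with (22 / 10000); [|lra].
    apply Rdiv_le_of_mult; [lra|].
    replace (9 / 100 - t) with (- (t - 9 / 100)) by ring; rewrite bump_even.
    assert (h1 := bump_near_1 (t - 9 / 100) ltac:(lra)); assert (h2 := bump_pos (9 / 100 + t)); lra. }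
rewrite (is_RInt_unique (V := R_CompleteNormedModule) _ _ _ _ hG) in t0.
(* All three coefficients are dominated by those of [15/8 * (c ^ 2 + s ^ 2) ^ 2 = 15/8]. *)
assert (q : 5 * c ^ 4 * (3 / 8) + 10 * (c * s) ^ 2 * (1 / 8) + s ^ 4 * (3 / 8) <= 15 / 8).
{ replace (5 * c ^ 4 * (3 / 8) + 10 * (c * s) ^ 2 * (1 / 8) + s ^ 4 * (3 / 8))
    with (15 / 8 * (c ^ 2) ^ 2 + 10 / 8 * (c ^ 2 * s ^ 2) + 3 / 8 * (s ^ 2) ^ 2) by field.
  assert (0 <= c ^ 2) by apply pow2_ge_0; assert (0 <= s ^ 2) by apply pow2_ge_0.
  set (X := c ^ 2) in *; set (Y := s ^ 2) in *; nra. }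
assert (PI ^ 2 <= 987 / 100) by nra.
assert (PI ^ 2 * (9 / 100) / 2 * (5 * c ^ 4 * (3 / 8) + 10 * (c * s) ^ 2 * (1 / 8) + s ^ 4 * (3 / 8)) <= PI ^ 2 * (9 / 100) / 2 * (15 / 8))
  by (apply Rmult_le_compat_l; [nra|exact q]).
lra.
Qed.

Lemma hilbert_bump_9_100_lower : 50 / 100 <= hilbert_bump (9 / 100).
Proof.
destruct PI_bounds as [p1 p2].
rewrite (hilbert_bump_split _ 1 (109 / 100)) by lra.
assert (t1 : 0 <= RInt (fun t => (bump (9 / 100 - t) - bump (9 / 100 + t)) / t) 1 (109 / 100)).
{ apply RInt_ge_0; [lra|apply ex_RInt_hilbert; lra|].
  intros t ht; apply hilbert_integrand_pos; lra. }
(* The factors [9966/10000] and [659/1000] are the losses of the cubic sine bound at [9/100] and on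
   [t <= 91/100]; [46/10] is below [5 * (98/100) ^ 2], from the first term of the difference
   factor. *)
set (k := PI ^ 2 * (9 / 100) / 2 * (9966 / 10000) * (659 / 1000) * 46 / 10).
assert (C4 := is_RInt_cos4 0 1).
match type of C4 with is_RInt _ _ _ ?l => replace l with (3 / 8) in C4 end.
2: { rewrite cos_half_PI_1; replace (PI * 0 / 2) with 0 by field; rewrite sin_0; field; lra. }
assert (hG := is_RInt_scal (V := R_NormedModule) _ _ _ k _ (is_RInt_minus (V := R_NormedModule) _ _ _ _ _ _ C4
  (is_RInt_const (V := R_NormedModule) 0 1 (4 / 10000)))).
assert (hP : 986 / 100 <= PI ^ 2 <= 988 / 100) by nra.
assert (hk : 134 / 100 <= k) by (unfold k; lra).
assert (t0 : k * (3 / 8 - 4 / 10000) <= RInt (fun t => (bump (9 / 100 - t) - bump (9 / 100 + t)) / t) 0 1); [|lra].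
match type of hG with is_RInt _ _ _ ?l => replace (k * (3 / 8 - 4 / 10000)) with l end.
2: { unfold scal, minus, plus, opp; simpl; unfold mult; simpl; field. }
rewrite <- (is_RInt_unique (V := R_CompleteNormedModule) _ _ _ _ hG).
apply RInt_le; [lra|eexists; exact hG|apply ex_RInt_hilbert; lra|].
intros t ht; unfold scal, minus, plus, opp; simpl; unfold mult; simpl.
assert (hc := cos_half_PI_bounds t ltac:(lra)).
destruct (Rle_lt_dec t (91 / 100)) as [h|h].
- apply Rle_trans with (2 := hilbert_integrand_ge (9 / 100) t ltac:(lra) ltac:(lra) ltac:(lra)).
  assert (hA : 9966 / 10000 <= 1 - (PI * (9 / 100) / 2) ^ 2 / 6) by nra.
  assert (hB : 659 / 1000 <= 1 - (PI * t / 2) ^ 2 / 6).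
  { assert (0 <= PI * t / 2 <= 142943 / 100000) by nra; nra. }
  assert (hA2 : 98 / 100 <= cos (PI * (9 / 100) / 2) ^ 2).
  { rewrite <- (Rplus_0_r (_ ^ 2)); replace 0 with (1 - 1) by ring.
    assert (e := sin_sqr_half (9 / 100)).
    assert (b := sin_half_PI_bounds (9 / 100) ltac:(lra)).
    assert (sin (PI * (9 / 100) / 2) ^ 2 <= 2 / 100) by nra; lra. }
  assert (hS : 46 / 10 * cos (PI * t / 2) ^ 4 <= bump_difference_factor (9 / 100) t).
  { unfold bump_difference_factor.
    assert (0 <= cos (PI * t / 2) ^ 4) by (apply pow_le; lra).
    assert (98 / 100 * (98 / 100) <= cos (PI * (9 / 100) / 2) ^ 4).
    { replace (cos (PI * (9 / 100) / 2) ^ 4) with (cos (PI * (9 / 100) / 2) ^ 2 * cos (PI * (9 / 100) / 2) ^ 2) by ring.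
      apply Rmult_le_compat; lra. }
    assert (0 <= 10 * (cos (PI * (9 / 100) / 2) * sin (PI * (9 / 100) / 2)) ^ 2 * (cos (PI * t / 2) * sin (PI * t / 2)) ^ 2).
    { repeat first [apply pow2_ge_0 | apply Rmult_le_pos | lra]. }
    assert (0 <= sin (PI * (9 / 100) / 2) ^ 4 * sin (PI * t / 2) ^ 4).
    { apply Rmult_le_pos; apply pow_le; apply sin_half_PI_bounds; lra. }
    nra. }
  assert (h4 : 0 <= cos (PI * t / 2) ^ 4) by (apply pow_le; lra).
  apply Rle_trans with (k * cos (PI * t / 2) ^ 4); [apply Rmult_le_compat_l; lra|].
  unfold k.
  replace (PI ^ 2 * (9 / 100) / 2 * (9966 / 10000) * (659 / 1000) * 46 / 10 * cos (PI * t / 2) ^ 4)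
    with (PI ^ 2 * (9 / 100) / 2 * (9966 / 10000) * (659 / 1000) * (46 / 10 * cos (PI * t / 2) ^ 4)) by field.
  assert (hK : 0 <= PI ^ 2 * (9 / 100) / 2) by lra.
  set (K := PI ^ 2 * (9 / 100) / 2) in *.
  apply Rmult_le_compat; [apply Rmult_le_pos; lra|lra| |exact hS].
  apply Rmult_le_compat; [lra|lra| |exact hB].
  apply Rmult_le_compat_l; assumption.
- apply Rle_trans with 0; [|apply hilbert_integrand_pos; lra].
  assert (hl := cos_half_PI_le t ltac:(lra)).
  assert (cos (PI * t / 2) <= 1414 / 10000) by nra.
  assert (cos (PI * t / 2) ^ 4 <= (1414 / 10000) ^ 4) by (apply pow_incr; lra).
  nra.
Qed.

Lemma hilbert_bump_91_100_upper : hilbert_bump (91 / 100) <= 151 / 100.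
Proof.
destruct PI_bounds as [p1 p2].
rewrite (hilbert_bump_split _ (9 / 100) (191 / 100)) by lra.
(* Near the pole the integrand is small because both [cos (PI * (91/100) / 2)] and [sin (PI t / 2)]
   are at most [1414/10000]. *)
assert (t0 : RInt (fun t => (bump (91 / 100 - t) - bump (91 / 100 + t)) / t) 0 (9 / 100) <= 3 / 1000).
{ apply Rle_trans with (RInt (fun _ => 3 / 100) 0 (9 / 100)).
  2: { rewrite RInt_const; unfold scal; simpl; unfold mult; simpl; lra. }
  apply RInt_le; [lra|apply ex_RInt_hilbert; lra|apply ex_RInt_const|].
  intros t ht.
  apply Rle_trans with (1 := hilbert_integrand_le (91 / 100) t ltac:(lra) ltac:(lra) ltac:(lra)).
  assert (b1 := cos_half_PI_bounds (91 / 100) ltac:(lra)).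
  assert (b2 := cos_half_PI_le (91 / 100) ltac:(lra)).
  assert (b3 := sin_half_PI_bounds t ltac:(lra)).
  assert (b4 := cos_half_PI_bounds t ltac:(lra)).
  assert (b6 := SIN_bound (PI * (91 / 100) / 2)).
  assert (b7 := sin_half_PI_bounds (91 / 100) ltac:(lra)).
  assert (hP : PI ^ 2 <= 988 / 100) by nra.
  assert (b8 : bump_difference_factor (91 / 100) t <= 16 * (2 / 100) ^ 2).
  { unfold bump_difference_factor.
    set (X := cos (PI * (91 / 100) / 2)) in *; set (Y := sin (PI * (91 / 100) / 2)) in *.
    set (C := cos (PI * t / 2)) in *; set (S := sin (PI * t / 2)) in *.
    assert (X <= 1414 / 10000) by lra; assert (S <= 1414 / 10000) by nra.
    assert (sq : forall x m, 0 <= x <= m -> 0 <= x ^ 2 <= m ^ 2).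
    { intros x m hx; split; [apply pow2_ge_0|apply pow_incr; exact hx]. }
    assert (hX := sq X (1414 / 10000) ltac:(lra)).
    assert (hS := sq S (1414 / 10000) ltac:(lra)).
    assert (hY := sq Y 1 ltac:(lra)); assert (hC := sq C 1 ltac:(lra)); clear sq.
    replace (5 * X ^ 4 * C ^ 4 + 10 * (X * Y) ^ 2 * (C * S) ^ 2 + Y ^ 4 * S ^ 4)
      with (5 * (X ^ 2 * C ^ 2) ^ 2 + 10 * ((X ^ 2 * C ^ 2) * (Y ^ 2 * S ^ 2)) + (Y ^ 2 * S ^ 2) ^ 2) by ring.
    assert (hU : 0 <= X ^ 2 * C ^ 2 <= 2 / 100) by (split; [apply Rmult_le_pos; lra|nra]).
    assert (hV : 0 <= Y ^ 2 * S ^ 2 <= 2 / 100) by (split; [apply Rmult_le_pos; lra|nra]).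
    set (U := X ^ 2 * C ^ 2) in *; set (V := Y ^ 2 * S ^ 2) in *.
    clearbody U V; assert (U ^ 2 <= (2 / 100) ^ 2) by (apply pow_incr; lra).
    assert (V ^ 2 <= (2 / 100) ^ 2) by (apply pow_incr; lra).
    assert (U * V <= 2 / 100 * (2 / 100)) by (apply Rmult_le_compat; lra).
    nra. }
  assert (b9 := bump_difference_factor_pos (91 / 100) t); nra. }
(* Away from the pole [bump (a + t)] vanishes. With [v = 91/100 - t], one cosine is at most
   [(1 + v) (1 - v)], and [1 - v <= 2 t] cancels the denominator, leaving [G]. *)
set (F := fun t => let v := 91 / 100 - t in
  - 2 * (3 * v / 8 + (sin (PI * v) / PI) / 2 + sin (2 * (PI * v)) / (2 * PI) / 8
   + 3 * v ^ 2 / 16 + (v * sin (PI * v) / PI + cos (PI * v) / PI ^ 2) / 2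
   + (v * sin (2 * (PI * v)) / (2 * PI) + cos (2 * (PI * v)) / (4 * PI ^ 2)) / 8)).
set (G := fun t => 2 * ((1 + (91 / 100 - t)) * ((1 + cos (PI * (91 / 100 - t))) / 2) ^ 2)).
assert (hG : forall a b, is_RInt G a b (F b - F a)).
{ intros a b; apply is_RInt_antiderivative.
  - intro t; unfold F, G; auto_derive; [exact I|].
    change (91 / 100 + - t) with (91 / 100 - t); set (v := 91 / 100 - t).
    rewrite cos_2a_cos; field; lra.
  - intro t; apply continuous_of_ex_derive; unfold G; auto_derive; exact I. }
assert (G_eq : forall t, G t = 2 * ((1 + (91 / 100 - t)) * cos (PI * (91 / 100 - t) / 2) ^ 4)).
{ intro t; unfold G; rewrite <- cos_half_sqr; ring. }
assert (t1 : RInt (fun t => (bump (91 / 100 - t) - bump (91 / 100 + t)) / t) (9 / 100) (191 / 100)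
  <= RInt G (9 / 100) (191 / 100)).
{ apply RInt_le; [lra|apply ex_RInt_hilbert; lra|eexists; apply hG|].
  intros t ht; rewrite G_eq, (bump_out (91 / 100 + t)) by (rewrite Rabs_right; lra).
  rewrite bump_in by lra; set (v := 91 / 100 - t).
  assert (hv : -1 <= v <= 1) by (unfold v; lra).
  assert (b1 := cos_half_PI_bounds v hv); assert (b2 := cos_half_PI_le_parabola v hv).
  assert (htv : 1 - v <= 2 * t) by (unfold v; lra); clearbody v.
  set (c := cos (PI * v / 2)) in *.
  apply Rdiv_le_of_mult; [lra|].
  replace (c ^ 5 - 0) with (c ^ 4 * c) by ring.
  replace (2 * ((1 + v) * c ^ 4) * t) with (c ^ 4 * ((1 + v) * (2 * t))) by ring.
  apply Rmult_le_compat_l; [apply pow_le; lra|].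
  apply Rle_trans with ((1 + v) * (1 - v)); [lra|apply Rmult_le_compat_l; lra]. }
(* Extending the range to [t = - 9/100] makes [v] run over [[-1, 1]], where the odd part drops out
   and the integral is [2 * (3/4)]. *)
assert (t2 : 0 <= RInt G (- (9 / 100)) (9 / 100)).
{ apply RInt_ge_0; [lra|eexists; apply hG|].
  intros t ht; rewrite G_eq; apply Rmult_le_pos; [lra|apply Rmult_le_pos; [lra|]].
  apply pow_le, cos_half_PI_bounds; lra. }
assert (t3 : RInt G (- (9 / 100)) (9 / 100) + RInt G (9 / 100) (191 / 100) = 3 / 2).
{ rewrite !(is_RInt_unique (V := R_CompleteNormedModule) _ _ _ _ (hG _ _)).
  transitivity (F (191 / 100) - F (- (9 / 100))); [ring|unfold F].
  replace (91 / 100 - 191 / 100) with (-1) by field.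
  replace (91 / 100 - - (9 / 100)) with 1 by field.
  replace (PI * -1) with (- PI) by ring; replace (2 * - PI) with (- (2 * PI)) by ring.
  rewrite !Rmult_1_r, !sin_neg, !cos_neg, sin_PI, sin_2PI, cos_PI, cos_2PI; field; lra. }
lra.
Qed.

(** The two bounds with denominators cleared, so that the hypotheses are rational inequalities at a
    numeral [a]. The numerals enclose [32 / (15 PI)], and [541/10000] is [6791/10000 - 5/8]. *)
Lemma potential_bump_between (a lo hi : R) : 1 < a -> lo * a <= 67905 / 100000 ->
  6791 / 10000 * (a ^ 2 - 1) + 541 / 10000 <= hi * a * (a ^ 2 - 1) ->
  lo <= potential_bump a <= hi.
Proof.
intros ha hlo hhi; destruct PI_bounds as [p1 p2].
assert (m1 : 67905 / 100000 <= 32 / (15 * PI)) by (apply Rle_div_of_mult; lra).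
assert (m2 : 32 / (15 * PI) <= 6791 / 10000) by (apply Rdiv_le_of_mult; lra).
assert (ha2 : 0 < a ^ 2 - 1) by nra.
split.
- apply Rle_trans with (2 := potential_bump_lower a ha).
  apply Rle_div_of_mult; lra.
- apply Rle_trans with (1 := potential_bump_upper a ha).
  apply Rdiv_le_of_mult; [lra|].
  apply Rle_trans with (6791 / 10000 + 541 / 10000 / (a ^ 2 - 1)).
  + apply Rplus_le_compat; [lra|]; apply Rmult_le_compat_r; [apply Rlt_le, Rinv_0_lt_compat|]; lra.
  + apply (Rmult_le_reg_r (a ^ 2 - 1)); [lra|].
    replace ((6791 / 10000 + 541 / 10000 / (a ^ 2 - 1)) * (a ^ 2 - 1))
      with (6791 / 10000 * (a ^ 2 - 1) + 541 / 10000) by (field; lra); exact hhi.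
Qed.

Lemma bump_9_100_bounds : 950 / 1000 <= bump (9 / 100) <= 952 / 1000.
Proof.
destruct PI_bounds as [p1 p2]; rewrite bump_in by lra.
set (x := PI * (9 / 100) / 2); assert (hx : 14136 / 100000 <= x <= 14138 / 100000) by (unfold x; lra).
destruct (cos_taylor x ltac:(lra)) as [h1 h2].
assert (x2 : 1998 / 100000 <= x ^ 2 <= 1999 / 100000) by (unfold pow; nra).
assert (b1 : 990 / 1000 <= cos x) by lra.
assert (b2 : cos x <= 9901 / 10000).
{ replace (x ^ 4) with (x ^ 2 * x ^ 2) in h2 by ring.
  assert (x ^ 2 * x ^ 2 <= 4 / 10000) by nra; lra. }
split.
- apply Rle_trans with ((990 / 1000) ^ 5); [lra|apply pow_incr; lra].
- apply Rle_trans with ((9901 / 10000) ^ 5); [apply pow_incr; lra|lra].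
Qed.

Lemma bump_9_100_sqr_bounds : 902 / 1000 <= bump (9 / 100) ^ 2 <= 907 / 1000.
Proof. destruct bump_9_100_bounds; nra. Qed.

Lemma PI_sqr_bounds : 986 / 100 <= PI ^ 2 <= 987 / 100.
Proof. destruct PI_bounds; nra. Qed.

(** * The response at the sampled delays *)

(** [response_H] is the response [H], and [response] the square root in [gbar], both times
    [252 PI ^ 3]; in this unit [P] becomes [63 PI l]. *)
Definition response_H (sigma : R) : R :=
  potential_bump (sigma + 11 / 10) + potential_bump (sigma + 31 / 10)
  - hilbert_bump (sigma - 31 / 10) - hilbert_bump (sigma - 11 / 10).

Definition response (sigma : R) : R :=
  sqrt (response_H sigma ^ 2 + (PI * corr1 (sigma - 21 / 10)) ^ 2).

Lemma gbar_response (T sigma l : R) : 0 < T -> - (9 / 100) <= sigma <= 5 ->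
  resp_P (cos2_pulse T) (3 * PI / (2 * T)) = l / (4 * PI ^ 2) ->
  gbar (cos2_pulse T) T (3 * PI / (2 * T)) (21 / 10 * T) (sigma * T) =
  (response sigma - 63 * PI * l) / (252 * PI ^ 3).
Proof.
intros hT hs hP; unfold gbar.
rewrite resp_H_formula, resp_Q_formula, hP by lra.
generalize PI_RGT_0; intro hpi.
assert (hN : 0 < 252 * PI ^ 3) by (apply Rmult_lt_0_compat; [lra|apply pow_lt; lra]).
fold (response_H sigma); unfold response.
set (h := response_H sigma); set (q := PI * corr1 (sigma - 21 / 10)); set (N := 252 * PI ^ 3) in *.
replace ((h / N) ^ 2 + (- q / N) ^ 2) with ((h ^ 2 + q ^ 2) * (/ N) ^ 2) by (field; lra).
rewrite sqrt_mult, sqrt_pow2; [|apply Rlt_le, Rinv_0_lt_compat; lra| |apply pow2_ge_0].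
2: { apply Rplus_le_le_0_compat; apply pow2_ge_0. }
replace (l / (4 * PI ^ 2)) with (63 * PI * l / N) by (unfold N; field; lra).
field; lra.
Qed.

Lemma hilbert_bump_neg (a : R) : 1 < a <= 4 -> hilbert_bump (- a) = - potential_bump a.
Proof. intro ha; rewrite hilbert_bump_odd, hilbert_potential by exact ha; reflexivity. Qed.

Lemma response_lt (sigma p : R) : 0 < p ->
  response_H sigma ^ 2 + (PI * corr1 (sigma - 21 / 10)) ^ 2 < p ^ 2 -> response sigma < p.
Proof.
intros hp h; rewrite <- (sqrt_pow2 p) by lra; apply sqrt_lt_1; [|apply pow2_ge_0|exact h].
apply Rplus_le_le_0_compat; apply pow2_ge_0.
Qed.

Lemma response_lt_response (s t : R) :
  response_H s ^ 2 + (PI * corr1 (s - 21 / 10)) ^ 2 < response_H t ^ 2 + (PI * corr1 (t - 21 / 10)) ^ 2 ->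
  response s < response t.
Proof.
intro h; apply sqrt_lt_1; [| |exact h]; apply Rplus_le_le_0_compat; apply pow2_ge_0.
Qed.

Lemma response_ge (s : R) : PI * corr1 (s - 21 / 10) <= response s.
Proof.
unfold response; set (q := PI * corr1 (s - 21 / 10)).
apply Rle_trans with (1 := Rle_abs q); rewrite <- sqrt_Rsqr_abs; apply sqrt_le_1.
- apply Rle_0_sqr.
- apply Rplus_le_le_0_compat; apply pow2_ge_0.
- unfold Rsqr; assert (0 <= response_H s ^ 2) by apply pow2_ge_0; nra.
Qed.

Lemma response_far (s : R) : 2 <= Rabs (s - 21 / 10) -> 0 <= response_H s -> response s = response_H s.
Proof.
intros h hp; unfold response; rewrite corr1_out by exact h.
rewrite Rmult_0_r; replace (0 ^ 2) with 0 by ring; rewrite Rplus_0_r; apply sqrt_pow2; exact hp.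
Qed.

(** A bound 0 or 1 in its calls marks a side where a crude estimate is enough. *)
Ltac pot a lo hi := generalize (potential_bump_between a lo hi ltac:(lra) ltac:(lra) ltac:(lra)).

Lemma response_H_0 : response_H 0 = 2 * (potential_bump (11 / 10) + potential_bump (31 / 10)).
Proof.
unfold response_H.
replace (0 + 11 / 10) with (11 / 10) by ring; replace (0 + 31 / 10) with (31 / 10) by ring.
replace (0 - 31 / 10) with (- (31 / 10)) by ring; replace (0 - 11 / 10) with (- (11 / 10)) by ring.
rewrite !hilbert_bump_neg by lra; ring.
Qed.

Lemma response_H_9_100 (s : R) : s = 9 / 100 \/ s = - (9 / 100) -> response_H s =
  potential_bump (11 / 10 + 9 / 100) + potential_bump (11 / 10 - 9 / 100)
  + (potential_bump (31 / 10 + 9 / 100) + potential_bump (31 / 10 - 9 / 100)).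
Proof.
intros [-> | ->]; unfold response_H.
- replace (9 / 100 - 31 / 10) with (- (31 / 10 - 9 / 100)) by ring.
  replace (9 / 100 - 11 / 10) with (- (11 / 10 - 9 / 100)) by ring.
  rewrite !hilbert_bump_neg, (Rplus_comm (9 / 100)), (Rplus_comm (9 / 100)) by lra; ring.
- replace (- (9 / 100) - 31 / 10) with (- (31 / 10 + 9 / 100)) by ring.
  replace (- (9 / 100) - 11 / 10) with (- (11 / 10 + 9 / 100)) by ring.
  replace (- (9 / 100) + 31 / 10) with (31 / 10 - 9 / 100) by ring.
  replace (- (9 / 100) + 11 / 10) with (11 / 10 - 9 / 100) by ring.
  rewrite !hilbert_bump_neg by lra; ring.
Qed.

(** The correlation vanishes at these delays and [H] is even, so the side values agree, and both
    exceed the centre by convexity of the potentials at [11/10] and [31/10]. The centre clears the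
    upper bound [167/100] for [P] by less than [3/1000]. *)
Lemma response_around_0 : response (- (9 / 100)) = response (9 / 100) /\
  response 0 < response (9 / 100) /\ 167 / 100 < response 0.
Proof.
assert (c1 := potential_bump_convex (11 / 10) (9 / 100) ltac:(lra) ltac:(lra) ltac:(lra)).
assert (c2 := potential_bump_convex (31 / 10) (9 / 100) ltac:(lra) ltac:(lra) ltac:(lra)).
assert (a1 := potential_bump_between (11 / 10) (6173 / 10000) 1 ltac:(lra) ltac:(lra) ltac:(lra)).
assert (a2 := potential_bump_between (31 / 10) (2190 / 10000) 1 ltac:(lra) ltac:(lra) ltac:(lra)).
assert (e0 := response_H_0).
assert (e1 := response_H_9_100 (9 / 100) (or_introl eq_refl)).
assert (e2 := response_H_9_100 (- (9 / 100)) (or_intror eq_refl)).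
rewrite !response_far; try (unfold Rabs; destruct Rcase_abs); lra.
Qed.

Lemma corr1_bump (u : R) : 0 <= u -> corr1 u = bump (u - 1).
Proof. intro h; unfold corr1; rewrite (bump_out (u + 1)); [ring|rewrite Rabs_right; lra]. Qed.

Lemma corr1_side (s : R) : s - 21 / 10 = - (109 / 100) \/ s - 21 / 10 = - (91 / 100) \/
  s - 21 / 10 = 91 / 100 \/ s - 21 / 10 = 109 / 100 -> corr1 (s - 21 / 10) = bump (9 / 100).
Proof.
intros [->|[->|[->| ->]]]; rewrite ?corr1_even, corr1_bump by lra;
  [| rewrite <- bump_even | rewrite <- bump_even |]; f_equal; field.
Qed.

Lemma corr1_peak (s : R) : s - 21 / 10 = - (1) \/ s - 21 / 10 = 1 -> corr1 (s - 21 / 10) = 1.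
Proof.
assert (b0 : bump (1 - 1) = 1).
{ rewrite bump_in by lra; replace (PI * (1 - 1) / 2) with 0 by field; rewrite cos_0; ring. }
intros [->| ->]; rewrite ?corr1_even, corr1_bump by lra; exact b0.
Qed.

Lemma response_H_neg_arg (s a b c d : R) :
  s + 11 / 10 = a -> s + 31 / 10 = b -> s - 31 / 10 = - c -> s - 11 / 10 = d -> 
  response_H s = potential_bump a + potential_bump b + hilbert_bump c - hilbert_bump d.
Proof.
intros <- <- h <-; unfold response_H; rewrite h, hilbert_bump_odd; ring.
Qed.

(** The correlation is symmetric about the centre, so [H] orders the side values through the odd
    term [hilbert_bump], which raises [H] at [101/100] and lowers it at [119/100]. On the left the
    gain in [H ^ 2], about [1.03], must beat the loss of at most [0.97] in [Q ^ 2]. *)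
Lemma response_around_11_10 : response (119 / 100) < response (11 / 10) /\
  response (11 / 10) < response (101 / 100) /\ 2 < response (119 / 100).
Proof.
assert (q := bump_9_100_bounds); destruct PI_bounds as [p1 p2].
assert (hl := hilbert_bump_9_100_lower); assert (hu := hilbert_bump_9_100_upper).
assert (h0 : hilbert_bump 0 = 0).
{ assert (e := hilbert_bump_odd 0); rewrite Ropp_0 in e; lra. }
assert (e1 := response_H_neg_arg (101 / 100) (211 / 100) (411 / 100) (209 / 100) (- (9 / 100))
  ltac:(field) ltac:(field) ltac:(field) ltac:(field)).
assert (e2 := response_H_neg_arg (11 / 10) (22 / 10) (42 / 10) 2 0
  ltac:(field) ltac:(field) ltac:(field) ltac:(field)).
assert (e3 := response_H_neg_arg (119 / 100) (229 / 100) (429 / 100) (191 / 100) (9 / 100)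
  ltac:(field) ltac:(field) ltac:(field) ltac:(field)).
rewrite hilbert_bump_odd in e1; rewrite h0 in e2.
rewrite (hilbert_potential (209 / 100)) in e1 by lra; rewrite (hilbert_potential 2) in e2 by lra.
rewrite (hilbert_potential (191 / 100)) in e3 by lra.
pot (211 / 100) (321 / 1000) 1; pot (411 / 100) (165 / 1000) 1; pot (209 / 100) (324 / 1000) 1.
pot (22 / 10) (308 / 1000) (316 / 1000); pot (42 / 10) (161 / 1000) (163 / 1000); pot 2 (339 / 1000) (349 / 1000).
pot (229 / 100) (296 / 1000) (303 / 1000); pot (429 / 100) (158 / 1000) (160 / 1000); pot (191 / 100) (355 / 1000) (367 / 1000).
intros.
assert (b1 : 1310 / 1000 <= response_H (101 / 100)) by lra.
assert (b2 : 0 <= response_H (11 / 10) <= 828 / 1000) by lra.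
assert (b3 : - (4 / 100) <= response_H (119 / 100) <= 4 / 10) by lra.
assert (hp := PI_sqr_bounds).
assert (hq : PI ^ 2 * (902 / 1000) <= PI ^ 2 * bump (9 / 100) ^ 2 <= PI ^ 2 * (907 / 1000)).
{ destruct bump_9_100_sqr_bounds; split; apply Rmult_le_compat_l; lra. }
repeat apply conj.
- apply response_lt_response; rewrite (corr1_side (119 / 100)), (corr1_peak (11 / 10)) by lra.
  rewrite !Rpow_mult_distr, pow1.
  assert (response_H (119 / 100) ^ 2 <= 2 / 10) by nra.
  assert (0 <= response_H (11 / 10) ^ 2) by apply pow2_ge_0; lra.
- apply response_lt_response; rewrite (corr1_side (101 / 100)), (corr1_peak (11 / 10)) by lra.
  rewrite !Rpow_mult_distr, pow1.
  assert (response_H (11 / 10) ^ 2 <= (828 / 1000) ^ 2) by (apply pow_incr; lra).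
  assert ((131 / 100) ^ 2 <= response_H (101 / 100) ^ 2) by (apply pow_incr; lra); lra.
- apply Rlt_le_trans with (2 := response_ge _); rewrite corr1_side by lra.
  apply Rlt_le_trans with (3 * (950 / 1000)); [lra|apply Rmult_le_compat; lra].
Qed.

(** At the centre the two principal values at distance 1 cancel. On each side, one term at [91/100]
    and one at [109/100] have opposite signs; the tightest bound is [1227/1000] at [219/100],
    against [128/100] for [P]. *)
Lemma response_around_21_10 (p : R) : 128 / 100 <= p ->
  response (201 / 100) < p /\ response (21 / 10) < p /\ response (219 / 100) < p.
Proof.
intro hp; destruct PI_bounds as [p1 p2].
assert (hl := hilbert_bump_pos (91 / 100) ltac:(lra)); assert (hu := hilbert_bump_91_100_upper).
assert (e1 := response_H_neg_arg (201 / 100) (311 / 100) (511 / 100) (109 / 100) (91 / 100)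
  ltac:(field) ltac:(field) ltac:(field) ltac:(field)).
assert (e2 := response_H_neg_arg (21 / 10) (32 / 10) (52 / 10) 1 1
  ltac:(field) ltac:(field) ltac:(field) ltac:(field)).
assert (e3 := response_H_neg_arg (219 / 100) (329 / 100) (529 / 100) (91 / 100) (109 / 100)
  ltac:(field) ltac:(field) ltac:(field) ltac:(field)).
rewrite (hilbert_potential (109 / 100)) in e1 by lra; rewrite (hilbert_potential (109 / 100)) in e3 by lra.
pot (311 / 100) (218 / 1000) (221 / 1000); pot (511 / 100) (132 / 1000) (134 / 1000).
pot (32 / 10) 0 (215 / 1000); pot (52 / 10) 0 (132 / 1000).
pot (329 / 100) (206 / 1000) (209 / 1000); pot (529 / 100) (128 / 1000) (129 / 1000).
pot (109 / 100) (622 / 1000) 1; generalize (potential_bump_le (109 / 100) ltac:(lra)); intros.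
assert (b1 : - (6 / 10) <= response_H (201 / 100) <= 111 / 100) by lra.
assert (b2 : 0 <= response_H (21 / 10) <= 4 / 10) by lra.
assert (b3 : - (6 / 10) <= response_H (219 / 100) <= 1227 / 1000) by lra.
assert (near := bump_near_1 (91 / 100) ltac:(lra)); assert (nearp := bump_pos (91 / 100)).
assert (sq : forall x, - (6 / 10) <= x <= 1227 / 1000 -> x ^ 2 <= 1506 / 1000) by (intros; nra).
assert (cs : (PI * bump (91 / 100)) ^ 2 <= 1 / 1000).
{ apply Rle_trans with ((1 / 100) ^ 2); [apply pow_incr; split; [apply Rmult_le_pos; lra|]|lra].
  apply Rle_trans with (4 * (2 / 1000)); [apply Rmult_le_compat; lra|lra]. }
assert (hp2 : (128 / 100) ^ 2 <= p ^ 2) by (apply pow_incr; lra).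
repeat apply conj; (apply response_lt; [lra|]).
- replace (201 / 100 - 21 / 10) with (- (9 / 100)) by field.
  rewrite corr1_even, corr1_bump by lra; replace (9 / 100 - 1) with (- (91 / 100)) by field.
  rewrite bump_even; assert (response_H (201 / 100) ^ 2 <= 1506 / 1000) by (apply sq; lra); lra.
- replace (21 / 10 - 21 / 10) with 0 by ring.
  rewrite corr1_bump by lra; rewrite bump_out by (rewrite Rabs_left; lra).
  rewrite Rmult_0_r; replace (0 ^ 2) with 0 by ring.
  assert (response_H (21 / 10) ^ 2 <= 1506 / 1000) by (apply sq; lra); lra.
- replace (219 / 100 - 21 / 10) with (9 / 100) by field.
  rewrite corr1_bump by lra; replace (9 / 100 - 1) with (- (91 / 100)) by field.
  rewrite bump_even; assert (response_H (219 / 100) ^ 2 <= 1506 / 1000) by (apply sq; lra); lra.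
Qed.

(** Beside the peak [Q ^ 2] drops by more than [0.91], while [H ^ 2] is at most [0.829] there, so
    the sign and size of [H] at the peak are immaterial. *)
Lemma response_around_31_10 : response (301 / 100) < response (31 / 10) /\
  response (319 / 100) < response (31 / 10) /\
  2 < response (301 / 100) /\ 2 < response (319 / 100).
Proof.
assert (q := bump_9_100_bounds); destruct PI_bounds as [p1 p2].
assert (hl := hilbert_bump_9_100_lower); assert (hu := hilbert_bump_9_100_upper).
assert (e1 := response_H_neg_arg (301 / 100) (411 / 100) (611 / 100) (9 / 100) (191 / 100)
  ltac:(field) ltac:(field) ltac:(field) ltac:(field)).
assert (e2 := response_H_neg_arg (319 / 100) (429 / 100) (629 / 100) (- (9 / 100)) (209 / 100)
  ltac:(field) ltac:(field) ltac:(field) ltac:(field)).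
rewrite hilbert_bump_odd in e2.
rewrite (hilbert_potential (191 / 100)) in e1 by lra; rewrite (hilbert_potential (209 / 100)) in e2 by lra.
pot (411 / 100) (165 / 1000) (167 / 1000); pot (611 / 100) (111 / 1000) (112 / 1000); pot (191 / 100) (355 / 1000) (367 / 1000).
pot (429 / 100) (158 / 1000) (160 / 1000); pot (629 / 100) (107 / 1000) (109 / 1000); pot (209 / 100) (324 / 1000) (333 / 1000).
intros.
assert (b1 : - (91 / 100) <= response_H (301 / 100) <= 91 / 100) by lra.
assert (b2 : - (91 / 100) <= response_H (319 / 100) <= 91 / 100) by lra.
assert (hp := PI_sqr_bounds).
assert (hq : PI ^ 2 * (902 / 1000) <= PI ^ 2 * bump (9 / 100) ^ 2 <= PI ^ 2 * (907 / 1000)).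
{ destruct bump_9_100_sqr_bounds; split; apply Rmult_le_compat_l; lra. }
assert (sq : forall x, - (91 / 100) <= x <= 91 / 100 -> x ^ 2 <= 829 / 1000) by (intros; nra).
assert (main : forall s, - (91 / 100) <= response_H s <= 91 / 100 ->
  corr1 (s - 21 / 10) = bump (9 / 100) -> response s < response (31 / 10) /\ 2 < response s).
{ intros s hs es; split.
  - apply response_lt_response; rewrite es, corr1_peak by lra.
    rewrite !Rpow_mult_distr, pow1; generalize (sq _ hs) (pow2_ge_0 (response_H (31 / 10))); lra.
  - apply Rlt_le_trans with (2 := response_ge _); rewrite es.
    apply Rlt_le_trans with (3 * (950 / 1000)); [lra|apply Rmult_le_compat; lra]. }
destruct (main _ b1 (corr1_side (301 / 100) ltac:(lra))).
destruct (main _ b2 (corr1_side (319 / 100) ltac:(lra))); auto.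
Qed.

Lemma potential_bump_far (a : R) : 3 <= a -> 0 <= potential_bump a <= 1 / 4.
Proof.
intro ha; apply potential_bump_between; [lra|lra|].
assert (8 <= a ^ 2 - 1) by nra; set (d := a ^ 2 - 1) in *; clearbody d; nra.
Qed.

(** The correlation vanishes and all four arguments lie outside the bump. Only [s - 31/10] is close
    to 1, and [potential_bump_le] controls that term. *)
Lemma response_around_42_10 (s p : R) : 411 / 100 <= s <= 429 / 100 -> 128 / 100 <= p -> response s < p.
Proof.
intros hs hp; apply response_lt; [lra|].
rewrite corr1_out by (rewrite Rabs_right; lra).
rewrite Rmult_0_r; replace (0 ^ 2) with 0 by ring.
assert (b : - (11 / 10) <= response_H s <= 11 / 10); [|nra].
unfold response_H; rewrite !hilbert_potential by lra.
assert (a1 := potential_bump_far (s + 11 / 10) ltac:(lra)).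
assert (a2 := potential_bump_far (s + 31 / 10) ltac:(lra)).
assert (a3 := potential_bump_far (s - 11 / 10) ltac:(lra)).
assert (a4 := potential_bump_le (s - 31 / 10) ltac:(lra)).
assert (a5 := potential_bump_lower (s - 31 / 10) ltac:(lra)).
assert (0 <= 32 / (15 * PI) / (s - 31 / 10)); [|lra].
generalize PI_RGT_0; intro; repeat apply Rdiv_le_0_compat; lra.
Qed.

Theorem mainTheorem2 (T : R) (hT : 0 < T)
    (Gamma lambda : R) (hGamma : 0 < Gamma) (hlambda : lambda <> 0) :
  let Omega := 3 * PI / (2 * T) in
  let L := 21 / 10 * T in
  let delta := 9 / 100 * T in
  let g0 := fun tau =>
    Gamma * lambda ^ 2 * gbar (cos2_pulse T) T Omega L tau in
  let gp := fun tau =>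
    Gamma * lambda ^ 2 * gbar (cos2_pulse T) T Omega L (tau + delta) in
  let gm := fun tau =>
    Gamma * lambda ^ 2 * gbar (cos2_pulse T) T Omega L (tau - delta) in
  (forall tau, tau = 0 ->
     gm tau = gp tau /\ gp tau > g0 tau /\ g0 tau > 0 /\
     N_THP (g0 tau) (gp tau) (gm tau) 7) /\
  (forall tau, tau = L - T ->
     gm tau > g0 tau /\ g0 tau > gp tau /\ gp tau > 0 /\
     N_THP (g0 tau) (gp tau) (gm tau) 3) /\
  (forall tau, tau = L ->
     gm tau < 0 /\ g0 tau < 0 /\ gp tau < 0 /\
     N_THP (g0 tau) (gp tau) (gm tau) 1) /\
  (forall tau, tau = L + T ->
     g0 tau > Rmax (gm tau) (gp tau) /\ Rmin (gm tau) (gp tau) > 0 /\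
     N_THP (g0 tau) (gp tau) (gm tau) 7) /\
  (forall tau, tau = 2 * L ->
     gm tau < 0 /\ g0 tau < 0 /\ gp tau < 0 /\
     N_THP (g0 tau) (gp tau) (gm tau) 1).
Proof.
intros Omega L delta g0 gp gm.
destruct (resp_P_bounds T hT) as (l & hl & hP).
assert (pi := PI_bounds); assert (hpi := PI_RGT_0).
set (p := 63 * PI * l).
(* These two thresholds for [P] are all that the sign comparisons use. *)
assert (hp : 128 / 100 <= p <= 167 / 100) by (unfold p; split; nra).
(* A common positive factor: every reward is [k * (response sigma - p)], so signs and order are
   those of [response] relative to [p]. *)
set (k := Gamma * lambda ^ 2 / (252 * PI ^ 3)).
assert (hk : 0 < k).
{ apply Rdiv_lt_0_compat; [apply Rmult_lt_0_compat; [exact hGamma|]|].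
  - rewrite <- Rsqr_pow2; apply Rlt_0_sqr; exact hlambda.
  - apply Rmult_lt_0_compat; [lra|apply pow_lt; lra]. }
assert (val : forall sigma tau, - (9 / 100) <= sigma <= 5 -> tau = sigma * T ->
  Gamma * lambda ^ 2 * gbar (cos2_pulse T) T Omega L tau = k * (response sigma - p)).
{ intros sigma tau hs ->; unfold Omega, L; rewrite (gbar_response T sigma l hT hs hP).
  unfold k, p; field; lra. }
assert (lt : forall x y, x < y -> k * (x - p) < k * (y - p)) by (intros; apply Rmult_lt_compat_l; lra).
assert (pos : forall x, p < x -> 0 < k * (x - p)) by (intros; apply Rmult_lt_0_compat; lra).
assert (neg : forall x, x < p -> k * (x - p) < 0) by (intros x hx; specialize (lt _ _ hx); lra).
assert (game : forall sm s0 sp tau, - (9 / 100) <= sm <= 5 -> - (9 / 100) <= s0 <= 5 -> - (9 / 100) <= sp <= 5 ->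
  tau - delta = sm * T -> tau = s0 * T -> tau + delta = sp * T ->
  gm tau = k * (response sm - p) /\ g0 tau = k * (response s0 - p) /\ gp tau = k * (response sp - p)).
{ intros; unfold gm, g0, gp; repeat apply conj; apply val; assumption. }
repeat apply conj; intros tau htau.
- destruct (game (- (9 / 100)) 0 (9 / 100) tau) as (-> & -> & ->);
    try lra; try (unfold delta; lra).
  destruct response_around_0 as (e & h1 & h2); rewrite e.
  assert (h3 := lt _ _ h1); assert (h4 := pos (response 0) ltac:(lra)).
  repeat apply conj; try lra; apply N_THP_anticoordination_game; lra.
- destruct (game (101 / 100) (11 / 10) (119 / 100) tau) as (-> & -> & ->);
    try lra; try (unfold delta, L in *; lra).
  destruct response_around_11_10 as (h1 & h2 & h3).
  apply lt in h1; apply lt in h2; assert (h4 := pos (response (119 / 100)) ltac:(lra)).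
  repeat apply conj; try lra; apply N_THP_leader_game; lra.
- destruct (game (201 / 100) (21 / 10) (219 / 100) tau) as (-> & -> & ->);
    try lra; try (unfold delta, L in *; lra).
  destruct (response_around_21_10 p ltac:(lra)) as (h1 & h2 & h3).
  apply neg in h1; apply neg in h2; apply neg in h3.
  repeat apply conj; try lra; apply N_THP_negative_rewards; lra.
- destruct (game (301 / 100) (31 / 10) (319 / 100) tau) as (-> & -> & ->);
    try lra; try (unfold delta, L in *; lra).
  destruct response_around_31_10 as (h1 & h2 & h3 & h4).
  apply lt in h1; apply lt in h2.
  assert (h5 := pos (response (301 / 100)) ltac:(lra)); assert (h6 := pos (response (319 / 100)) ltac:(lra)).
  repeat apply conj; [apply Rmax_lub_lt; lra|apply Rmin_glb_lt; lra|apply N_THP_coordination_game; lra].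
- destruct (game (411 / 100) (42 / 10) (429 / 100) tau) as (-> & -> & ->);
    try lra; try (unfold delta, L in *; lra).
  assert (h1 := neg _ (response_around_42_10 (411 / 100) p ltac:(lra) ltac:(lra))).
  assert (h2 := neg _ (response_around_42_10 (42 / 10) p ltac:(lra) ltac:(lra))).
  assert (h3 := neg _ (response_around_42_10 (429 / 100) p ltac:(lra) ltac:(lra))).
  repeat apply conj; try lra; apply N_THP_negative_rewards; lra.
Qed.
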